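(* Let $\beta>0$ and $\omega_n=\sqrt{n\tanh(\beta n)/\beta}$ for $n\in\mathbb N^*=\{1,2,\dots\}$. The spectrum of the conservative operator $\mathcal A$ is purely discrete and is given by $$\sigma(\mathcal A)=\{0\}\cup\{\pm i\omega_n:n\in\mathbb N^*\}.$$ Moreover, $$\ker(\mathcal A)=\operatorname{span}\left\{\binom10,\binom01\right\},$$ and, for every $n\in\mathbb N^*$, $$\ker(\pm i\omega_nI-\mathcal A)=\left\{\begin{pmatrix}c_+e^{inx}+c_-e^{-inx}\\ \mp\frac{n}{\omega_n}\left(c_+e^{inx}-c_-e^{-inx}\right)\end{pmatrix}:c_+,c_-\in\mathbb C\right\}.$$ In particular, $0$ and each eigenvalue $\pm i\omega_n$, $n\in\mathbb N^*$, have geometric multiplicity two. Since $\mathcal A$ is normal, their algebraic multiplicities coincide with their geometric multiplicities. Furthermore, the spectrum has no finite accumulation point.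
   Context: $\mathbb T=\mathbb R/(2\pi\mathbb Z)$; functions are complex valued. Fourier convention: $\widehat v(k)=\frac1{2\pi}\int_{\mathbb T}v(x)e^{-ikx}dx$, $k\in\mathbb Z$. $\langle k\rangle=(1+k^2)^{1/2}$ and $\|v\|_{H^s}^2=2\pi\sum_k\langle k\rangle^{2s}|\widehat v(k)|^2$. Fourier multipliers: $\widehat{T_\beta v}(k)=-im_\beta(k)\widehat v(k)$ with $m_\beta(k)=\tanh(\beta k)/\beta$; $\widehat{P_\beta v}(k)=p_\beta(k)\widehat v(k)$ with $p_\beta(k)=\frac{\tanh(\beta k)}{\beta k}$ for $k\ne0$ and $p_\beta(0)=1$. Energy space: $\mathcal H=L^2(\mathbb T)\times H^{-1/2}(\mathbb T)$ with inner product $\langle(h,u),(\varphi,\psi)\rangle_{\mathcal H}=\langle h,\varphi\rangle_{L^2}+\langle P_\beta u,\psi\rangle_{H^{1/2},H^{-1/2}}=2\pi\sum_k\widehat h(k)\overline{\widehat\varphi(k)}+2\pi\sum_kp_\beta(k)\widehat u(k)\overline{\widehat\psi(k)}$. Conservative operator on $\mathcal H$: $\mathcal A(h,u)=(T_\beta u,-h_x)$ with domain $D(\mathcal A)=H^{1/2}(\mathbb T)\times L^2(\mathbb T)$. ''Purely discrete'' means that the spectrum consists only of isolated eigenvalues of finite algebraic multiplicity. *)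

(* Defs.v *)
From HB Require Import structures.
From mathcomp Require Import all_boot all_order all_algebra.
From mathcomp Require Import complex ring.
From mathcomp Require Import all_classical all_reals all_analysis.

Set Implicit Arguments.
Unset Strict Implicit.
Unset Printing Implicit Defensive.

Import Order.TTheory GRing.Theory Num.Theory.
Import numFieldNormedType.Exports.

Local Open Scope classical_set_scope.
Local Open Scope ring_scope.

Notation normc := ComplexField.Normc.normc.

(* A subspace hspace of V with an inner product, linear in the first argument;
   inner is only meaningful on hspace. *)
Record inner_space (R : realType) (V : lmodType R[i]) := InnerSpace {
  hspace : set V ;
  inner : V -> V -> R[i] }.

(* Only the restriction of app to dom matters. *)
Record operator (R : realType) (V : lmodType R[i]) := Operator {
  dom : set V ;
  app : V -> V }.

Section operators.
Context {R : realType} {V : lmodType R[i]}.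
Implicit Types (H : inner_space V) (A : operator V) (l : R[i]).

Definition hnorm H (x : V) : R := Num.sqrt (complex.Re (inner H x x)).

Definition shift_op l A : operator V := Operator (dom A) (fun x => l *: x - app A x).

Definition ker_op A : set V := [set x | dom A x /\ app A x = 0].

(* l I - A is a bijection from its domain onto H, with bounded inverse. *)
Definition resolvent_set H A : set R[i] := [set l |
  [/\ forall x, dom A x -> hspace H (app (shift_op l A) x),
      forall y, hspace H y ->
        exists! x, dom A x /\ app (shift_op l A) x = y
    & exists K : R, forall x, dom A x ->
        hnorm H x <= K * hnorm H (app (shift_op l A) x)]].

Definition spectrum H A : set R[i] := ~` resolvent_set H A.

Definition is_eigenvalue A l : Prop := exists x, [/\ x != 0, dom A x & app A x = l *: x].

Definition has_dim (S : set V) (d : nat) : Prop :=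
  exists b : 'I_d -> V,
    (forall c : 'I_d -> R[i], \sum_i c i *: b i = 0 -> forall i, c i = 0) /\
    S = [set x | exists c : 'I_d -> R[i], x = \sum_i c i *: b i].

(* The kernel of A ^ j, where dom (A ^ j.+1) = {x in dom A | A x in dom (A ^ j)}. *)
Fixpoint ker_pow A (j : nat) : set V :=
  if j is j'.+1 then [set x | dom A x /\ ker_pow A j' (app A x)] else [set 0].

Definition root_space A l : set V := \bigcup_j ker_pow (shift_op l A) j.

Definition geometric_multiplicity A l (d : nat) : Prop := has_dim (ker_op (shift_op l A)) d.

Definition algebraic_multiplicity A l (d : nat) : Prop := has_dim (root_space A l) d.

(* R[i]^o is R[i] with the topology of its modulus. *)
Definition purely_discrete H A : Prop := forall l, spectrum H A l ->
  [/\ isolated (spectrum H A : set R[i]^o) l, is_eigenvalue A l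
    & exists d, algebraic_multiplicity A l d].

Definition densely_defined H A : Prop := dom A `<=` hspace H /\
  forall x, hspace H x -> forall e : R, 0 < e ->
    exists2 y, dom A y & hnorm H (x - y) < e.

Definition closed_op H A : Prop := forall (u : nat -> V) (x y : V),
  (forall n, dom A (u n)) -> hspace H x -> hspace H y ->
  hnorm H (u n - x) @[n --> \oo] --> (0 : R) ->
  hnorm H (app A (u n) - y) @[n --> \oo] --> (0 : R) ->
  dom A x /\ app A x = y.

Definition graph_op A (x y : V) : Prop := dom A x /\ app A x = y.

Definition graph_adj H A (y z : V) : Prop :=
  [/\ hspace H y, hspace H z
    & forall x, dom A x -> inner H (app A x) y = inner H x z].

(* A is densely defined and closed, and A^* A = A A^*, domains included. *)
Definition normal_op H A : Prop :=
  [/\ densely_defined H A, closed_op H A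
    & forall x z, (exists2 y, graph_op A x y & graph_adj H A y z) <->
                  (exists2 y, graph_adj H A x y & graph_op A y z)].

End operators.

Section smooth.
Context {R : realType}.
Implicit Types f g : R -> R.

Definition smooth f : Prop := forall n x, derivable (derive1n n f) x 1.

Lemma derive1n_shift f n m : derive1n m (derive1n n f) = derive1n (m + n) f.
Proof. by rewrite /derive1n iterD. Qed.

Lemma smooth_derive1 f : smooth f -> smooth (derive1 f).
Proof.
move=> sf n x; have := sf n.+1 x.
by rewrite -[derive1 f]/(derive1n 1 f) derive1n_shift addn1.
Qed.

Lemma smooth_continuous f : smooth f -> continuous f.
Proof.
move=> sf x; apply: differentiable_continuous; apply/derivable1_diffP.
exact: (sf 0%N x).
Qed.

Lemma derive1nD f g (a b : R) n : smooth f -> smooth g ->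
  derive1n n (fun x => a * f x + b * g x) = (fun x => a * derive1n n f x + b * derive1n n g x).
Proof.
move=> sf sg; elim: n => [//|n IH].
rewrite derive1nS IH; apply/funext => x; rewrite !derive1nS !derive1E.
have df : derivable (a *: (derive1n n f : R -> R)) x 1 by apply: derivableZ; exact: sf.
have dg : derivable (b *: (derive1n n g : R -> R)) x 1 by apply: derivableZ; exact: sg.
have -> : (fun x0 : R => a * derive1n n f x0 + b * derive1n n g x0) =
  (a *: (derive1n n f : R -> R)) + (b *: (derive1n n g : R -> R)) by [].
by rewrite (deriveD df dg) (deriveZ a (sf n x)) (deriveZ b (sg n x)).
Qed.

Lemma smoothD f g (a b : R) : smooth f -> smooth g ->
  smooth (fun x => a * f x + b * g x).
Proof.
move=> sf sg n x; rewrite derive1nD//.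
have -> : (fun x0 : R => a * derive1n n f x0 + b * derive1n n g x0) =
  (a *: (derive1n n f : R -> R)) + (b *: (derive1n n g : R -> R)) by [].
by apply: derivableD; apply: derivableZ; [exact: sf | exact: sg].
Qed.

Lemma smooth_cst (a : R) : smooth (fun=> a).
Proof.
move=> n x; suff [b ->] : exists b : R, derive1n n (fun=> a : R) = (fun=> b) by apply: derivable_cst.
elim: n => [|n [b IH]]; first by exists a.
exists 0; rewrite derive1nS IH; apply/funext => y.
by rewrite derive1E derive_cst.
Qed.

Lemma derive1_periodic f (T : R) :
  periodic f T -> periodic (derive1 f) T.
Proof.
move=> pf x; rewrite /derive1 /=.
suff -> : (fun h : R => h^-1 *: (f (h + (x + T)) - f (x + T))) =
  (fun h : R => h^-1 *: (f (h + x) - f x)) by [].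
by apply/funext => h; rewrite addrA !pf.
Qed.

Lemma is_derive_trig (w a b x : R) :
  is_derive x 1 (fun y => a * cos (w * y) + b * sin (w * y))
    ((b * w) * cos (w * x) + (- (a * w)) * sin (w * x)).
Proof.
have hw : is_derive x 1 (w \*: (id : R -> R)) (w *: 1) by apply: is_deriveZ.
have hc : is_derive x 1 (cos \o (w \*: (id : R -> R))) _ :=
  is_derive1_comp (is_derive_cos _) hw.
have hs : is_derive x 1 (sin \o (w \*: (id : R -> R))) _ :=
  is_derive1_comp (is_derive_sin _) hw.
apply: (is_derive_eq (is_deriveD (is_deriveZ a hc) (is_deriveZ b hs))).
rewrite -![_ *: _]/(_ * _) /=; ring.
Qed.

Lemma smooth_trig (w a b : R) :
  smooth (fun y => a * cos (w * y) + b * sin (w * y)).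
Proof.
move=> n x; suff [c [d ->]] : exists c d : R,
    derive1n n (fun y => a * cos (w * y) + b * sin (w * y)) =
    (fun y => c * cos (w * y) + d * sin (w * y)).
  by have [] := is_derive_trig w c d x.
elim: n => [|n [c [d IH]]]; first by exists a, b.
exists (d * w), (- (c * w)); rewrite derive1nS IH; apply/funext => y.
by rewrite derive1E; have [_ ->] := is_derive_trig w c d y.
Qed.

End smooth.

Section test_functions.
Context {R : realType}.
Implicit Types (f g : R -> R[i]^o) (a : R[i]).

Definition reF f : R -> R := fun x => complex.Re (f x).
Definition imF f : R -> R := fun x => complex.Im (f x).

Definition test_pred : {pred R -> R[i]^o} := fun f =>
  `[< [/\ periodic f (2 * pi), smooth (reF f) & smooth (imF f)] >].

(* The elements of C^oo(T), T = R / 2 pi Z. *)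
Record testfun := TestFun {
  testfun_val : R -> R[i]^o ;
  testfun_prop : testfun_val \in test_pred }.

Lemma test_predP f : reflect
  [/\ periodic f (2 * pi), smooth (reF f) & smooth (imF f)]
  (f \in test_pred).
Proof. exact: asboolP. Qed.

Lemma ReZD a (z w : R[i]) : complex.Re (a * z + w) =
  complex.Re a * complex.Re z - complex.Im a * complex.Im z + complex.Re w.
Proof. by case: a z w => [? ?] [? ?] [? ?]. Qed.

Lemma ImZD a (z w : R[i]) : complex.Im (a * z + w) =
  complex.Re a * complex.Im z + complex.Im a * complex.Re z + complex.Im w.
Proof. by case: a z w => [? ?] [? ?] [? ?]. Qed.

Lemma reF_lin a f g : reF (a *: f + g) = (fun x => 1 *
  (complex.Re a * reF f x + - complex.Im a * imF f x) + 1 * reF g x).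
Proof. by apply/funext => x; rewrite /reF ReZD !mul1r mulNr. Qed.

Lemma imF_lin a f g : imF (a *: f + g) = (fun x => 1 *
  (complex.Re a * imF f x + complex.Im a * reF f x) + 1 * imF g x).
Proof. by apply/funext => x; rewrite /imF ImZD !mul1r. Qed.

Lemma test_submod_closed : submod_closed test_pred.
Proof.
split; first by apply/test_predP; split=> //; exact: smooth_cst.
move=> a f g /test_predP[pf rf jf] /test_predP[pg rg jg]; apply/test_predP; split.
- by move=> x; rewrite !fctE pf pg.
- by rewrite reF_lin; apply: (@smoothD _ _ _ 1 1 _ rg); exact: (@smoothD _ _ _ _ _ rf jf).
- by rewrite imF_lin; apply: (@smoothD _ _ _ 1 1 _ jg); exact: (@smoothD _ _ _ _ _ jf rf).
Qed.

HB.instance Definition _ := GRing.isSubmodClosed.Build _ _ test_pred test_submod_closed.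
HB.instance Definition _ := [isSub for testfun_val].
HB.instance Definition _ := [Choice of testfun by <:].
HB.instance Definition _ := [SubChoice_isSubLmodule of testfun by <:].

Definition testfun_fun (phi : testfun) : R -> R[i] := testfun_val phi.
Coercion testfun_fun : testfun >-> Funclass.

Lemma testfunP (phi : testfun) :
  [/\ periodic phi (2 * pi), smooth (reF phi) & smooth (imF phi)].
Proof. exact/test_predP/testfun_prop. Qed.

Definition tderiv_val (phi : testfun) : R -> R[i]^o :=
  fun x => Complex (derive1 (reF phi) x) (derive1 (imF phi) x).

Lemma tderiv_subproof (phi : testfun) : tderiv_val phi \in test_pred.
Proof.
have [pphi rphi jphi] := testfunP phi; apply/test_predP; split.
- move=> x; rewrite /tderiv_val !(@derive1_periodic _ _ (2 * pi))//.
  + by move=> y; rewrite /imF pphi.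
  + by move=> y; rewrite /reF pphi.
- exact: smooth_derive1.
- exact: smooth_derive1.
Qed.

Definition tderiv (phi : testfun) : testfun := TestFun (tderiv_subproof phi).

Lemma tderiv_lin a (phi psi : testfun) : tderiv (a *: phi + psi) = a *: tderiv phi + tderiv psi.
Proof.
have [_ r1 j1] := testfunP phi; have [_ r2 j2] := testfunP psi.
apply/val_inj/funext => x; rewrite /= /tderiv_val.
have D1 (f g : R -> R) (b c : R) : smooth f -> smooth g ->
    derive1 (fun x => b * f x + c * g x) x = b * derive1 f x + c * derive1 g x.
  by move=> sf sg; rewrite -[derive1 _]/(derive1n 1 _) derive1nD.
have -> : reF (a *: phi + psi) = reF (a *: (phi : R -> R[i]^o) + (psi : R -> R[i]^o)) by [].
have -> : imF (a *: phi + psi) = imF (a *: (phi : R -> R[i]^o) + (psi : R -> R[i]^o)) by [].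
rewrite reF_lin imF_lin.
rewrite (D1 _ _ _ _ (@smoothD _ _ _ _ _ r1 j1) r2) (D1 _ _ _ _ (@smoothD _ _ _ _ _ j1 r1) j2).
rewrite (D1 _ _ _ _ r1 j1) (D1 _ _ _ _ j1 r1).
rewrite !mul1r mulNr; apply/eqP; rewrite eq_complex; apply/andP; split; apply/eqP.
- by rewrite [RHS]ReZD.
- by rewrite [RHS]ImZD.
Qed.

Definition expi_val (k : int) : R -> R[i]^o :=
  fun x => Complex (cos (k%:~R * x)) (sin (k%:~R * x)).

Lemma expi_subproof k : expi_val k \in test_pred.
Proof.
have per (h : R -> R) : periodic h (pi *+ 2) ->
    forall x, h (k%:~R * (x + 2 * pi)) = h (k%:~R * x).
  move=> ph x; rewrite mulr_natl mulrDr [_ * (pi *+ 2)]mulrzl; case: k => m.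
    by rewrite -pmulrn (periodicn ph).
  by rewrite [(pi *+ 2) *~ _]nmulrn -[LHS](periodicn ph m.+1) subrK.
apply/test_predP; split.
- move=> x; rewrite /expi_val.
  by rewrite (per _ (@cosD2pi R)) (per _ (@sinD2pi R)).
- have -> : reF (expi_val k) = (fun y => 1 * cos (k%:~R * y) + 0 * sin (k%:~R * y)).
    by apply/funext => y; rewrite mul1r mul0r addr0.
  exact: smooth_trig.
- have -> : imF (expi_val k) = (fun y => 0 * cos (k%:~R * y) + 1 * sin (k%:~R * y)).
    by apply/funext => y; rewrite mul1r mul0r add0r.
  exact: smooth_trig.
Qed.

Definition expi (k : int) : testfun := TestFun (expi_subproof k).

End test_functions.
Arguments testfun R : clear implicits.

Section distributions.
Context {R : realType}.
Implicit Types (phi psi : testfun R) (a : R[i]).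

Definition pdistr_pred : {pred testfun R -> R[i]^o} := fun v =>
  `[< (forall a phi psi, v (a *: phi + psi) = a * v phi + v psi) /\
      (exists (N : nat) (K : R), forall phi (B : R),
         (forall n x, (n <= N)%N -> normc (iter n tderiv phi x) <= B) ->
         normc (v phi) <= K * B) >].

(* Distributions on T: the continuous linear forms on C^oo(T). *)
Record pdistr := PDistr {
  pdistr_val : testfun R -> R[i]^o ;
  pdistr_prop : pdistr_val \in pdistr_pred }.

Lemma pdistr_predP (v : testfun R -> R[i]^o) : reflect
  ((forall a phi psi, v (a *: phi + psi) = a * v phi + v psi) /\
   (exists (N : nat) (K : R), forall phi (B : R),
      (forall n x, (n <= N)%N -> normc (iter n tderiv phi x) <= B) ->
      normc (v phi) <= K * B)) (v \in pdistr_pred).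
Proof. exact: asboolP. Qed.

Lemma pdistr_submod_closed : submod_closed pdistr_pred.
Proof.
split.
  have z phi : (0 : testfun R -> R[i]^o) phi = 0 by [].
  apply/pdistr_predP; split=> [a phi psi|]; first by rewrite !z mulr0 addr0.
  exists 0%N, 0 => phi B _; rewrite mul0r z.
  by rewrite ComplexField.Normc.normc0.
move=> c v w /pdistr_predP[lv [N1 [K1 b1]]] /pdistr_predP[lw [N2 [K2 b2]]].
apply/pdistr_predP; split=> [a phi psi|].
  by rewrite !fctE lv lw /GRing.scale /=; ring.
exists (maxn N1 N2), (normc c * K1 + K2) => phi B hB.
apply: le_trans (le_normcD _ _) _; rewrite mulrDl lerD//.
  rewrite [X in normc X](_ : _ = c * v phi)// ComplexField.Normc.normcM -mulrA.
  apply: ler_wpM2l; first by case: (c) => ? ?; exact: sqrtr_ge0.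
  by apply: b1 => n x nN; apply: hB; rewrite leq_max nN.
by apply: b2 => n x nN; apply: hB; rewrite leq_max nN orbT.
Qed.

HB.instance Definition _ := GRing.isSubmodClosed.Build _ _ pdistr_pred pdistr_submod_closed.
HB.instance Definition _ := [isSub for pdistr_val].
HB.instance Definition _ := [Choice of pdistr by <:].
HB.instance Definition _ := [SubChoice_isSubLmodule of pdistr by <:].

Definition pairing (v : pdistr) (phi : testfun R) : R[i] := pdistr_val v phi.
Coercion pairing : pdistr >-> Funclass.

Lemma pdistrP (v : pdistr) :
  (forall a phi psi, v (a *: phi + psi) = a * v phi + v psi) /\
  (exists (N : nat) (K : R), forall phi (B : R),
     (forall n x, (n <= N)%N -> normc (iter n tderiv phi x) <= B) ->
     normc (v phi) <= K * B).
Proof. exact/pdistr_predP/pdistr_prop. Qed.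

Definition ddx_val (v : pdistr) : testfun R -> R[i]^o := fun phi => - v (tderiv phi).

Lemma ddx_subproof (v : pdistr) : ddx_val v \in pdistr_pred.
Proof.
have [lv [N [K bv]]] := pdistrP v; apply/pdistr_predP; split=> [a phi psi|].
  by rewrite /ddx_val tderiv_lin lv; ring.
exists N.+1, K => phi B hB; rewrite /ddx_val normcN; apply: bv => n x nN.
by rewrite -iterSr; exact: hB.
Qed.

Definition ddx (v : pdistr) : pdistr := PDistr (ddx_subproof v).

Definition integral_period (f : R -> R[i]) : R[i] := Complex
  (\int[lebesgue_measure]_(x in `[0, 2 * pi]) complex.Re (f x))
  (\int[lebesgue_measure]_(x in `[0, 2 * pi]) complex.Im (f x)).

Definition embed_val (f : testfun R) : testfun R -> R[i]^o :=
  fun phi => integral_period (fun x => f x * phi x).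

Lemma smooth_integrable (g : R -> R) : continuous g ->
  lebesgue_measure.-integrable `[0, 2 * pi] (EFin \o g).
Proof.
move=> cg; apply: continuous_compact_integrable; first exact: segment_compact.
by apply: continuous_subspaceT => x; exact: cg.
Qed.

Lemma embed_subproof (f : testfun R) : embed_val f \in pdistr_pred.
Proof.
have cre (h : testfun R) : continuous (fun x => complex.Re (h x)).
  by have [_ r _] := testfunP h; exact: (smooth_continuous r).
have cim (h : testfun R) : continuous (fun x => complex.Im (h x)).
  by have [_ _ r] := testfunP h; exact: (smooth_continuous r).
have ReM (z w : R[i]) : complex.Re (z * w) =
  complex.Re z * complex.Re w - complex.Im z * complex.Im w.
  by case: z w => [? ?] [? ?].
have ImM (z w : R[i]) : complex.Im (z * w) =
  complex.Re z * complex.Im w + complex.Im z * complex.Re w.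
  by case: z w => [? ?] [? ?].
have cRe (phi : testfun R) : continuous (fun x => complex.Re (f x * phi x)).
  have -> : (fun x => complex.Re (f x * phi x)) =
    (fun x => complex.Re (f x) * complex.Re (phi x) - complex.Im (f x) * complex.Im (phi x)).
    by apply/funext => x; rewrite ReM.
  by move=> x; apply: cvgB; apply: cvgM; [exact: cre|exact: cre|exact: cim|exact: cim].
have cIm (phi : testfun R) : continuous (fun x => complex.Im (f x * phi x)).
  have -> : (fun x => complex.Im (f x * phi x)) =
    (fun x => complex.Re (f x) * complex.Im (phi x) + complex.Im (f x) * complex.Re (phi x)).
    by apply/funext => x; rewrite ImM.
  by move=> x; apply: cvgD; apply: cvgM; [exact: cre|exact: cim|exact: cim|exact: cre].
have mI : measurable (`[0, 2 * pi]%classic : set (measurableTypeR R)) by exact: measurable_itv.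
have intlin (g h k : R -> R) (b c : R) : continuous g -> continuous h -> continuous k ->
    (\int[lebesgue_measure]_(x in `[0, 2 * pi]) (b * g x + c * h x + k x) =
     b * \int[lebesgue_measure]_(x in `[0, 2 * pi]) g x + c * \int[lebesgue_measure]_(x in `[0, 2 * pi]) h x +
     \int[lebesgue_measure]_(x in `[0, 2 * pi]) k x)%R.
  move=> cg ch ck.
  have cb : continuous (fun x => b * g x) by move=> x; exact: cvgM (cvg_cst _) (cg x).
  have cc : continuous (fun x => c * h x) by move=> x; exact: cvgM (cvg_cst _) (ch x).
  rewrite RintegralD//=; [|apply: smooth_integrable => x; apply: cvgD; [exact: cb|exact: cc]
    |exact: smooth_integrable].
  by rewrite RintegralD//= ?RintegralZl//; exact: smooth_integrable.
apply/pdistr_predP; split=> [a phi psi|].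
  have -> : embed_val f (a *: phi + psi) =
      integral_period (fun x => a * (f x * phi x) + f x * psi x).
    rewrite /embed_val; congr integral_period; apply/funext => x.
    by rewrite mulrCA -mulrDr.
  apply/eqP; rewrite eq_complex; apply/andP; split; apply/eqP.
  - rewrite ReZD /= -mulNr -intlin//.
    by apply: eq_Rintegral => x _; rewrite ReZD mulNr.
  - rewrite ImZD /= -intlin//.
    by apply: eq_Rintegral => x _; rewrite ImZD.
pose G x := `|complex.Re (f x)| + `|complex.Im (f x)|.
have cG : continuous G.
  by move=> x; apply: cvgD; apply: cvg_norm; [exact: cre|exact: cim].
pose K := \int[lebesgue_measure]_(x in `[0, 2 * pi]) G x.
have normcRI (z : R[i]) : normc z <= `|complex.Re z| + `|complex.Im z|.
  case: z => p q /=; rewrite -[leRHS]ger0_norm ?addr_ge0// -sqrtr_sqr ler_wsqrtr//.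
  rewrite sqrrD -[p ^+ 2]real_normK ?num_real// -[q ^+ 2]real_normK ?num_real//.
  by rewrite addrAC lerDl mulrn_wge0// mulr_ge0.
have ReN (z : R[i]) : `|complex.Re z| <= normc z.
  by case: z => p q /=; rewrite -sqrtr_sqr ler_wsqrtr// lerDl sqr_ge0.
have ImN (z : R[i]) : `|complex.Im z| <= normc z.
  by case: z => p q /=; rewrite -sqrtr_sqr ler_wsqrtr// lerDr sqr_ge0.
exists 0%N, (K + K) => phi B hB; rewrite mulrDl.
have prodB x : normc (f x * phi x) <= B * G x.
  rewrite ComplexField.Normc.normcM mulrC; apply: ler_pM => //.
  - by case: (phi x) => ? ?; exact: sqrtr_ge0.
  - by case: (f x) => ? ?; exact: sqrtr_ge0.
  - exact: (hB 0%N).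
have bnd (g : R -> R) : continuous g -> (forall x, `|g x| <= B * G x) ->
    `|\int[lebesgue_measure]_(x in `[0, 2 * pi]) g x| <= K * B.
  move=> cg gB; apply: le_trans (le_normr_Rintegral mI (smooth_integrable cg)) _.
  have -> : K * B = \int[lebesgue_measure]_(x in `[0, 2 * pi]) (B * G x).
    by rewrite mulrC RintegralZl//; exact: smooth_integrable.
  apply: le_Rintegral => //; first by apply: smooth_integrable => x; apply: cvg_norm; exact: cg.
  by apply: smooth_integrable => x; exact: cvgM (cvg_cst _) (cG x).
apply: le_trans (normcRI _) _; apply: lerD; apply: bnd => [|x].
- exact: cRe.
- exact: le_trans (ReN _) (prodB x).
- exact: cIm.
- exact: le_trans (ImN _) (prodB x).
Qed.

Definition embed (f : testfun R) : pdistr := PDistr (embed_subproof f).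

End distributions.
Arguments pdistr R : clear implicits.

Section fourier.
Context {R : realType}.
Local Open Scope complex_scope.
Implicit Types v : pdistr R.

(* For v = embed f this is (2 pi)^-1 times the integral of f(x) e^(- i k x). *)
Definition fcoef v (k : int) : R[i] := (2 * pi)^-1%:C * v (expi (- k)).

(* Sum over Z of an absolutely summable family: limit of the sums over
   - N <= k <= N. *)
Definition zsum (a : int -> R[i]) : R[i] :=
  limn (fun N => \sum_(j < N.*2.+1) a (j%:Z - N%:Z) : R[i]^o).

Definition bracket (k : int) : R := Num.sqrt (1 + k%:~R ^+ 2).

Definition sobolev_sqnorm (s : R) v : \bar R :=
  ((2 * pi)%:E *
   \esum_(k in [set: int]) (bracket k `^ (2 * s) * normc (fcoef v k) ^+ 2)%:E)%E.

Definition sobolev (s : R) : set (pdistr R) :=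
  [set v | (sobolev_sqnorm s v < +oo)%E].

(* A class of a.e. equal functions is represented by the distribution it defines. *)
Definition L2 : set (pdistr R) := [set v | exists f : R -> R[i],
  [/\ measurable_fun `[0, 2 * pi] (fun x => complex.Re (f x)),
      measurable_fun `[0, 2 * pi] (fun x => complex.Im (f x)),
      (\int[lebesgue_measure]_(x in `[0%R, (2 * pi)%R]) (normc (f x) ^+ 2)%:E < +oo)%E
    & forall phi : testfun R, v phi = integral_period (fun x => f x * phi x)]].

(* The Fourier multiplier of symbol m: the unique distribution with Fourier
   coefficients m k * fcoef v k, which exists when m has polynomial growth. *)
Definition multiplier (m : int -> R[i]) v : pdistr R :=
  xget 0 [set w | forall k, fcoef w k = m k * fcoef v k].

Definition tanh (x : R) : R := (expR x - expR (- x)) / (expR x + expR (- x)).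

Definition m_symbol (beta : R) (k : int) : R := tanh (beta * k%:~R) / beta.

Definition p_symbol (beta : R) (k : int) : R :=
  if k == 0 then 1 else tanh (beta * k%:~R) / (beta * k%:~R).

Definition T_op (beta : R) : pdistr R -> pdistr R :=
  multiplier (fun k => Complex 0 (- m_symbol beta k)).

(* L^2 x H^(-1/2); p_symbol is the symbol of P_beta. *)
Definition energy_space (beta : R) : inner_space (pdistr R * pdistr R)%type := InnerSpace
  [set hu | L2 hu.1 /\ sobolev (- 2^-1) hu.2]
  (fun hu fp =>
     (2 * pi)%:C * zsum (fun k => fcoef hu.1 k * conjc (fcoef fp.1 k)) +
     (2 * pi)%:C * zsum (fun k => (p_symbol beta k)%:C * fcoef hu.2 k * conjc (fcoef fp.2 k))).

Definition conservative_op (beta : R) : operator (pdistr R * pdistr R)%type := Operator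
  [set hu | sobolev 2^-1 hu.1 /\ L2 hu.2]
  (fun hu => (T_op beta hu.2, - ddx hu.1)).

Definition omega (beta : R) (n : nat) : R := Num.sqrt (n%:R * tanh (beta * n%:R) / beta).

End fourier.

(* Main.v *)
Require Import Defs.
From HB Require Import structures.
From mathcomp Require Import all_boot all_order all_algebra.
From mathcomp Require Import complex ring lra zify.
From mathcomp Require Import all_classical all_reals all_analysis measurable_realfun.

Set Implicit Arguments.
Unset Strict Implicit.
Unset Printing Implicit Defensive.
Import Order.TTheory GRing.Theory Num.Theory.
Import numFieldNormedType.Exports.
Local Open Scope classical_set_scope.
Local Open Scope ring_scope.
Local Open Scope complex_scope.

(** In Fourier variables the conservative operator is block diagonal: on the
    coefficients (a_k, b_k) of (h, u) it acts by
    (a_k, b_k) |-> (- i m_k b_k, - i k a_k), where m_k = k p_k.  The block is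
    skew-Hermitian for the energy |a_k|^2 + p_k |b_k|^2, and it is diagonal in
    the two modes a_k + sqrt(p_k) b_k and a_k - sqrt(p_k) b_k, with eigenvalues
    - i tau_k and i tau_k, tau_k = k sqrt(p_k).  Here tau_n = omega_n for
    n >= 0, tau is odd and strictly increasing, and |tau_k| tends to infinity;
    so each value i tau_n is taken at exactly two (mode, frequency) pairs,
    which gives the double eigenvalues and their eigenvectors, and the set of
    these values is discrete.

    Away from all the i tau_k the resolvent divides every mode by l - i tau_k.
    The energy is half the sum of the squared moduli of the modes, hence this
    division is bounded by the inverse of the distance from l to the spectrum
    (resolvent_bound, shift_surjective).  Iterating a diagonal operator creates
    no new kernel, hence generalized eigenspaces are eigenspaces
    (root_space_ker).  Testing the adjoint identity on single exponentials
    shows that the adjoint is - A, with the same domain (graph_adj_A), whence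
    normality.  Except for trigonometric polynomials, membership in the domain
    comes from dom_regularity: since m_k is bounded away from 0 for k <> 0, a
    pair x of the energy space whose formal image A x is in the energy space is
    in the domain.

    Reading the problem in Fourier variables rests on two facts.
    First, a periodic distribution is determined by its Fourier coefficients
    (fcoef_inj): the averages of a test function against the de la Vallee
    Poussin kernels ((1 + cos)/2)^n, suitably normalized, are trigonometric
    polynomials and converge to it together with all derivatives.
    Second, L^2 is the set of distributions with square summable coefficients
    (L2P).  One direction is the inequality of Bessel; for the other
    (riesz_fischer), the partial sums along a subsequence with increments d_i
    of geometrically decreasing L^2 norm are dominated by the square root of
    the integrable function sum_i 2^(i+1) |d_i|^2, and converge wherever it is
    finite (telescoping_limit). *)

(** * Complex integrals over a period *)

Section period_integral.
Context {R : realType}.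
Implicit Types (f g : R -> R[i]) (phi : testfun R).

Notation mu := (@lebesgue_measure R).
Notation D := (`[0, 2 * pi]%classic : set (measurableTypeR R)).

Lemma Re_cmul (z w : R[i]) : complex.Re (z * w) =
  complex.Re z * complex.Re w - complex.Im z * complex.Im w.
Proof. by case: z w => [? ?] [? ?]. Qed.

Lemma Im_cmul (z w : R[i]) : complex.Im (z * w) =
  complex.Re z * complex.Im w + complex.Im z * complex.Re w.
Proof. by case: z w => [? ?] [? ?]. Qed.

Lemma Re_caddE (z w : R[i]) : complex.Re (z + w) = complex.Re z + complex.Re w.
Proof. by case: z w => [? ?] [? ?]. Qed.

Lemma Im_caddE (z w : R[i]) : complex.Im (z + w) = complex.Im z + complex.Im w.
Proof. by case: z w => [? ?] [? ?]. Qed.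

Lemma Re_coppE (z : R[i]) : complex.Re (- z) = - complex.Re z.
Proof. by case: z. Qed.

Lemma Im_coppE (z : R[i]) : complex.Im (- z) = - complex.Im z.
Proof. by case: z. Qed.

Lemma normc_ge0 (z : R[i]) : 0 <= normc z.
Proof. by case: z => ? ?; exact: sqrtr_ge0. Qed.

Lemma sqr_normcE (z : R[i]) : normc z ^+ 2 = complex.Re z ^+ 2 + complex.Im z ^+ 2.
Proof. by case: z => p q /=; rewrite sqr_sqrtr// addr_ge0 ?sqr_ge0. Qed.

Lemma normc_le_ReD_Im (z : R[i]) : normc z <= `|complex.Re z| + `|complex.Im z|.
Proof.
case: z => p q /=; rewrite -[leRHS]ger0_norm ?addr_ge0// -sqrtr_sqr ler_wsqrtr//.
rewrite sqrrD -[p ^+ 2]real_normK ?num_real// -[q ^+ 2]real_normK ?num_real//.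
by rewrite addrAC lerDl mulrn_wge0// mulr_ge0.
Qed.

Lemma Re_le_normc (z : R[i]) : `|complex.Re z| <= normc z.
Proof. by case: z => p q /=; rewrite -sqrtr_sqr ler_wsqrtr// lerDl sqr_ge0. Qed.

Lemma Im_le_normc (z : R[i]) : `|complex.Im z| <= normc z.
Proof. by case: z => p q /=; rewrite -sqrtr_sqr ler_wsqrtr// lerDr sqr_ge0. Qed.

Lemma mulc_conjc (z : R[i]) : z * z^* = (normc z ^+ 2)%:C.
Proof.
rewrite sqr_normcE; case: z => p q; apply/eqP; rewrite eq_complex /=.
by apply/andP; split; apply/eqP; ring.
Qed.

Lemma eq_cplx (z w : R[i]) :
  complex.Re z = complex.Re w -> complex.Im z = complex.Im w -> z = w.
Proof. by case: z w => [? ?] [? ?] /= -> ->. Qed.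

Lemma period_measurable : measurable D.
Proof. exact: measurable_itv. Qed.

Lemma twopi_gt0 : 0 < 2 * pi :> R.
Proof. by rewrite mulr_gt0 ?pi_gt0. Qed.

Lemma period_eq_integrable (g h : R -> \bar R) : mu.-integrable D g ->
  g =1 h -> mu.-integrable D h.
Proof. by move=> ig gh; apply: (eq_integrable period_measurable _ _ _ ig). Qed.

Lemma measure_period : mu D = (2 * pi)%:E.
Proof.
have := lebesgue_measure_itv `[0 : R, 2 * pi].
by rewrite /= lte_fin twopi_gt0 /= oppr0 adde0.
Qed.

Definition cintegrable f := mu.-integrable D (fun x => (complex.Re (f x))%:E) /\
  mu.-integrable D (fun x => (complex.Im (f x))%:E).

Lemma cintegrableD f g : cintegrable f -> cintegrable g ->
  cintegrable (fun x => f x + g x).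
Proof.
move=> [f1 f2] [g1 g2]; split.
  apply: (period_eq_integrable (integrableD period_measurable f1 g1)) => x.
  by rewrite /=; case: (f x) (g x) => [? ?] [? ?].
apply: (period_eq_integrable (integrableD period_measurable f2 g2)) => x.
by rewrite /=; case: (f x) (g x) => [? ?] [? ?].
Qed.

Lemma cintegrableZ (c : R[i]) f : cintegrable f -> cintegrable (fun x => c * f x).
Proof.
move=> [f1 f2].
have Z k (h : R -> \bar R) : mu.-integrable D h -> mu.-integrable D (fun x => k%:E * h x)%E.
  by move=> ih; exact: (integrableZl period_measurable k ih).
split.
- apply: (period_eq_integrable (integrableB period_measurable
    (Z (complex.Re c) _ f1) (Z (complex.Im c) _ f2))) => x.
  by rewrite /= Re_cmul.
- apply: (period_eq_integrable (integrableD period_measurable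
    (Z (complex.Re c) _ f2) (Z (complex.Im c) _ f1))) => x.
  by rewrite /= Im_cmul.
Qed.

Lemma integral_periodD f g : cintegrable f -> cintegrable g ->
  integral_period (fun x => f x + g x) = integral_period f + integral_period g.
Proof.
move=> [f1 f2] [g1 g2]; apply: eq_cplx => /=.
- rewrite -(RintegralD period_measurable f1 g1).
  by apply: eq_Rintegral => x _; case: (f x) (g x) => [? ?] [? ?].
- rewrite -(RintegralD period_measurable f2 g2).
  by apply: eq_Rintegral => x _; case: (f x) (g x) => [? ?] [? ?].
Qed.

Lemma integral_periodZ c f : cintegrable f ->
  integral_period (fun x => c * f x) = c * integral_period f.
Proof.
move=> [f1 f2].
have Z k (h : R -> R) : mu.-integrable D (EFin \o h) ->
    mu.-integrable D (EFin \o (fun x => k * h x)).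
  by move=> ih; exact: (integrableZl period_measurable k ih).
apply: eq_cplx; rewrite ?Re_cmul ?Im_cmul /=.
- rewrite -(RintegralZl _ period_measurable f1) -(RintegralZl _ period_measurable f2).
  rewrite -(RintegralB period_measurable (Z _ _ f1) (Z _ _ f2)).
  by apply: eq_Rintegral => x _; rewrite Re_cmul.
- rewrite -(RintegralZl _ period_measurable f1) -(RintegralZl _ period_measurable f2).
  rewrite -(RintegralD period_measurable (Z _ _ f2) (Z _ _ f1)).
  by apply: eq_Rintegral => x _; rewrite Im_cmul.
Qed.

Lemma cintegrable0 : cintegrable (fun=> 0).
Proof. by split; exact: integrable0. Qed.

Lemma cintegrable_sum (I : Type) (s : seq I) (F : I -> R -> R[i]) :
  (forall i, cintegrable (F i)) -> cintegrable (fun x => \sum_(i <- s) F i x).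
Proof.
move=> iF; elim: s => [|i s IH].
  by rewrite (_ : (fun _ => _) = fun=> 0) ?funeqE; [exact: cintegrable0|move=> x; rewrite big_nil].
rewrite (_ : (fun _ => _) = fun x => F i x + \sum_(i <- s) F i x).
  exact: cintegrableD.
by apply/funext => x; rewrite big_cons.
Qed.

Lemma integral_period_sum (I : Type) (s : seq I) (F : I -> R -> R[i]) :
  (forall i, cintegrable (F i)) ->
  integral_period (fun x => \sum_(i <- s) F i x) = \sum_(i <- s) integral_period (F i).
Proof.
move=> iF; elim: s => [|i s IH].
  rewrite big_nil /integral_period.
  by apply: eq_cplx => /=; under eq_Rintegral do rewrite big_nil /=;
    rewrite Rintegral_cst ?mul0r//; exact: period_measurable.
rewrite big_cons -IH -integral_periodD//; last exact: cintegrable_sum.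
by congr integral_period; apply/funext => x; rewrite big_cons.
Qed.

Lemma continuous_Re_testfun phi : continuous (fun x => complex.Re (phi x)).
Proof. by have [_ r _] := testfunP phi; exact: (smooth_continuous r). Qed.

Lemma continuous_Im_testfun phi : continuous (fun x => complex.Im (phi x)).
Proof. by have [_ _ r] := testfunP phi; exact: (smooth_continuous r). Qed.

Lemma cintegrable_testfun phi : cintegrable phi.
Proof.
by split; apply: smooth_integrable; [exact: continuous_Re_testfun|exact: continuous_Im_testfun].
Qed.

Lemma periodic_zmul (V : zmodType) (f : R -> V) (T : R) : periodic f T ->
  forall (m : int) x, f (x + m%:~R * T) = f x.
Proof.
move=> pf [n|n] x; first by rewrite -pmulrn mulr_natl periodicn.
by rewrite NegzE mulrNz mulNr -pmulrn mulr_natl -(periodicn pf n.+1) subrK.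
Qed.

Lemma period_reduction (x0 x T : R) : 0 < T -> exists m : int,
  x0 <= x + m%:~R * T < x0 + T.
Proof.
move=> T0; have /andP[h1 h2] := floor_itv ((x - x0) / T).
move: h1 h2; set m := Num.floor _; rewrite ler_pdivlMr// ltr_pdivrMr// intrD1 => h1 h2.
by exists (- m); rewrite mulrNz mulNr; apply/andP; split; nra.
Qed.

Lemma bounded_periodic (h : R -> R) : continuous h -> periodic h (2 * pi) ->
  exists B : R, forall x, `|h x| <= B.
Proof.
move=> ch ph.
have := @EVT_max R (fun x => `|h x|) 0 (2 * pi) (ltW twopi_gt0).
case.
  by apply: continuous_subspaceT => x; apply: cvg_norm; exact: ch.
move=> c _ cmax; exists (`|h c|) => x.
have [m /andP[m0 m1]] := period_reduction 0 x twopi_gt0.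
rewrite -(periodic_zmul ph m x); apply: cmax.
by rewrite in_itv /= m0 ltW//; move: m1; rewrite add0r.
Qed.

Lemma bounded_testfun phi : exists2 B : R, 0 <= B & forall x, normc (phi x) <= B.
Proof.
have [pphi _ _] := testfunP phi.
have [|B1 b1] := bounded_periodic (@continuous_Re_testfun phi).
  by move=> x; rewrite pphi.
have [|B2 b2] := bounded_periodic (@continuous_Im_testfun phi).
  by move=> x; rewrite pphi.
exists (B1 + B2) => [|x].
  by apply: addr_ge0; [exact: le_trans (b1 0)|exact: le_trans (b2 0)].
by apply: le_trans (normc_le_ReD_Im _) _; exact: lerD.
Qed.

(** Test functions are bounded and continuous, so that they multiply integrable functions. *)
Lemma cintegrableM_testfun f phi : cintegrable f -> cintegrable (fun x => f x * phi x).
Proof.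
move=> [f1 f2]; have [B B0 hB] := bounded_testfun phi.
have M (g h : R -> R) : mu.-integrable D (EFin \o g) -> continuous h ->
    (forall x, `|h x| <= B) -> mu.-integrable D (EFin \o (fun x => g x * h x)).
  move=> ig ch bh.
  have mh : measurable_fun D h by apply: measurable_funS (continuous_measurable_fun ch).
  apply: (period_eq_integrable (integrableMl period_measurable ig mh _)) => //.
  exists B; split; first exact: num_real.
  by move=> C BC x _ /=; exact: le_trans (bh x) (ltW BC).
have bR x : `|complex.Re (phi x)| <= B by exact: le_trans (Re_le_normc _) (hB x).
have bI x : `|complex.Im (phi x)| <= B by exact: le_trans (Im_le_normc _) (hB x).
have cR := @continuous_Re_testfun phi; have cI := @continuous_Im_testfun phi.
split.
- apply: (period_eq_integrable (integrableB period_measurable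
    (M _ _ f1 cR bR) (M _ _ f2 cI bI))) => x.
  by rewrite /= Re_cmul.
- apply: (period_eq_integrable (integrableD period_measurable
    (M _ _ f1 cI bI) (M _ _ f2 cR bR))) => x.
  by rewrite /= Im_cmul.
Qed.

(** The primitive takes equal values at both ends of the period. *)
Lemma integral_tderiv phi : integral_period (tderiv phi) = 0.
Proof.
have [pphi rphi jphi] := testfunP phi.
have ftc (h : R -> R) : smooth h -> periodic h (2 * pi) ->
    \int[mu]_(x in D) (derive1 h x) = 0.
  move=> sh ph; rewrite /Rintegral (@continuous_FTC2 _ (derive1 h) h)//=.
  - by rewrite -[2 * pi]add0r ph subrr.
  - exact: twopi_gt0.
  - by apply: continuous_subspaceT; apply: smooth_continuous; exact: smooth_derive1.
  - split; first by move=> x _; exact: (sh 0%N).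
    + by apply: cvg_at_right_filter; exact: (smooth_continuous sh).
    + by apply: cvg_at_left_filter; exact: (smooth_continuous sh).
by apply: eq_cplx => /=; apply: ftc => //; move=> x; rewrite /reF /imF pphi.
Qed.

Lemma expiE (k : int) (x : R) : expi k x = Complex (cos (k%:~R * x)) (sin (k%:~R * x)).
Proof. by []. Qed.

Lemma expiD (k l : int) (x : R) : expi (k + l) x = expi k x * expi l x.
Proof.
by rewrite !expiE intrD mulrDl cosD sinD; apply: eq_cplx => /=; rewrite // addrC.
Qed.

Lemma expi_conj (k : int) (x : R) : expi (- k) x = (expi k x)^*.
Proof. by rewrite !expiE intrN mulNr cosN sinN. Qed.

Lemma expi0 (x : R) : expi 0 x = 1.
Proof. by rewrite expiE mul0r cos0 sin0. Qed.

Lemma tderiv_expi (k : int) : tderiv (expi k) = Complex 0 k%:~R *: expi k :> testfun R.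
Proof.
apply/val_inj/funext => x; rewrite /= /tderiv_val.
have -> : derive1 (reF (expi k : R -> R[i]^o)) x = - k%:~R * sin (k%:~R * x).
  have -> : reF (expi k : R -> R[i]^o) = (fun y => 1 * cos (k%:~R * y) + 0 * sin (k%:~R * y)).
    by apply/funext => y; rewrite mul1r mul0r addr0.
  by rewrite derive1E; have [_ ->] := is_derive_trig (k%:~R : R) 1 0 x; ring.
have -> : derive1 (imF (expi k : R -> R[i]^o)) x = k%:~R * cos (k%:~R * x).
  have -> : imF (expi k : R -> R[i]^o) = (fun y => 0 * cos (k%:~R * y) + 1 * sin (k%:~R * y)).
    by apply/funext => y; rewrite mul1r mul0r add0r.
  by rewrite derive1E; have [_ ->] := is_derive_trig (k%:~R : R) 0 1 x; ring.
change (Complex (- k%:~R * sin (k%:~R * x)) (k%:~R * cos (k%:~R * x)) =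
  Complex 0 k%:~R * expi k x :> R[i]).
by rewrite expiE; apply: eq_cplx => /=; ring.
Qed.

(* Simplification would otherwise expand exponentials into cosines and sines. *)
Opaque expi.

Lemma testfunZE (c : R[i]) phi x : (c *: phi : testfun R) x = c * phi x.
Proof. by []. Qed.

Lemma testfunDE phi psi x : (phi + psi : testfun R) x = phi x + psi x.
Proof. by []. Qed.

(** For k <> 0 the function e_k is, up to the factor i k, a derivative of a periodic function. *)
Lemma integral_expi (k : int) :
  integral_period (expi k : R -> R[i]) = if k == 0 then (2 * pi)%:C else 0.
Proof.
case: eqP => [->|/eqP k0].
  apply: eq_cplx => /=.
    transitivity (\int[mu]_(x in D) (1 : R)).
      by apply: eq_Rintegral => x _; rewrite expi0.
    rewrite (Rintegral_cst mu period_measurable) mul1r.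
    exact: (congr1 fine measure_period).
  transitivity (\int[mu]_(x in D) (0 : R)).
    by apply: eq_Rintegral => x _; rewrite expi0.
  by rewrite (Rintegral_cst mu period_measurable) mul0r.
have := integral_tderiv (expi k); rewrite tderiv_expi.
have -> : ((Complex 0 k%:~R *: expi k : testfun R) : R -> R[i]) =
  fun x => Complex 0 k%:~R * expi k x by [].
rewrite integral_periodZ; last exact: cintegrable_testfun.
move/eqP; rewrite mulf_eq0 => /orP[|/eqP//].
by rewrite eq_complex /= eqxx /= intr_eq0 (negbTE k0).
Qed.

End period_integral.

(* Opacity declared in a section ends with it. *)
Opaque expi.

(** * Approximation by trigonometric kernels *)

Section trigonometric_approximation.
Context {R : realType}.
Implicit Types (phi psi : testfun R) (v : pdistr R).

Notation mu := (@lebesgue_measure R).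
Notation D := (`[0, 2 * pi]%classic : set (measurableTypeR R)).

Lemma Rintegral_parts_periodic (f g : R -> R) : smooth f -> smooth g ->
  periodic f (2 * pi) -> periodic g (2 * pi) ->
  \int[mu]_(x in D) (derive1 f x * g x) = - \int[mu]_(x in D) (f x * derive1 g x).
Proof.
move=> sf sg pf pg.
have cf := smooth_continuous sf; have cg := smooth_continuous sg.
have cf' := smooth_continuous (smooth_derive1 sf).
have cg' := smooth_continuous (smooth_derive1 sg).
have db (h : R -> R) : smooth h -> derivable_oo_LRcontinuous h 0 (2 * pi).
  move=> sh; split; first by move=> x _; exact: (sh 0%N).
  - by apply: cvg_at_right_filter; exact: (smooth_continuous sh).
  - by apply: cvg_at_left_filter; exact: (smooth_continuous sh).
have := @Rintegration_by_parts R g f (derive1 g) (derive1 f) 0 (2 * pi) twopi_gt0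
  (continuous_subspaceT cg') (db _ sg) (fun _ _ => erefl)
  (continuous_subspaceT cf') (db _ sf) (fun _ _ => erefl).
have pe (h : R -> R) : periodic h (2 * pi) -> h (2 * pi) = h 0 by move=> ph; rewrite -[LHS](congr1 h (add0r _)) ph.
rewrite !pe// subrr sub0r => h.
transitivity (\int[mu]_(x in D) (g x * derive1 f x)).
  by apply: eq_Rintegral => x _; rewrite mulrC.
by rewrite [LHS]h; congr (- _); apply: eq_Rintegral => x _; rewrite mulrC.
Qed.

Lemma sin_ge_mul_cos (d : R) : 0 <= d <= pi / 4 -> d * cos d <= sin d.
Proof.
move=> /andP[d0 d4].
have [|c] := @MVT_segment R sin cos 0 d d0 (fun x _ => is_derive_sin x).
  by apply: continuous_subspaceT; exact: continuous_sin.
rewrite in_itv /= => /andP[c0 cd]; rewrite sin0 !subr0 => ->.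
rewrite mulrC; apply: ler_wpM2r => //.
have pi0 := @pi_gt0 R.
by rewrite leNgt ltr_cos -?leNgt// in_itv /=; apply/andP; split; lra.
Qed.

(** With t = 2 d one has 1 - cos t = 2 (sin d)^2 and sin d >= d cos d, while
    (cos d)^2 >= 1/2 on this range. *)
Lemma sqr_le_chord_pihalf (d : R) : 0 <= d <= pi / 4 ->
  (2 * d) ^+ 2 <= 16 * (1 - cos (2 * d)).
Proof.
move=> /andP[d0 d4]; have pi0 := @pi_gt0 R.
have hd : d * cos d <= sin d by apply: sin_ge_mul_cos; rewrite d0.
have ct : cos (2 * d) = 2 * cos d ^+ 2 - 1 by rewrite mulr_natl cos_mulr2n; ring.
have c0 : 0 <= cos (2 * d) by apply: cos_ge0_pihalf; apply/andP; split; lra.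
have cd0 : 0 <= cos d by apply: cos_ge0_pihalf; apply/andP; split; lra.
have dc2 : d ^+ 2 * cos d ^+ 2 <= sin d ^+ 2.
  by rewrite -exprMn ler_sqr ?nnegrE ?mulr_ge0//; apply: le_trans hd; rewrite mulr_ge0.
rewrite exprMn; move: dc2 (cos2Dsin2 d) c0 (sqr_ge0 d); rewrite ct.
move: (cos d ^+ 2) (sin d ^+ 2) (d ^+ 2) => C S E EC CS c0 E0.
have : E * 2^-1 <= E * C by apply: ler_wpM2l => //; lra.
lra.
Qed.

(** Squared arc length is controlled by squared chord length, which is a
    trigonometric polynomial.  Beyond pi / 2 the crude bounds 1 <= 1 - cos t and
    t <= pi < 4 suffice. *)
Lemma sqr_le_chord (t : R) : `|t| <= pi -> t ^+ 2 <= 16 * (1 - cos t).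
Proof.
have nonneg (s : R) : 0 <= s -> s <= pi -> s ^+ 2 <= 16 * (1 - cos s).
  move=> s0 spi; have pi0 := @pi_gt0 R.
  have pi4 : pi < 4 :> R by have := @pihalf_lt2 R; lra.
  have [s2|s2] := leP s (pi / 2).
    have := @sqr_le_chord_pihalf (s / 2); rewrite [2 * _]mulrC divfK//; apply.
    by apply/andP; split; lra.
  have : cos s <= cos (pi / 2).
    by rewrite leNgt ltr_cos -?leNgt ?(ltW s2)// in_itv /=; apply/andP; split; lra.
  by rewrite cos_pihalf; nra.
by move=> tpi; rewrite -real_normK ?num_real// -cos_norm; exact: nonneg.
Qed.

Lemma lipschitz_periodic (f : R -> R) : smooth f -> periodic f (2 * pi) ->
  exists2 M : R, 0 <= M & forall x t : R, `|f t - f x| <= M * `|t - x|.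
Proof.
move=> sf pf.
have [M hM] := bounded_periodic (smooth_continuous (smooth_derive1 sf))
  (derive1_periodic pf).
have M0 : 0 <= M by exact: le_trans (hM 0).
exists M => //.
suff H (x t : R) : x <= t -> `|f t - f x| <= M * `|t - x|.
  move=> x t; have [|/ltW] := leP x t; first exact: H.
  by move=> /H; rewrite distrC [X in _ <= _ * X]distrC.
move=> xt.
have [||c _ ->] := @MVT_segment R f (derive1 f) x t xt.
- by move=> y _; rewrite derive1E; apply/derivableP; exact: (sf 0%N).
- exact: continuous_subspaceT (smooth_continuous sf).
by rewrite normrM ler_wpM2r.
Qed.

(** A Lipschitz function varies by at most M |t - x|, and
    |t - x| <= eta + |t - x|^2 / eta, whichever of |t - x| and eta is larger.
    The quadratic term is then bounded by the chord, whose average against the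
    kernels is known exactly. *)
Lemma periodic_chord_bound (f : R -> R) : smooth f -> periodic f (2 * pi) ->
  exists2 M : R, 0 <= M & forall (eta x t : R), 0 < eta ->
    `|f t - f x| <= M * (eta + 16 / eta * (1 - cos (x - t))).
Proof.
move=> sf pf; have [M M0 hM] := lipschitz_periodic sf pf.
exists M => // eta x t eta0.
have [m /andP[m1 m2]] := period_reduction (x - pi) t twopi_gt0.
set u := t + _ in m1 m2.
have -> : f t = f u by rewrite /u periodic_zmul.
have -> : cos (x - t) = cos (u - x).
  rewrite -cosN opprB -[in LHS](periodic_zmul (T := 2 * pi) (f := cos) _ m).
    by congr cos; rewrite /u; ring.
  by move=> y; rewrite mulr_natl cosD2pi.
apply: le_trans (hM _ _) _; apply: ler_wpM2l => //.
have upi : `|u - x| <= pi by rewrite ler_norml; apply/andP; split; lra.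
have := sqr_le_chord upi; rewrite -real_normK ?num_real//.
move: (1 - cos _) `|u - x| (normr_ge0 (u - x)) => c th th0 hc.
have [|h] := leP th eta.
  move=> h; apply: le_trans h _; rewrite lerDl mulr_ge0 ?divr_ge0 ?(ltW eta0)//.
  nra.
rewrite mulrAC -[leLHS](mulfK (lt0r_neq0 eta0)) -[X in _ <= X + _](mulfK (lt0r_neq0 eta0)).
rewrite -mulrDl ler_wpM2r ?invr_ge0 ?ltW//; nra.
Qed.

(** The de la Vallee Poussin kernel ((1 + cos s)/2)^n normalized to have mean 1:
    (2 + 2 cos s)^n has mean binomial(2 n, n). *)
Definition vpkernel (n : nat) (s : R) : R := (2 + 2 * cos s) ^+ n / 'C(n.*2, n)%:R.

Definition vpcoef (n i : nat) : R := 'C(n.*2, i)%:R / 'C(n.*2, n)%:R.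

Lemma central_bin_neq0 (n : nat) : 'C(n.*2, n)%:R != 0 :> R.
Proof. by rewrite pnatr_eq0 -lt0n bin_gt0 -addnn leq_addr. Qed.

Lemma expi_nat (k : nat) (s : R) : expi k%:Z s = expi 1 s ^+ k.
Proof.
elim: k => [|k IH]; first by rewrite expi0.
by rewrite exprS -IH -expiD -intS.
Qed.

(** 2 + 2 cos s = e^(- i s) (1 + e^(i s))^2, so that the binomial formula gives
    the Fourier coefficients of the kernel. *)
Lemma vpkernelE n s : (vpkernel n s)%:C =
  \sum_(i < n.*2.+1) (vpcoef n i)%:C * expi (i%:Z - n%:Z) s.
Proof.
rewrite /vpkernel rmorphM /= rmorphXn /=.
have -> : (2 + 2 * cos s)%:C = expi (-1) s * (1 + expi 1 s) ^+ 2.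
  have -> : expi (-1) s * (1 + expi 1 s) ^+ 2 = expi (-1) s + 2 + expi 1 s.
    have h : expi (-1) s * expi 1 s = 1 by rewrite -expiD expi0.
    transitivity (expi (-1) s + 2 * (expi (-1) s * expi 1 s)
      + (expi (-1) s * expi 1 s) * expi 1 s); first by ring.
    by rewrite h; ring.
  apply: eq_cplx; rewrite !expiE /= ?mulN1r ?mul1r ?cosN ?sinN; ring.
rewrite exprMn -exprM mul2n exprDn mulr_sumr mulr_suml.
have -> : expi (-1) s ^+ n = expi (- n%:Z) s.
  by rewrite !expi_conj expi_nat rmorphXn.
apply: eq_bigr => i _.
rewrite expr1n mul1r. rewrite expiD expi_nat /vpcoef rmorphM /= !rmorph_nat.
by rewrite -mulr_natr; ring.
Qed.

Lemma vpkernel_ge0 n s : 0 <= vpkernel n s.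
Proof. by rewrite divr_ge0// exprn_ge0//; have := cos_geN1 s; lra. Qed.

Lemma expiB (k : int) (x t : R) : expi k (x - t) = expi k x * expi (- k) t.
Proof.
by rewrite !expiE; apply: eq_cplx => /=;
  rewrite intrN mulNr mulrBr ?cosB ?sinB cosN sinN; ring.
Qed.

Lemma continuous_vpkernel n x : continuous (fun t => vpkernel n (x - t)).
Proof.
move=> t; apply: cvgM; last exact: cvg_cst.
apply: (@cvg_comp _ _ _ (fun t => 2 + 2 * cos (x - t)) (fun y => y ^+ n)); last exact: exprn_continuous.
apply: cvgD; first exact: cvg_cst.
apply: cvgM; first exact: cvg_cst.
apply: (@cvg_comp _ _ _ (fun t => x - t) cos); last exact: continuous_cos.
by apply: cvgB; [exact: cvg_cst|exact: cvg_id].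
Qed.

Lemma integrable_vpkernel n x : mu.-integrable D (EFin \o (fun t => vpkernel n (x - t))).
Proof. by apply: smooth_integrable; exact: continuous_vpkernel. Qed.

Lemma vpcoef_mid n : vpcoef n n = 1.
Proof. by rewrite /vpcoef divff// central_bin_neq0. Qed.

Lemma Rintegral_vpkernel n x : \int[mu]_(t in D) vpkernel n (x - t) = 2 * pi.
Proof.
have e (t : R) : (vpkernel n (x - t))%:C =
    \sum_(i < n.*2.+1) ((vpcoef n i)%:C * expi (i%:Z - n%:Z) x) * expi (- (i%:Z - n%:Z)) t.
  by rewrite vpkernelE; apply: eq_bigr => i _; rewrite expiB; ring.
have : integral_period (fun t => (vpkernel n (x - t))%:C) = (2 * pi)%:C.
  rewrite (_ : (fun t => _) = (fun t => \sum_(i < n.*2.+1)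
      ((vpcoef n i)%:C * expi (i%:Z - n%:Z) x) * expi (- (i%:Z - n%:Z)) t));
    last exact/funext.
  rewrite integral_period_sum; last first.
    by move=> i; apply: cintegrableZ; exact: cintegrable_testfun.
  have nn : (n < n.*2.+1)%N by rewrite ltnS -addnn leq_addr.
  rewrite (bigD1 (Ordinal nn))//= big1 ?addr0.
    rewrite integral_periodZ; last exact: cintegrable_testfun.
    by rewrite subrr expi0 vpcoef_mid oppr0 integral_expi eqxx !mul1r.
  move=> i /eqP ni; rewrite integral_periodZ; last exact: cintegrable_testfun.
  rewrite integral_expi oppr_eq0 subr_eq0 ifN ?mulr0//.
  by apply/eqP => -[] ein; apply: ni; exact/val_inj.
by move=> /(congr1 (@complex.Re R)).
Qed.

Lemma central_bin_step n :
  n.+1%:R * 'C(n.+1.*2, n.+1)%:R = (2 * n%:R + 1) * 2 * 'C(n.*2, n)%:R :> R.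
Proof.
have h1 : (n.+1 * 'C(n.+1.*2, n.+1) = n.+1.*2 * 'C(n.*2.+1, n))%N.
  by rewrite -mul_bin_diag doubleS.
have h2 : (n.+1 * 'C(n.*2.+1, n) = n.*2.+1 * 'C(n.*2, n))%N.
  by have := mul_bin_down n.*2.+1 n; rewrite /= subSn -?addnn ?leq_addr// addnK.
have n0 : n.+1%:R != 0 :> R by rewrite pnatr_eq0.
move: h1 h2 => /(congr1 (fun m => m%:R : R)) h1 /(congr1 (fun m => m%:R : R)) h2.
rewrite -!muln2 !natrM in h1 h2 *; rewrite -[(n * 2).+1%:R]natr1 natrM in h2.
apply: (mulfI n0); rewrite h1 mulrAC h2; ring.
Qed.

(** The kernels concentrate at the origin: 2 (1 - cos) K_n is a combination of
    K_n and K_(n+1), because 2 (1 - cos) = 4 - (2 + 2 cos), and both have mean 1. *)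
Lemma Rintegral_vpkernel_chord n x :
  \int[mu]_(t in D) ((1 - cos (x - t)) * vpkernel n (x - t)) = 2 * pi / n.+1%:R.
Proof.
(* The factor 2 + 2 cos raises n to n + 1, and the normalization changes by 2 q. *)
set q : R := 'C(n.+1.*2, n.+1)%:R / 'C(n.*2, n)%:R / 2.
have b0 := central_bin_neq0 n; have b1 := central_bin_neq0 n.+1.
have e (t : R) : (1 - cos (x - t)) * vpkernel n (x - t) =
    2 * vpkernel n (x - t) - q * vpkernel n.+1 (x - t).
  by rewrite /vpkernel /q exprS; field; rewrite b0 b1.
under eq_Rintegral do rewrite e.
have Z k m : mu.-integrable D (EFin \o (fun t => k * vpkernel m (x - t))).
  by have := integrableZl period_measurable k (integrable_vpkernel m x).
rewrite (RintegralB period_measurable (Z 2 n) (Z q n.+1)).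
rewrite !(RintegralZl _ period_measurable (integrable_vpkernel _ x)) !Rintegral_vpkernel.
have n0 : n.+1%:R != 0 :> R by rewrite pnatr_eq0.
have -> : q = (2 * n%:R + 1) / n.+1%:R.
  rewrite /q; apply: (mulfI n0); rewrite !mulrA central_bin_step.
  by move: (n.+1%:R : R) n0 ('C(n.*2, n)%:R : R) b0 => a a0 b bn0; field; rewrite a0.
have -> : n%:R = n.+1%:R - 1 :> R by rewrite -natr1 addrK.
by move: (n.+1%:R : R) n0 => a a0; field.
Qed.

Lemma vpkernel_error (f : R -> R) : smooth f -> periodic f (2 * pi) ->
  exists2 M : R, 0 <= M & forall (eta : R) n x, 0 < eta ->
    `|\int[mu]_(t in D) ((f t - f x) * vpkernel n (x - t))| <=
      2 * pi * (M * (eta + 16 / (eta * n.+1%:R))).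
Proof.
move=> sf pf; have [M M0 hM] := periodic_chord_bound sf pf.
exists M => // eta n x eta0.
have cK := @continuous_vpkernel n x.
have c1 : continuous (fun t => (f t - f x) * vpkernel n (x - t)).
  by move=> t; apply: cvgM (cK t); apply: cvgB (cvg_cst _); exact: (smooth_continuous sf).
have c2 : continuous (fun t => (1 - cos (x - t)) * vpkernel n (x - t)).
  move=> t; apply: cvgM (cK t); apply: cvgB; first exact: cvg_cst.
  apply: (@cvg_comp _ _ _ (fun t => x - t) cos); last exact: continuous_cos.
  by apply: cvgB; [exact: cvg_cst|exact: cvg_id].
have i1 := integrable_vpkernel n x; have i2 := smooth_integrable c2.
have Z k (h : R -> R) : mu.-integrable D (EFin \o h) ->
    mu.-integrable D (EFin \o (fun x => k * h x)).
  by move=> ih; exact: (integrableZl period_measurable k ih).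
apply: le_trans (le_normr_Rintegral period_measurable (smooth_integrable c1)) _.
have -> : 2 * pi * (M * (eta + 16 / (eta * n.+1%:R))) =
    \int[mu]_(t in D) (M * eta * vpkernel n (x - t) +
      M * (16 / eta) * ((1 - cos (x - t)) * vpkernel n (x - t))).
  rewrite (RintegralD period_measurable (Z _ _ i1) (Z _ _ i2)).
  rewrite (RintegralZl _ period_measurable i1) (RintegralZl _ period_measurable i2).
  rewrite Rintegral_vpkernel Rintegral_vpkernel_chord.
  have n0 : n.+1%:R != 0 :> R by rewrite pnatr_eq0.
  have := lt0r_neq0 eta0.
  by move: (n.+1%:R : R) n0 => a a0 e0; field; rewrite a0 e0.
apply: (le_Rintegral period_measurable).
- by apply: smooth_integrable => t; apply: cvg_norm; exact: c1.
- exact: (integrableD period_measurable (Z _ _ i1) (Z _ _ i2)).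
move=> t _; rewrite normrM (ger0_norm (vpkernel_ge0 _ _)).
apply: le_trans (ler_wpM2r (vpkernel_ge0 _ _) (hM eta x t eta0)) _.
by rewrite le_eqVlt; apply/orP; left; apply/eqP; ring.
Qed.

End trigonometric_approximation.

(** * Fourier coefficients determine a distribution *)

Section fourier_uniqueness.
Context {R : realType}.
Implicit Types (phi psi : testfun R) (v w : pdistr R).

Notation mu := (@lebesgue_measure R).
Notation D := (`[0, 2 * pi]%classic : set (measurableTypeR R)).

Lemma testfun_sumE (I : Type) (s : seq I) (F : I -> testfun R) x :
  (\sum_(i <- s) F i : testfun R) x = \sum_(i <- s) F i x.
Proof. by apply: (big_morph (fun phi : testfun R => phi x)). Qed.

Lemma pdistrD v phi psi : v (phi + psi) = v phi + v psi.
Proof. by have [l _] := pdistrP v; rewrite -{1}[phi]scale1r l mul1r. Qed.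

Lemma pdistr0 v : v 0 = 0.
Proof. by apply: (addrI (v 0)); rewrite -pdistrD !addr0. Qed.

Lemma pdistrZ v (a : R[i]) phi : v (a *: phi) = a * v phi.
Proof. by have [l _] := pdistrP v; rewrite -[a *: phi]addr0 l pdistr0 addr0. Qed.

Lemma pdistr_sum v (I : Type) (s : seq I) (F : I -> testfun R) :
  v (\sum_(i <- s) F i) = \sum_(i <- s) v (F i).
Proof. by apply: big_morph; [exact: pdistrD|exact: pdistr0]. Qed.

Lemma tderivD phi psi : tderiv (phi + psi) = tderiv phi + tderiv psi.
Proof. by rewrite -{1}[phi]scale1r tderiv_lin scale1r. Qed.

Lemma tderiv0 : tderiv (0 : testfun R) = 0.
Proof. by apply: (addrI (tderiv 0)); rewrite -tderivD !addr0. Qed.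

Lemma tderivZ (a : R[i]) phi : tderiv (a *: phi) = a *: tderiv phi.
Proof. by rewrite -[a *: phi]addr0 tderiv_lin tderiv0 addr0. Qed.

Lemma tderiv_sum (I : Type) (s : seq I) (F : I -> testfun R) :
  tderiv (\sum_(i <- s) F i) = \sum_(i <- s) tderiv (F i).
Proof. by apply: big_morph; [exact: tderivD|exact: tderiv0]. Qed.

Lemma embedE phi psi : embed phi psi = integral_period (fun x => phi x * psi x).
Proof. by []. Qed.

Lemma integral_parts phi psi : integral_period (fun x => tderiv phi x * psi x) =
  - integral_period (fun x => phi x * tderiv psi x).
Proof.
have [pphi rphi jphi] := testfunP phi; have [ppsi rpsi jpsi] := testfunP psi.
have pr (chi : testfun R) : periodic (chi : R -> R[i]) (2 * pi) -> periodic (reF (chi : R -> R[i])) (2 * pi).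
  by move=> p x; rewrite /reF p.
have pj (chi : testfun R) : periodic (chi : R -> R[i]) (2 * pi) -> periodic (imF (chi : R -> R[i])) (2 * pi).
  by move=> p x; rewrite /imF p.
have IM (f g : R -> R) : smooth f -> smooth g ->
    mu.-integrable D (EFin \o (fun x => f x * g x)).
  move=> sf sg; apply: smooth_integrable => x.
  by apply: cvgM; apply: smooth_continuous.
have [rphi' jphi'] := (smooth_derive1 rphi, smooth_derive1 jphi).
have [rpsi' jpsi'] := (smooth_derive1 rpsi, smooth_derive1 jpsi).
apply: eq_cplx => /=.
- transitivity (\int[mu]_(x in D) (derive1 (reF (phi : R -> R[i])) x * reF (psi : R -> R[i]) x
      - derive1 (imF (phi : R -> R[i])) x * imF (psi : R -> R[i]) x)).
    by apply: eq_Rintegral => x _; rewrite Re_cmul.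
  rewrite (RintegralB period_measurable (IM _ _ rphi' rpsi) (IM _ _ jphi' jpsi)).
  rewrite !Rintegral_parts_periodic//; [|exact: pj|exact: pj|exact: pr|exact: pr].
  rewrite -opprD; congr (- _).
  rewrite -(RintegralB period_measurable (IM _ _ rphi rpsi') (IM _ _ jphi jpsi')).
  by apply: eq_Rintegral => x _; rewrite Re_cmul.
- transitivity (\int[mu]_(x in D) (derive1 (reF (phi : R -> R[i])) x * imF (psi : R -> R[i]) x
      + derive1 (imF (phi : R -> R[i])) x * reF (psi : R -> R[i]) x)).
    by apply: eq_Rintegral => x _; rewrite Im_cmul.
  rewrite (RintegralD period_measurable (IM _ _ rphi' jpsi) (IM _ _ jphi' rpsi)).
  rewrite !Rintegral_parts_periodic//; [|exact: pj|exact: pr|exact: pr|exact: pj].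
  rewrite -opprD; congr (- _).
  rewrite -(RintegralD period_measurable (IM _ _ rphi jpsi') (IM _ _ jphi rpsi')).
  by apply: eq_Rintegral => x _; rewrite Im_cmul.
Qed.

Lemma fcoef_embed_tderiv phi k :
  fcoef (embed (tderiv phi)) k = Complex 0 k%:~R * fcoef (embed phi) k.
Proof.
rewrite /fcoef embedE integral_parts.
have -> : integral_period (fun x => phi x * tderiv (expi (- k)) x) =
    embed phi (tderiv (expi (- k))) by [].
rewrite tderiv_expi pdistrZ mulrN mulrCA -mulNr; congr (_ * _).
by apply: eq_cplx => /=; rewrite ?oppr0// intrN opprK.
Qed.

(** The convolution of phi with the kernel, written as a trigonometric polynomial,
    so that a distribution with vanishing coefficients vanishes on it. *)
Definition vpsum n phi : testfun R := \sum_(i < n.*2.+1)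
  ((vpcoef n i)%:C * fcoef (embed phi) (i%:Z - n%:Z)) *: expi (i%:Z - n%:Z).

(** Both operators are Fourier multipliers; this is why one estimate covers all derivatives. *)
Lemma tderiv_vpsum n phi : tderiv (vpsum n phi) = vpsum n (tderiv phi).
Proof.
rewrite /vpsum tderiv_sum; apply: eq_bigr => i _.
by rewrite tderivZ tderiv_expi scalerA fcoef_embed_tderiv; congr (_ *: _); ring.
Qed.

Lemma vpsumE n phi x : vpsum n phi x =
  (2 * pi)^-1%:C * integral_period (fun t => phi t * (vpkernel n (x - t))%:C).
Proof.
rewrite (_ : (fun t => _) = (fun t => \sum_(i < n.*2.+1)
    ((vpcoef n i)%:C * expi (i%:Z - n%:Z) x) * (phi t * expi (- (i%:Z - n%:Z)) t))); last first.
  apply/funext => t; rewrite vpkernelE mulr_sumr; apply: eq_bigr => i _.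
  by rewrite expiB; ring.
rewrite integral_period_sum; last first.
  move=> i; apply: cintegrableZ; apply: cintegrableM_testfun; exact: cintegrable_testfun.
rewrite /vpsum testfun_sumE mulr_sumr; apply: eq_bigr => i _.
rewrite integral_periodZ; last first.
  by apply: cintegrableM_testfun; exact: cintegrable_testfun.
by rewrite testfunZE /fcoef embedE; ring.
Qed.

(** The kernel is real and has mean 1, so that the error is the integral of
    (phi t - phi x) K_n (x - t), to be estimated on real and imaginary parts. *)
Lemma vpsum_error phi : exists2 M : R, 0 <= M & forall (eta : R) n x, 0 < eta ->
  normc (phi x - vpsum n phi x) <= M * (eta + 16 / (eta * n.+1%:R)).
Proof.
have [pphi rphi jphi] := testfunP phi.
have [|M1 M10 h1] := vpkernel_error rphi; first by move=> x; rewrite /reF pphi.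
have [|M2 M20 h2] := vpkernel_error jphi; first by move=> x; rewrite /imF pphi.
exists (M1 + M2); first exact: addr_ge0.
move=> eta n x eta0.
have tp := @twopi_gt0 R; have tp0 : 2 * pi != 0 :> R by rewrite gt_eqF.
have iK := integrable_vpkernel n x.
have part (f : R -> R) : smooth f ->
    (2 * pi)^-1 * \int[mu]_(t in D) (f t * vpkernel n (x - t)) - f x =
    (2 * pi)^-1 * \int[mu]_(t in D) ((f t - f x) * vpkernel n (x - t)).
  move=> sf.
  have cf : continuous (fun t => f t * vpkernel n (x - t)).
    by move=> t; apply: cvgM; [exact: smooth_continuous|exact: continuous_vpkernel].
  have ic : mu.-integrable D (EFin \o (fun t => f x * vpkernel n (x - t))).
    exact: (integrableZl period_measurable (f x) iK).
  transitivity ((2 * pi)^-1 * \int[mu]_(t in D)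
      (f t * vpkernel n (x - t) - f x * vpkernel n (x - t))).
    rewrite (RintegralB period_measurable (smooth_integrable cf) ic).
    rewrite (RintegralZl _ period_measurable iK) Rintegral_vpkernel mulrBr.
    by congr (_ - _); rewrite [f x * _]mulrC mulKf.
  by congr (_ * _); apply: eq_Rintegral => t _; rewrite mulrBl.
rewrite -normcN opprB vpsumE; apply: le_trans (normc_le_ReD_Im _) _.
rewrite [leRHS]mulrDl; apply: lerD.
- have -> : complex.Re ((2 * pi)^-1%:C *
      integral_period (fun t => phi t * (vpkernel n (x - t))%:C) - phi x) =
      (2 * pi)^-1 * \int[mu]_(t in D) (reF (phi : R -> R[i]) t * vpkernel n (x - t))
        - reF (phi : R -> R[i]) x.
    rewrite Re_caddE Re_coppE Re_cmul /= mul0r subr0; congr (_ * _ - _).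
    by apply: eq_Rintegral => t _; rewrite Re_cmul /= mulr0 subr0.
  rewrite part// normrM ger0_norm ?invr_ge0 ?(ltW tp)// ler_pdivrMl//.
  exact: h1.
- have -> : complex.Im ((2 * pi)^-1%:C *
      integral_period (fun t => phi t * (vpkernel n (x - t))%:C) - phi x) =
      (2 * pi)^-1 * \int[mu]_(t in D) (imF (phi : R -> R[i]) t * vpkernel n (x - t))
        - imF (phi : R -> R[i]) x.
    rewrite Im_caddE Im_coppE Im_cmul /= mul0r addr0; congr (_ * _ - _).
    by apply: eq_Rintegral => t _; rewrite Im_cmul /= mulr0 add0r.
  rewrite part// normrM ger0_norm ?invr_ge0 ?(ltW tp)// ler_pdivrMl//.
  exact: h2.
Qed.

Lemma vpsum_error_derivatives phi N : exists2 M : R, 0 <= M &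
  forall (eta : R) n j x, 0 < eta -> (j <= N)%N ->
    normc (iter j tderiv (phi - vpsum n phi) x) <= M * (eta + 16 / (eta * n.+1%:R)).
Proof.
have step n psi : tderiv (psi - vpsum n psi) = tderiv psi - vpsum n (tderiv psi).
  by rewrite -scaleN1r tderivD tderivZ tderiv_vpsum scaleN1r.
elim: N phi => [|N IH] phi.
  have [M M0 h] := vpsum_error phi; exists M => // eta n [|//] x eta0 _; exact: h.
have [M M0 h] := vpsum_error phi; have [M' M'0 h'] := IH (tderiv phi).
exists (M + M'); first exact: addr_ge0.
move=> eta n j x eta0 jN.
have pos : 0 <= eta + 16 / (eta * n.+1%:R).
  by rewrite addr_ge0 ?divr_ge0 ?mulr_ge0 ?(ltW eta0).
case: j jN => [_|j jN]; rewrite mulrDl.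
  by apply: le_trans (h eta n x eta0) _; rewrite lerDl mulr_ge0.
rewrite iterSr step; apply: le_trans (h' eta n j x eta0 jN) _.
by rewrite lerDr mulr_ge0.
Qed.

(** A distribution is controlled by finitely many derivatives, and for these the
    sums vpsum n phi, on which v vanishes, converge uniformly to phi. *)
Lemma pdistr_eq0 v : (forall k, fcoef v k = 0) -> v = 0.
Proof.
move=> v0; have vexp k : v (expi k) = 0.
  have /eqP := v0 (- k); rewrite /fcoef opprK mulf_eq0 => /orP[|/eqP//].
  rewrite eq_complex /= eqxx andbT invr_eq0 => /eqP tp.
  by have := @twopi_gt0 R; rewrite tp ltxx.
have [_ [N [K hK]]] := pdistrP v.
apply/val_inj/funext => phi; change (v phi = 0).
apply: ComplexField.Normc.eq0_normc; apply/eqP; rewrite eq_le normc_ge0 andbT leNgt.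
apply/negP => a0; set a := normc (v phi) in a0.
have [M M0 h] := vpsum_error_derivatives phi N.
have bound eta n : 0 < eta -> a <= `|K| * (M * (eta + 16 / (eta * n.+1%:R))).
  move=> eta0; have -> : a = normc (v (phi - vpsum n phi)).
    rewrite -scaleN1r pdistrD pdistrZ [v (vpsum _ _)](_ : _ = 0) ?mulr0 ?addr0//.
    by rewrite pdistr_sum big1// => i _; rewrite pdistrZ vexp mulr0.
  apply: le_trans (hK _ _ (fun j x jN => h eta n j x eta0 jN)) _.
  apply: ler_wpM2r (ler_norm _).
  by rewrite mulr_ge0// addr_ge0 ?divr_ge0 ?mulr_ge0 ?(ltW eta0).
set C := `|K| * M + 1.
have C0 : 0 < C by rewrite ltr_wpDl ?mulr_ge0.
(* With this eta and n large the bound becomes C (2 eta) = a / 2 < a. *)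
have [eta eta0 etaE] : exists2 eta : R, 0 < eta & eta = a / (4 * C).
  by exists (a / (4 * C)) => //; rewrite divr_gt0// mulr_gt0.
have [n hn] : exists n : nat, 16 / (eta * n.+1%:R) <= eta.
  have X0 : 0 <= 16 / (eta * eta) by apply: divr_ge0 => //; apply: mulr_ge0; exact: ltW.
  have := archi_boundP X0; set n := Num.Def.archi_bound _ => hn; exists n.
  rewrite ler_pdivrMr ?mulr_gt0// mulrA mulrC -ler_pdivrMr ?mulr_gt0//.
  by apply: le_trans (ltW hn) _; rewrite ler_nat.
have := bound eta n eta0.
apply/negP; rewrite -ltNge.
have : `|K| * (M * (eta + 16 / (eta * n.+1%:R))) <= C * (eta + eta).
  rewrite mulrA; apply: ler_pM; rewrite ?mulr_ge0//.
  - by rewrite addr_ge0 ?divr_ge0 ?mulr_ge0 ?(ltW eta0).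
  - by rewrite lerDl.
  - by rewrite lerD2l.
move/le_lt_trans; apply; rewrite -mulr2n etaE.
have -> : C * (a / (4 * C) *+ 2) = a / 2 by field; rewrite gt_eqF.
by rewrite ltr_pdivrMr// ltr_pMr// ltr1n.
Qed.

Lemma fcoef_is_linear (a : R[i]) v w k :
  fcoef (a *: v + w) k = a * fcoef v k + fcoef w k.
Proof.
rewrite /fcoef; have -> : (a *: v + w) (expi (- k)) = a * v (expi (- k)) + w (expi (- k)) by [].
ring.
Qed.

Lemma fcoef0 k : fcoef (0 : pdistr R) k = 0.
Proof. by rewrite /fcoef (_ : (0 : pdistr R) _ = 0)// mulr0. Qed.

Lemma fcoefD v w k : fcoef (v + w) k = fcoef v k + fcoef w k.
Proof. by rewrite -{1}[v]scale1r fcoef_is_linear mul1r. Qed.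

Lemma fcoefZ (a : R[i]) v k : fcoef (a *: v) k = a * fcoef v k.
Proof. by rewrite -[a *: v]addr0 fcoef_is_linear fcoef0 addr0. Qed.

Lemma fcoefN v k : fcoef (- v) k = - fcoef v k.
Proof. by rewrite -scaleN1r fcoefZ mulN1r. Qed.

Lemma fcoef_inj v w : (forall k, fcoef v k = fcoef w k) -> v = w.
Proof.
move=> vw; apply/eqP; rewrite -subr_eq0; apply/eqP; apply: pdistr_eq0 => k.
by rewrite fcoefD fcoefN vw subrr.
Qed.

Lemma fcoef_ddx v k : fcoef (ddx v) k = Complex 0 k%:~R * fcoef v k.
Proof.
rewrite /fcoef; have -> : ddx v (expi (- k)) = - v (tderiv (expi (- k))) by [].
rewrite tderiv_expi pdistrZ mulrN mulrCA -mulNr; congr (_ * _).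
by apply: eq_cplx => /=; rewrite ?oppr0// intrN opprK.
Qed.

(** The choice made in the definition of multipliers is unique by fcoef_inj. *)
Lemma fcoef_multiplier (m : int -> R[i]) v w : (forall k, fcoef w k = m k * fcoef v k) ->
  multiplier m v = w.
Proof.
move=> mw; rewrite /multiplier; case: xgetP => [u _ hu|hu]; last by have := hu w mw.
by apply: fcoef_inj => k; rewrite hu mw.
Qed.

Lemma embed_sum (I : Type) (s : seq I) (F : I -> testfun R) k :
  fcoef (embed (\sum_(i <- s) F i)) k = \sum_(i <- s) fcoef (embed (F i)) k.
Proof.
have sym (phi psi : testfun R) : embed phi psi = embed psi phi.
  by rewrite !embedE; congr integral_period; apply/funext => x; rewrite mulrC.
rewrite /fcoef sym pdistr_sum mulr_sumr; apply: eq_bigr => i _.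
by rewrite sym.
Qed.

Lemma fcoef_embedZ (a : R[i]) phi k : fcoef (embed (a *: phi)) k = a * fcoef (embed phi) k.
Proof.
rewrite /fcoef !embedE mulrCA; congr (_ * _).
rewrite -integral_periodZ; last by apply: cintegrableM_testfun; exact: cintegrable_testfun.
by congr integral_period; apply/funext => x; rewrite testfunZE mulrA.
Qed.

Lemma fcoef_embedD phi psi k :
  fcoef (embed (phi + psi)) k = fcoef (embed phi) k + fcoef (embed psi) k.
Proof.
rewrite /fcoef !embedE -mulrDr; congr (_ * _).
rewrite -integral_periodD; [|by apply: cintegrableM_testfun; exact: cintegrable_testfun..].
by congr integral_period; apply/funext => x; rewrite testfunDE mulrDl.
Qed.

Lemma fcoef_embed_expi (m k : int) :
  fcoef (embed (expi m : testfun R)) k = if k == m then 1 else 0.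
Proof.
rewrite /fcoef embedE.
have -> : (fun x => (expi m : testfun R) x * expi (- k) x) = expi (m - k) :> (R -> R[i]).
  by apply/funext => x; rewrite expiD.
rewrite integral_expi subr_eq0 eq_sym; case: eqP => _; rewrite ?mulr0//.
by rewrite -rmorphM /= mulVf// gt_eqF// twopi_gt0.
Qed.

End fourier_uniqueness.

(** * Symmetric sums and weighted l^2 sequences *)

Section symmetric_sums.

(** Listed in the order in which the symmetric partial sums of series over Z are taken. *)
Definition irange (N : nat) : seq int := [seq j%:Z - N%:Z | j <- iota 0 N.*2.+1].

Lemma mem_irange N (k : int) : (k \in irange N) = (`|k| <= N)%N.
Proof.
apply/mapP/idP => [[j]|kN].
  by rewrite mem_iota add0n => /andP[_ jN] ->; lia.
exists (absz (k + N%:Z)); last by lia.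
by rewrite mem_iota; lia.
Qed.

Lemma irange_uniq N : uniq (irange N).
Proof. by rewrite map_inj_uniq ?iota_uniq// => i j; lia. Qed.

Lemma irangeE (V : zmodType) (a : int -> V) N :
  \sum_(j < N.*2.+1) a (j%:Z - N%:Z) = \sum_(k <- irange N) a k.
Proof. by rewrite big_map -/(index_iota 0 N.*2.+1) big_mkord. Qed.

Lemma irange_sub N M : (N <= M)%N -> {subset irange N <= irange M}.
Proof. by move=> NM k; rewrite !mem_irange => /leq_trans; apply. Qed.

Lemma sub_irange (s : seq int) : exists N, {subset s <= irange N}.
Proof.
exists (\sum_(k <- s) `|k|)%N => k ks; rewrite mem_irange.
by rewrite (big_rem k)//= leq_addr.
Qed.

Lemma sum_subseq_le (R : numDomainType) (I : eqType) (s t : seq I) (a : I -> R) :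
  uniq s -> uniq t -> {subset s <= t} -> (forall k, 0 <= a k) ->
  \sum_(k <- s) a k <= \sum_(k <- t) a k.
Proof.
move=> us ut st a0; have -> : \sum_(k <- s) a k = \sum_(k <- t | k \in s) a k.
  rewrite -[RHS]big_filter; apply: perm_big; apply: uniq_perm; rewrite ?filter_uniq// => k.
  by rewrite mem_filter; case: (boolP (k \in s)) => // /st ->.
by rewrite [leRHS](bigID (mem s)) /= lerDl sumr_ge0.
Qed.

Lemma irange_le (R : numDomainType) (a : int -> R) N M : (forall k, 0 <= a k) ->
  (N <= M)%N -> \sum_(k <- irange N) a k <= \sum_(k <- irange M) a k.
Proof.
by move=> a0 NM; apply: sum_subseq_le; rewrite ?irange_uniq//; exact: irange_sub.
Qed.

Lemma irange_delta (V : zmodType) (a : int -> V) (m : int) N :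
  (forall k, k != m -> a k = 0) -> (`|m| <= N)%N -> \sum_(k <- irange N) a k = a m.
Proof.
move=> a0 mN; rewrite (bigD1_seq m) ?mem_irange ?irange_uniq//=.
by rewrite big1 ?addr0// => k /a0.
Qed.

End symmetric_sums.

Section weighted_l2.
Context {R : realType}.
Implicit Types (w : int -> R) (c : int -> R[i]) (v : pdistr R).

(** Finiteness of a weighted sum of squares.  Bounding the symmetric partial sums
    by a real number avoids extended reals in all later comparisons. *)
Definition wl2 w c : Prop :=
  exists M : R, forall N, \sum_(k <- irange N) w k * normc (c k) ^+ 2 <= M.

Notation l2 := (wl2 (fun=> 1)).

Lemma wl2_le w w' c c' (K : R) : 0 <= K ->
  (forall k, w k * normc (c k) ^+ 2 <= K * (w' k * normc (c' k) ^+ 2)) ->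
  wl2 w' c' -> wl2 w c.
Proof.
move=> K0 h [M hM]; exists (K * M) => N.
apply: le_trans (ler_wpM2l K0 (hM N)); rewrite mulr_sumr.
by apply: ler_sum => k _.
Qed.

Lemma wl2_sum w w1 w2 c c1 c2 (K : R) : 0 <= K ->
  (forall k, w k * normc (c k) ^+ 2 <=
     K * (w1 k * normc (c1 k) ^+ 2 + w2 k * normc (c2 k) ^+ 2)) ->
  wl2 w1 c1 -> wl2 w2 c2 -> wl2 w c.
Proof.
move=> K0 h [M1 h1] [M2 h2]; exists (K * (M1 + M2)) => N.
apply: le_trans (ler_wpM2l K0 (lerD (h1 N) (h2 N))).
by rewrite -big_split mulr_sumr; apply: ler_sum => k _.
Qed.

Lemma sobolevP (s : R) v :
  sobolev s v <-> wl2 (fun k => bracket k `^ (2 * s)) (fcoef v).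
Proof.
set a := fun k : int => bracket k `^ (2 * s) * normc (fcoef v k) ^+ 2.
have a0 k : 0 <= a k by rewrite mulr_ge0 ?powR_ge0 ?exprn_ge0 ?normc_ge0.
have tp := @twopi_gt0 R.
have -> : sobolev s v <-> (\esum_(k in [set: int]) (a k)%:E < +oo)%E.
  rewrite /sobolev /sobolev_sqnorm /= -/a; split => h.
    have : (0 <= \esum_(k in [set: int]) (a k)%:E)%E.
      by apply: esum_ge0 => k _; rewrite lee_fin.
    move: h; case: esum => [r _ _||//]; first exact: ltry.
    by rewrite gt0_muley ?lte_fin.
  by apply: lte_mul_pinfty h; rewrite ?lee_fin ?ltW//.
split=> [h|[M hM]].
  have e0 : (0 <= \esum_(k in [set: int]) (a k)%:E)%E.
    by apply: esum_ge0 => k _; rewrite lee_fin.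
  exists (fine (\esum_(k in [set: int]) (a k)%:E)) => N.
  rewrite -lee_fin fineK ?ge0_fin_numE//.
  apply: esum_ge; exists [set` irange N]; first by split => //; exact: finite_seq.
  by rewrite -fsbig_seq ?irange_uniq// sumEFin.
apply: (@le_lt_trans _ _ M%:E); last exact: ltry.
apply: ge_ereal_sup => _ [F [finF _] <-].
rewrite fsbig_finite//= sumEFin lee_fin.
have [N hN] := sub_irange (finmap.enum_fset (fset_set F)).
by apply: le_trans (hM N); apply: sum_subseq_le; rewrite ?finmap.fset_uniq ?irange_uniq.
Qed.

End weighted_l2.
Notation l2 := (wl2 (fun=> 1)).

Section trigonometric_polynomials.
Context {R : realType}.
Implicit Types (c : int -> R[i]) (f : R -> R[i]) (v : pdistr R).
Notation mu := (@lebesgue_measure R).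
Notation D := (`[0, 2 * pi]%classic : set (measurableTypeR R)).

Definition trig N c : testfun R := \sum_(k <- irange N) c k *: expi k.

Lemma fcoef_trig N c k :
  fcoef (embed (trig N c)) k = if (`|k| <= N)%N then c k else 0.
Proof.
rewrite embed_sum.
transitivity (\sum_(j <- irange N) if j == k then c k else 0).
  apply: eq_bigr => j _; rewrite fcoef_embedZ fcoef_embed_expi eq_sym.
  by case: eqP => [->|_]; rewrite ?mulr1 ?mulr0.
case: ifPn => [kN|kN].
  by rewrite (irange_delta (m := k)) ?eqxx// => j /negbTE ->.
rewrite big_seq big1// => j; rewrite mem_irange => jN.
by case: eqP => // jk; move: kN; rewrite -jk jN.
Qed.

Lemma integral_mul_conj_trig N c f : cintegrable f ->
  integral_period (fun x => f x * (trig N c x)^*) =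
  \sum_(k <- irange N) (c k)^* * integral_period (fun x => f x * expi (- k) x).
Proof.
move=> fi.
rewrite (_ : (fun x => _) = fun x => \sum_(k <- irange N) (c k)^* * (f x * expi (- k) x)).
  rewrite integral_period_sum => [|k]; last by apply: cintegrableZ; exact: cintegrableM_testfun.
  apply: eq_bigr => k _; rewrite integral_periodZ//; exact: cintegrableM_testfun.
apply/funext => x; rewrite /trig testfun_sumE rmorph_sum mulr_sumr.
by apply: eq_bigr => k _; rewrite testfunZE rmorphM /= expi_conj mulrCA.
Qed.

Lemma integrable_sqr_testfun (phi : testfun R) :
  mu.-integrable D (EFin \o (fun x => normc (phi x) ^+ 2)).
Proof.
apply: smooth_integrable.
rewrite (_ : (fun x => _) = fun x => complex.Re (phi x) ^+ 2 + complex.Im (phi x) ^+ 2).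
  have sq (h : R -> R) : continuous h -> continuous (fun x => h x ^+ 2).
    by move=> ch x; apply: (cvgM (ch x) (ch x)).
  by move=> x; apply: cvgD; apply: sq; [exact: continuous_Re_testfun|exact: continuous_Im_testfun].
by apply/funext => x; rewrite sqr_normcE.
Qed.

(** Parseval identity for trigonometric polynomials, by orthogonality of the exponentials. *)
Lemma integral_sqr_trig N c : \int[mu]_(x in D) (normc (trig N c x) ^+ 2) =
  2 * pi * \sum_(k <- irange N) normc (c k) ^+ 2.
Proof.
have : integral_period (fun x => trig N c x * (trig N c x)^*) =
    (2 * pi * \sum_(k <- irange N) normc (c k) ^+ 2)%:C.
  rewrite integral_mul_conj_trig; last exact: cintegrable_testfun.
  rewrite mulr_sumr rmorph_sum; apply: eq_big_seq => k; rewrite mem_irange => kN.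
  have -> : integral_period (fun x => trig N c x * expi (- k) x) =
      (2 * pi)%:C * fcoef (embed (trig N c)) k.
    rewrite /fcoef embedE mulrA -rmorphM /= divff ?mul1r//.
    by rewrite gt_eqF// twopi_gt0.
  by rewrite fcoef_trig kN mulrCA [_^* * _]mulrC mulc_conjc -rmorphM.
move=> /(congr1 (@complex.Re R)) /= <-; apply: eq_Rintegral => x _.
by rewrite mulc_conjc.
Qed.

(** On a set of finite measure |f| <= 1 + |f|^2 makes square integrable functions integrable. *)
Lemma sqr_integrable_cintegrable f :
  measurable_fun D (fun x => complex.Re (f x)) ->
  measurable_fun D (fun x => complex.Im (f x)) ->
  (\int[mu]_(x in D) (normc (f x) ^+ 2)%:E < +oo)%E ->
  mu.-integrable D (EFin \o (fun x => normc (f x) ^+ 2)) /\ cintegrable f.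
Proof.
move=> mr mj fin.
have m2 : measurable_fun D (fun x => normc (f x) ^+ 2).
  rewrite (_ : (fun x => _) = fun x => complex.Re (f x) ^+ 2 + complex.Im (f x) ^+ 2).
    by apply: measurable_funD; exact: measurable_funX.
  by apply/funext => x; rewrite sqr_normcE.
have i2 : mu.-integrable D (EFin \o (fun x => normc (f x) ^+ 2)).
  apply/integrableP; split; first exact/measurable_EFinP.
  under eq_integral do rewrite /= ger0_norm ?exprn_ge0 ?normc_ge0//.
  exact: fin.
have i1 : mu.-integrable D (EFin \o (fun x => 1 + normc (f x) ^+ 2)).
  have i1 : mu.-integrable D (EFin \o (fun=> 1)).
    by apply: smooth_integrable => x; exact: cvg_cst.
  exact: (integrableD period_measurable i1 i2).
have dom (r z : R) : `|r| <= z -> `|r| <= 1 + z ^+ 2.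
  by move=> rz; apply: le_trans rz _; nra.
split=> //; split; apply: (le_integrable period_measurable _ _ i1).
- exact/measurable_EFinP.
- move=> x _ /=; rewrite lee_fin [leRHS]ger0_norm ?addr_ge0 ?sqr_ge0//.
  exact: dom (Re_le_normc _).
- exact/measurable_EFinP.
- move=> x _ /=; rewrite lee_fin [leRHS]ger0_norm ?addr_ge0 ?sqr_ge0//.
  exact: dom (Im_le_normc _).
Qed.

(** Bessel inequality: if S is the N-th partial Fourier sum of f, the square of
    the L^2 norm of f - S is that of f minus that of S. *)
Lemma L2_fcoef_l2 v : L2 v -> l2 (fcoef v).
Proof.
move=> [f [mr mj fin hv]].
have [i2 ci] := sqr_integrable_cintegrable mr mj fin.
have tp := @twopi_gt0 R.
exists ((2 * pi)^-1 * \int[mu]_(x in D) (normc (f x) ^+ 2)) => N.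
under eq_bigr do rewrite mul1r.
rewrite -ler_pdivrMl ?invr_gt0// invrK.
set S := trig N (fcoef v); set E := 2 * pi * _.
have I1 : integral_period (fun x => f x * (S x)^*) = E%:C.
  rewrite integral_mul_conj_trig// /E mulr_sumr rmorph_sum; apply: eq_bigr => k _.
  have -> : integral_period (fun x => f x * expi (- k) x) = (2 * pi)%:C * fcoef v k.
    rewrite /fcoef hv mulrA -rmorphM /= divff ?mul1r//.
    by rewrite gt_eqF.
  by rewrite mulrCA [_^* * _]mulrC mulc_conjc -rmorphM.
have I2 : \int[mu]_(x in D) (normc (S x) ^+ 2) = E by exact: integral_sqr_trig.
have ciS : cintegrable (fun x => f x * (S x)^*).
  rewrite (_ : (fun x => _) = fun x => \sum_(k <- irange N) (fcoef v k)^* * (f x * expi (- k) x)).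
    by apply: cintegrable_sum => k; apply: cintegrableZ; exact: cintegrableM_testfun.
  apply/funext => x; rewrite /S /trig testfun_sumE rmorph_sum mulr_sumr.
  by apply: eq_bigr => k _; rewrite testfunZE rmorphM /= expi_conj mulrCA.
have iS := integrable_sqr_testfun S.
have iRe := ciS.1.
have iRe2 : mu.-integrable D (EFin \o (fun x => 2 * complex.Re (f x * (S x)^*))).
  exact: (integrableZl period_measurable 2 iRe).
have : 0 <= \int[mu]_(x in D) (normc (f x) ^+ 2 - 2 * complex.Re (f x * (S x)^*) + normc (S x) ^+ 2).
  apply: Rintegral_ge0 => x _; rewrite !sqr_normcE Re_cmul.
  case: (f x) (S x) => a b [a' b'] /=.
  have := sqr_ge0 (a - a'); have := sqr_ge0 (b - b'); rewrite !sqrrB; lra.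
rewrite (RintegralD period_measurable (integrableB period_measurable i2 iRe2) iS).
rewrite (RintegralB period_measurable i2 iRe2) (RintegralZl _ period_measurable iRe) I2.
have -> : \int[mu]_(x in D) complex.Re (f x * (S x)^*) = E.
  by have := congr1 (@complex.Re R) I1.
lra.
Qed.

Lemma L2_distribution f :
  measurable_fun D (fun x => complex.Re (f x)) ->
  measurable_fun D (fun x => complex.Im (f x)) ->
  (\int[mu]_(x in D) (normc (f x) ^+ 2)%:E < +oo)%E ->
  exists2 v : pdistr R, L2 v &
    forall phi : testfun R, v phi = integral_period (fun x => f x * phi x).
Proof.
move=> mr mj fin; have [_ ci] := sqr_integrable_cintegrable mr mj fin.
pose V := (fun phi : testfun R => integral_period (fun x => f x * phi x)) : testfun R -> R[i]^o.
have VP : V \in pdistr_pred.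
  apply/pdistr_predP; split=> [a phi psi|].
    rewrite /V -integral_periodZ; last exact: cintegrableM_testfun.
    rewrite -integral_periodD; last exact: cintegrableM_testfun.
      by congr integral_period; apply/funext => x; rewrite testfunDE testfunZE; ring.
    by apply: cintegrableZ; exact: cintegrableM_testfun.
  pose G x := `|complex.Re (f x)| + `|complex.Im (f x)|.
  have ni : mu.-integrable D (EFin \o G).
    by have [/integrable_abse f1 /integrable_abse f2] := ci; exact: (integrableD period_measurable f1 f2).
  exists 0%N, (2 * \int[mu]_(x in D) G x) => phi B hB.
  have B0 : 0 <= B by exact: le_trans (normc_ge0 _) (hB 0%N 0 isT).
  have pB x : normc (f x * phi x) <= B * G x.
    rewrite ComplexField.Normc.normcM mulrC ler_pM ?normc_ge0 ?normc_le_ReD_Im//.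
    exact: (hB 0%N).
  have [iR iI] := cintegrableM_testfun phi ci.
  have bnd (g : R -> R) : mu.-integrable D (EFin \o g) -> (forall x, `|g x| <= B * G x) ->
      `|\int[mu]_(x in D) g x| <= (\int[mu]_(x in D) G x) * B.
    move=> ig gB; apply: le_trans (le_normr_Rintegral period_measurable ig) _.
    rewrite [leRHS]mulrC -(RintegralZl _ period_measurable ni).
    apply: (le_Rintegral period_measurable) => //.
    - exact: integrable_abse ig.
    - exact: (integrableZl period_measurable B ni).
  apply: le_trans (normc_le_ReD_Im _) _; rewrite [leRHS](_ : _ =
    (\int[mu]_(x in D) G x) * B + (\int[mu]_(x in D) G x) * B); last by ring.
  apply: lerD; apply: bnd => //.
  - by move=> x; exact: le_trans (Re_le_normc _) (pB x).
  - by move=> x; exact: le_trans (Im_le_normc _) (pB x).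
by exists (PDistr VP) => //; exists f; split.
Qed.

End trigonometric_polynomials.

(** * The theorem of Riesz and Fischer *)

Section riesz_fischer.
Context {R : realType}.
Implicit Types (c : int -> R[i]) (v : pdistr R) (phi : testfun R).
Notation mu := (@lebesgue_measure R).
Notation D := (`[0, 2 * pi]%classic : set (measurableTypeR R)).

(** Iterating (x + r)^2 <= 2 x^2 + 2 r^2.  The exponential weights are harmless
    against increments whose squared norms decrease like 4^(- i). *)
Lemma sqr_sum_weighted n (x : nat -> R) :
  (\sum_(i < n) x i) ^+ 2 <= \sum_(i < n) 2 ^+ i.+1 * x i ^+ 2.
Proof.
elim: n x => [|n IH] x; first by rewrite !big_ord0 expr0n.
rewrite !big_ord_recl /=; have := IH (fun i => x i.+1).
set r := \sum_(i < n) _ => h.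
have -> : \sum_(i < n) 2 ^+ (bump 0 i).+1 * x (bump 0 i) ^+ 2 =
    2 * \sum_(i < n) 2 ^+ i.+1 * x i.+1 ^+ 2.
  by rewrite mulr_sumr; apply: eq_bigr => i _; rewrite exprS mulrA.
have : (x 0%N + r) ^+ 2 <= 2 * x 0%N ^+ 2 + 2 * r ^+ 2.
  by have := sqr_ge0 (x 0%N - r); rewrite sqrrB sqrrD; lra.
rewrite expr1; lra.
Qed.

Lemma normc_sum_le n (z : nat -> R[i]) :
  normc (\sum_(i < n) z i) <= \sum_(i < n) normc (z i).
Proof.
elim/big_ind2: _ => [|a b a' b' h h'|//]; first by rewrite ComplexField.Normc.normc0.
exact: le_trans (le_normcD _ _) (lerD h h').
Qed.

Lemma cvgn_EFin (h : nat -> R) (l : R) :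
  h n @[n --> \oo] --> l -> (h n)%:E @[n --> \oo] --> l%:E.
Proof. by move=> hl; apply/fine_cvgP; split => //; exact: nearW. Qed.

(** The upper limit is measurable everywhere and agrees with the limit where the
    latter exists. *)
Lemma measurable_pointwise_limit (h : nat -> R -> R) :
  (forall n, measurable_fun D (h n)) ->
  exists2 f : R -> R, measurable_fun D f &
    forall x l, h n x @[n --> \oo] --> l -> f x = l.
Proof.
move=> mh; exists (fun x => fine (limn_esup (fun n => (h n x)%:E))).
  apply: measurableT_comp; first exact: fine_measurable.
  have mh' n : measurable_fun D (EFin \o h n) by exact/measurable_EFinP.
  exact: (measurable_fun_limn_esup mh').
move=> x l hl; have hl' : (h n x)%:E @[n --> \oo] --> l%:E by exact: cvgn_EFin.
by rewrite is_cvg_limn_esupE ?(cvg_lim _ hl')//; apply/cvg_ex; exists l%:E.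
Qed.

Lemma sum_halves (C : R) n : \sum_(i < n) C * 2^-1 ^+ i = C * 2 * (1 - 2^-1 ^+ n).
Proof.
elim: n => [|n IH]; first by rewrite big_ord0 expr0 subrr mulr0.
by rewrite big_ord_recr /= IH exprS; field.
Qed.

Section telescoping.
Variables (d : nat -> testfun R) (C : R).
Hypothesis dC : forall i, \int[mu]_(x in D) (normc (d i x) ^+ 2) <= C / 4 ^+ i.

(* G dominates the squared partial sums and, where finite, forces their convergence. *)
Let g i (x : R) : R := 2 ^+ i.+1 * normc (d i x) ^+ 2.
Let G (x : R) : \bar R := (\sum_(i <oo) (g i x)%:E)%E.
Let u n : testfun R := \sum_(i < n) d i.

Let g_ge0 i x : 0 <= g i x.
Proof. by rewrite mulr_ge0 ?exprn_ge0 ?normc_ge0. Qed.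

Let ig i : mu.-integrable D (EFin \o g i).
Proof. exact: (integrableZl period_measurable _ (integrable_sqr_testfun (d i))). Qed.

Let G_ge n x : ((\sum_(i < n) g i x)%:E <= G x)%E.
Proof.
rewrite -sumEFin -(big_mkord xpredT (fun i => (g i x)%:E)).
by apply: nneseries_lim_ge => i _ _; rewrite lee_fin.
Qed.

Let G_ge0 x : (0 <= G x)%E.
Proof. by have := G_ge 0 x; rewrite big_ord0. Qed.

Let mG : measurable_fun D G.
Proof.
by apply: ge0_emeasurable_sum => [i x _ _|i _]; [rewrite lee_fin|exact: measurable_int (ig i)].
Qed.

Let G_integrable : mu.-integrable D G.
Proof.
apply/integrableP; split => //.
under eq_integral do rewrite gee0_abs//.
rewrite (integral_nneseries mu period_measurable) => [|i|i x _].
- apply: (@le_lt_trans _ _ (4 * C)%:E); last exact: ltry.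
  apply: lime_le.
    by apply: is_cvg_nneseries => i _ _; apply: integral_ge0 => x _; rewrite lee_fin.
  apply: nearW => n; rewrite big_mkord.
  have gi i : (\int[mu]_(x in D) (g i x)%:E = (\int[mu]_(x in D) g i x)%:E)%E.
    by rewrite fineK//; exact: integrable_fin_num (ig i).
  under eq_bigr do rewrite gi; rewrite sumEFin lee_fin.
  have le1 i : \int[mu]_(x in D) g i x <= 2 * C * 2^-1 ^+ i.
    rewrite (RintegralZl _ period_measurable (integrable_sqr_testfun (d i))).
    apply: le_trans (ler_wpM2l _ (dC i)) _; first exact: exprn_ge0.
    have -> : (4 : R) = 2 * 2 by ring.
    rewrite exprS exprMn exprVn le_eqVlt; apply/orP; left; apply/eqP.
    by field; rewrite expf_neq0.
  apply: (@le_trans _ _ (\sum_(i < n) 2 * C * 2^-1 ^+ i)).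
    by apply: ler_sum => i _; exact: le1.
  have C0 : 0 <= C.
    have := dC 0; rewrite expr0 divr1; apply: le_trans.
    by apply: Rintegral_ge0 => x _; rewrite sqr_ge0.
  rewrite sum_halves; have : 0 <= 2^-1 ^+ n :> R by rewrite exprn_ge0// invr_ge0.
  have : 0 <= C * 2^-1 ^+ n by rewrite mulr_ge0// exprn_ge0// invr_ge0.
  nra.
- exact: measurable_int (ig i).
- by rewrite lee_fin.
Qed.

Let u_bound n x : ((normc (u n x) ^+ 2)%:E <= G x)%E.
Proof.
apply: le_trans (G_ge n x); rewrite lee_fin.
apply: le_trans (sqr_sum_weighted n (fun i => normc (d i x))).
rewrite ler_sqr ?nnegrE ?normc_ge0 ?sumr_ge0//.
  by rewrite /u testfun_sumE; exact: normc_sum_le (fun i => d i x).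
by move=> i _; exact: normc_ge0.
Qed.

Let u_cvg (h : R[i] -> R) x : (forall z w, h (z + w) = h z + h w) -> h 0 = 0 ->
  (forall z, `|h z| <= normc z) -> G x \is a fin_num ->
  cvgn (fun n => h (u n x)).
Proof.
move=> hD h0 hn Gfin.
have -> : (fun n => h (u n x)) = series (fun i => h (d i x)).
  apply/funext => n; rewrite /u testfun_sumE /series /= big_mkord.
  by apply: (big_morph h).
apply: normed_cvg; apply: nondecreasing_is_cvgn.
  apply/nondecreasing_seqP => n /=.
  by rewrite /series /= big_nat_recr//= lerDl.
exists (2 + fine (G x)) => _ [n _ <-]; rewrite [leLHS]big_mkord.
(* Either t <= 2^(- i), or 1 <= 2^i t and then t <= 2^i t^2. *)
have le1 i : `|h (d i x)| <= 1 * 2^-1 ^+ i + g i x.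
  apply: le_trans (hn _) _; rewrite /g mul1r.
  move: (normc (d i x)) (normc_ge0 (d i x)) => t t0.
  have e0 : 0 < 2 ^+ i :> R by rewrite exprn_gt0.
  have i0 : 0 < 2^-1 ^+ i :> R by rewrite exprn_gt0// invr_gt0.
  have [tl|tl] := leP t (2^-1 ^+ i); first by rewrite (le_trans tl)// lerDl mulr_ge0 ?sqr_ge0 ?exprn_ge0.
  apply: (@le_trans _ _ (2 ^+ i.+1 * t ^+ 2)); last by rewrite lerDr ltW.
  have h1 : 1 <= 2 ^+ i * t.
    have : 2 ^+ i * 2^-1 ^+ i <= 2 ^+ i * t by rewrite ler_pM2l// ltW.
    by rewrite -exprMn divff// expr1n.
  rewrite exprS; have : t * 1 <= t * (2 ^+ i * t) by rewrite ler_wpM2l.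
  have : 0 <= t * (2 ^+ i * t) by rewrite !mulr_ge0// ltW.
  by rewrite expr2; lra.
apply: (@le_trans _ _ (\sum_(i < n) (1 * 2^-1 ^+ i + g i x))).
  by apply: ler_sum => i _; exact: le1.
rewrite big_split /= lerD//.
  rewrite sum_halves mul1r; have : 0 <= 2^-1 ^+ n :> R by rewrite exprn_ge0// invr_ge0.
  lra.
by rewrite -lee_fin fineK//; exact: G_ge.
Qed.

(** G is integrable, hence finite almost everywhere, and there the series of the
    d i converges absolutely.  Its partial sums u satisfy |u|^2 <= G, so that
    the limit is square integrable and dominated convergence applies with the
    bound |u| <= 1 + G. *)
Lemma telescoping_limit : exists f : R -> R[i],
  [/\ measurable_fun D (fun x => complex.Re (f x)),
      measurable_fun D (fun x => complex.Im (f x)),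
      (\int[mu]_(x in D) (normc (f x) ^+ 2)%:E < +oo)%E &
      forall phi,
        complex.Re (integral_period (fun x => (\sum_(i < n) d i : testfun R) x * phi x)) @[n --> \oo]
          --> complex.Re (integral_period (fun x => f x * phi x)) /\
        complex.Im (integral_period (fun x => (\sum_(i < n) d i : testfun R) x * phi x)) @[n --> \oo]
          --> complex.Im (integral_period (fun x => f x * phi x))].
Proof.
have mtest (h : testfun R) : measurable_fun D (fun x => complex.Re (h x)) /\
    measurable_fun D (fun x => complex.Im (h x)).
  split.
    by apply: measurable_funS (continuous_measurable_fun (@continuous_Re_testfun R h)).
  by apply: measurable_funS (continuous_measurable_fun (@continuous_Im_testfun R h)).
have [fr mr lr] := measurable_pointwise_limit (fun n => (mtest (u n)).1).
have [fj mj lj] := measurable_pointwise_limit (fun n => (mtest (u n)).2).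
pose f x : R[i] := Complex (fr x) (fj x).
have cr x : G x \is a fin_num -> complex.Re (u n x) @[n --> \oo] --> fr x.
  move=> /(u_cvg Re_caddE erefl (@Re_le_normc R)) h.
  by rewrite (lr x _ h).
have cj x : G x \is a fin_num -> complex.Im (u n x) @[n --> \oo] --> fj x.
  move=> /(u_cvg Im_caddE erefl (@Im_le_normc R)) h.
  by rewrite (lj x _ h).
(* Where G is infinite the inequality is trivial, whatever the value of f. *)
have fG x : ((normc (f x) ^+ 2)%:E <= G x)%E.
  have [Gfin|] := boolP (G x \is a fin_num); last first.
    by rewrite ge0_fin_numE// ltey negbK => /eqP ->; exact: leey.
  rewrite -[G x]fineK// lee_fin sqr_normcE /=.
  have l : complex.Re (u n x) ^+ 2 + complex.Im (u n x) ^+ 2 @[n --> \oo] -->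
      fr x ^+ 2 + fj x ^+ 2.
    by rewrite !expr2; apply: cvgD; apply: cvgM; by [exact: cr|exact: cj].
  rewrite -(cvg_lim _ l)//; apply: limr_le; first by apply/cvg_ex; exists (fr x ^+ 2 + fj x ^+ 2).
  by apply: nearW => n; rewrite -sqr_normcE -lee_fin fineK.
have fin : (\int[mu]_(x in D) (normc (f x) ^+ 2)%:E < +oo)%E.
  have /integrableP[_] := G_integrable; apply: le_lt_trans.
  apply: ge0_le_integral => //.
  - by move=> x _; rewrite lee_fin sqr_ge0.
  - apply/measurable_EFinP; rewrite (_ : (fun x => _) = fun x => fr x ^+ 2 + fj x ^+ 2).
      by apply: measurable_funD; exact: measurable_funX.
    by apply/funext => x; rewrite sqr_normcE.
  - exact: measurableT_comp.
  - by move=> x _; rewrite gee0_abs.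
exists f; split => // phi.
have [B B0 hB] := bounded_testfun phi.
have i1 : mu.-integrable D (EFin \o (fun=> 1)).
  by apply: smooth_integrable => x; exact: cvg_cst.
have iB : mu.-integrable D (fun x => B%:E * (1 + G x))%E.
  exact: (integrableZl period_measurable B (integrableD period_measurable i1 G_integrable)).
have ub n x (h : R) : `|h| <= normc (u n x * phi x) -> (`|h%:E| <= B%:E * (1 + G x))%E.
  move=> hu; apply: (@le_trans _ _ (B%:E * (1 + (normc (u n x) ^+ 2)%:E))%E); last first.
    by rewrite lee_wpmul2l ?lee_fin// leeD2l.
  rewrite -EFinD -EFinM abse_EFin lee_fin; apply: le_trans hu _.
  rewrite ComplexField.Normc.normcM mulrC; apply: ler_pM; rewrite ?normc_ge0//.
  nra.
have aeG : \forall x \ae mu, D x -> G x \is a fin_num.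
  exact: (integrable_ae period_measurable G_integrable).
have [mp mq] := mtest phi.
have conv (h : nat -> R -> R) (k : R -> R) :
    (forall n, measurable_fun D (h n)) -> measurable_fun D k ->
    (forall n x, `|h n x| <= normc (u n x * phi x)) ->
    (forall x, G x \is a fin_num -> h n x @[n --> \oo] --> k x) ->
    (\int[mu]_(x in D) h n x) @[n --> \oo] --> \int[mu]_(x in D) k x.
  move=> mh mk hu hk.
  have mh' n : measurable_fun D (EFin \o h n) by exact/measurable_EFinP.
  have mk' : measurable_fun D (EFin \o k) by exact/measurable_EFinP.
  have ae1 : \forall x \ae mu, D x -> (EFin \o h n) x @[n --> \oo] --> (EFin \o k) x.
    by apply: filterS aeG => x Gx Dx; apply: cvgn_EFin; apply: hk; exact: Gx.
  have ae2 : \forall x \ae mu, forall n, D x ->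
      (`|(EFin \o h n) x| <= B%:E * (1 + G x))%E.
    by apply: nearW => x n _; apply: ub; exact: hu.
  have [ik _] := dominated_convergence period_measurable mh' mk' ae1 iB ae2.
  have -> : (\int[mu]_(x in D) (EFin \o k) x = (\int[mu]_(x in D) k x)%:E)%E.
    by rewrite fineK//; exact: (integrable_fin_num period_measurable ik).
  by move/fine_cvgP => [_].
have uR n x : complex.Re (u n x * phi x) =
  complex.Re (u n x) * complex.Re (phi x) - complex.Im (u n x) * complex.Im (phi x).
  exact: Re_cmul.
have uI n x : complex.Im (u n x * phi x) =
  complex.Re (u n x) * complex.Im (phi x) + complex.Im (u n x) * complex.Re (phi x).
  exact: Im_cmul.
have mu_phi n := cintegrableM_testfun phi (cintegrable_testfun (u n)).
split; apply: conv.
- by move=> n; apply/measurable_EFinP; exact: measurable_int (mu_phi n).1.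
- have -> : (fun x => complex.Re (f x * phi x)) =
      (fun x => fr x * complex.Re (phi x) - fj x * complex.Im (phi x)).
    by apply/funext => x; rewrite Re_cmul.
  by apply: measurable_funB; apply: measurable_funM.
- by move=> n x; exact: Re_le_normc.
- move=> x Gx; rewrite Re_cmul -[X in X @ _](funext (fun n => esym (uR n x))).
  by apply: cvgB; apply: cvgM; by [exact: cvg_cst|exact: cr|exact: cj].
- by move=> n; apply/measurable_EFinP; exact: measurable_int (mu_phi n).2.
- have -> : (fun x => complex.Im (f x * phi x)) =
      (fun x => fr x * complex.Im (phi x) + fj x * complex.Re (phi x)).
    by apply/funext => x; rewrite Im_cmul.
  by apply: measurable_funD; apply: measurable_funM.
- by move=> n x; exact: Im_le_normc.
- move=> x Gx; rewrite Im_cmul -[X in X @ _](funext (fun n => esym (uI n x))).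
  by apply: cvgD; apply: cvgM; by [exact: cvg_cst|exact: cr|exact: cj].
Qed.

End telescoping.
End riesz_fischer.

Section riesz_fischer_theorem.
Context {R : realType}.
Implicit Types (c : int -> R[i]).

Lemma irangeB (a : int -> R) N N' : (N <= N')%N ->
  \sum_(k <- irange N') (if (`|k| <= N)%N then 0 else a k) =
  \sum_(k <- irange N') a k - \sum_(k <- irange N) a k.
Proof.
move=> NN'; have -> : \sum_(k <- irange N) a k =
    \sum_(k <- irange N') if (`|k| <= N)%N then a k else 0.
  rewrite -big_mkcond -[RHS]big_filter; apply: perm_big; apply: uniq_perm.
  - exact: irange_uniq.
  - by rewrite filter_uniq// irange_uniq.
  move=> k; rewrite mem_filter !mem_irange.
  by case: (leqP `|k| N) => // /leq_trans ->.
by rewrite -sumrB; apply: eq_bigr => k _; case: ifP => _; rewrite ?subrr ?subr0.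
Qed.

Lemma nondecreasing_tail (A : nat -> R) (M eps : R) :
  nondecreasing_seq A -> (forall n, A n <= M) -> 0 < eps ->
  exists n, forall m, (n <= m)%N -> A m - A n <= eps.
Proof.
move=> ndA bA eps0; have cA : cvgn A.
  by apply: nondecreasing_is_cvgn => //; exists M => _ [n _ <-].
have /cvgrPdist_le/(_ _ eps0)[n _ hn] := cA.
exists n => m nm; have := hn n (leqnn n); rewrite /= ler_norml => /andP[_ h].
have := nondecreasing_cvgn_le ndA cA m; lra.
Qed.

(** Partial sums along a sparse subsequence N i have increments with squared norms
    at most 2 pi 4^(- i), which is what telescoping_limit asks for. *)
Theorem riesz_fischer c : l2 c ->
  exists2 v : pdistr R, L2 v & forall k, fcoef v k = c k.
Proof.
move=> [M hM]; pose A N := \sum_(k <- irange N) normc (c k) ^+ 2.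
have AM N : A N <= M by apply: le_trans (hM N); rewrite /A; under [leRHS]eq_bigr do rewrite mul1r.
have ndA : nondecreasing_seq A.
  by move=> n m nm; apply: irange_le => // k; exact: sqr_ge0.
have [n hn] : exists n : nat -> nat, forall i m, (n i <= m)%N -> A m - A (n i) <= 4^-1 ^+ i.
  suff /choice[n hn] : forall i, exists n, forall m, (n <= m)%N -> A m - A n <= 4^-1 ^+ i.
    by exists n.
  by move=> i; apply: nondecreasing_tail ndA AM _; rewrite exprn_gt0// invr_gt0.
(* Summing the thresholds makes the subsequence increasing, with N i >= n i and N i >= i. *)
pose N i := (\sum_(j < i.+1) (n j).+1)%N.
have NS i : N i.+1 = (N i + (n i.+1).+1)%N by rewrite /N big_ord_recr.
have Nn i : (n i <= N i)%N.
  by case: i => [|i]; rewrite ?NS /N ?big_ord_recr ?big_ord0 /=; lia.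
have Ni i : (i <= N i)%N by elim: i => // i IH; rewrite NS; lia.
have Nle i : (N i <= N i.+1)%N by rewrite NS leq_addr.
have tail i : A (N i.+1) - A (N i) <= 4^-1 ^+ i.
  have h1 : A (n i) <= A (N i) by apply: ndA.
  have h2 : A (N i.+1) - A (n i) <= 4^-1 ^+ i by apply: hn; exact: leq_trans (Nn i) (Nle i).
  lra.
pose d i := if i is j.+1 then trig (N i) (fun k => if (`|k| <= N j)%N then 0 else c k)
  else trig (N 0%N) c.
have tp := @twopi_gt0 R.
have M0 : 0 <= M.
  by apply: le_trans (AM 0%N); apply: sumr_ge0 => k _; exact: sqr_ge0.
(* The term d 0 is bounded through M, and 4 absorbs the shift from 4^(- i) to 4^(- (i + 1)). *)
have dC i : \int[lebesgue_measure]_(x in `[0, 2 * pi]) (normc (d i x) ^+ 2) <=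
    (2 * pi * (M + 4)) / 4 ^+ i.
  case: i => [|i]; rewrite [leLHS]integral_sqr_trig.
    by rewrite expr0 divr1 ler_wpM2l ?(ltW tp)//; have := AM (N 0%N); rewrite /A; lra.
  have -> : \sum_(k <- irange (N i.+1)) normc (if (`|k| <= N i)%N then 0 else c k) ^+ 2 =
      A (N i.+1) - A (N i).
    rewrite -irangeB//; apply: eq_bigr => k _.
    by case: ifP => _; rewrite // ComplexField.Normc.normc0 expr0n.
  rewrite -[leRHS]mulrA; apply: ler_wpM2l; first exact: ltW.
  apply: le_trans (tail i) _.
  rewrite exprS exprVn; have : 0 < 4 ^- i :> R by rewrite invr_gt0 exprn_gt0.
  rewrite invfM mulrA => e0; rewrite -[leLHS]mul1r ler_wpM2r ?(ltW e0)//; lra.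
have [f [mr mj fin lim]] := telescoping_limit dC.
have [v vL2 hv] := L2_distribution mr mj fin.
exists v => // k.
have partial m : (`|k| < m)%N -> fcoef (embed (\sum_(i < m) d i)) k = c k.
  have H j : fcoef (embed (\sum_(i < j.+1) d i)) k = if (`|k| <= N j)%N then c k else 0.
    elim: j => [|j IH]; first by rewrite big_ord_recr big_ord0 /= add0r fcoef_trig.
    rewrite big_ord_recr fcoef_embedD IH /= fcoef_trig.
    case: leqP => h1; last by rewrite add0r.
    by rewrite (leq_trans h1 (Nle j)) addr0.
  case: m => // m; rewrite ltnS => km.
  by rewrite H (leq_trans km (Ni m)).
have I m : (`|k| < m)%N ->
    integral_period (fun x => (\sum_(i < m) d i : testfun R) x * expi (- k) x) =
    (2 * pi)%:C * c k.
  move=> /partial <-; rewrite /fcoef embedE mulrA -rmorphM /= divff ?mul1r//.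
  by rewrite gt_eqF.
have [lR lI] := lim (expi (- k)).
have If : integral_period (fun x => f x * expi (- k) x) = (2 * pi)%:C * c k.
  apply: eq_cplx.
  - apply: (cvg_unique (@Rhausdorff R) lR); apply: cvg_near_cst.
    by exists `|k|.+1%N => // m km; exact: (congr1 (@complex.Re R) (I m km)).
  - apply: (cvg_unique (@Rhausdorff R) lI); apply: cvg_near_cst.
    by exists `|k|.+1%N => // m km; exact: (congr1 (@complex.Im R) (I m km)).
rewrite /fcoef hv If mulrA -rmorphM /= mulVf ?mul1r//.
by rewrite gt_eqF.
Qed.

Lemma L2P (v : pdistr R) : L2 v <-> l2 (fcoef v).
Proof.
split; first exact: L2_fcoef_l2.
by move=> /riesz_fischer[w wL2 wv]; rewrite -(fcoef_inj wv).
Qed.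

Lemma multiplierP (m : int -> R[i]) (v : pdistr R) :
  l2 (fun k => m k * fcoef v k) -> forall k, fcoef (multiplier m v) k = m k * fcoef v k.
Proof.
by move=> /riesz_fischer[w _ hw] k; rewrite (fcoef_multiplier hw).
Qed.

End riesz_fischer_theorem.

(** * The symbols and the frequencies *)

Section symbols.
Context {R : realType}.

Lemma tanhN (t : R) : tanh (- t) = - tanh t.
Proof. by rewrite /tanh opprK addrC [expR (- t) + _]addrC -mulNr opprB addrC. Qed.

Lemma tanhE (t : R) : tanh t = 1 - 2 / (expR (t *+ 2) + 1).
Proof.
have e0 := expR_gt0 t; have e1 := expR_gt0 (t *+ 2).
rewrite /tanh expRN mulr2n expRD in e1 *.
by field; rewrite !lt0r_neq0// addr_gt0// mulr_gt0.
Qed.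

Lemma tanh_lt (s t : R) : s < t -> tanh s < tanh t.
Proof.
move=> st; rewrite !tanhE ltrD2l ltrN2 ltr_pM2l// ltf_pV2 ?posrE ?addr_gt0 ?expR_gt0//.
by rewrite ltrD2r ltr_expR ltr_pMn2r.
Qed.

Lemma tanh0 : tanh (0 : R) = 0.
Proof. by rewrite /tanh oppr0 subrr mul0r. Qed.

Lemma tanh_gt0 (t : R) : 0 < t -> 0 < tanh t.
Proof. by move=> /tanh_lt; rewrite tanh0. Qed.

Lemma tanh_lt1 (t : R) : tanh t < 1.
Proof.
rewrite tanhE ltrBlDr ltrDl divr_gt0// addr_gt0// expR_gt0//.
Qed.

Lemma sqr_tanh_le1 (t : R) : tanh t ^+ 2 <= 1.
Proof.
have h1 := tanh_lt1 t; have := tanh_lt1 (- t); rewrite tanhN => h2; nra.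
Qed.

Variables (beta : R) (beta_gt0 : 0 < beta).
Notation p := (p_symbol beta).
Notation m := (m_symbol beta).

Lemma m_symbolE k : m k = k%:~R * p k.
Proof.
rewrite /m_symbol /p_symbol; case: eqP => [->|/eqP k0].
  by rewrite mulr0 tanh0 mul0r mul0r.
have k1 : k%:~R != 0 :> R by rewrite intr_eq0.
by field; rewrite k1 gt_eqF.
Qed.

Lemma m_symbolN k : m (- k) = - m k.
Proof. by rewrite /m_symbol intrN mulrN tanhN mulNr. Qed.

Lemma p_symbolN k : p (- k) = p k.
Proof.
rewrite /p_symbol oppr_eq0; case: eqP => // _.
by rewrite intrN mulrN tanhN invrN mulrNN.
Qed.

Lemma p_symbol_pos k : (0 < k) -> 0 < p k.
Proof.
move=> k0; rewrite /p_symbol gt_eqF//.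
have k1 : 0 < k%:~R :> R by rewrite ltr0z.
by rewrite divr_gt0 ?tanh_gt0 ?mulr_gt0.
Qed.

Lemma p_symbol_gt0 k : 0 < p k.
Proof.
have [/p_symbol_pos//|k0|<-] := ltrgtP 0 k; last by rewrite /p_symbol eqxx.
by rewrite -p_symbolN; apply: p_symbol_pos; rewrite oppr_gt0.
Qed.

Lemma m_symbol_lt j k : j < k -> m j < m k.
Proof.
by move=> jk; rewrite /m_symbol ltr_pM2r ?invr_gt0// tanh_lt// ltr_pM2l// ltr_int.
Qed.

Lemma m_symbol_gt0 k : 0 < k -> 0 < m k.
Proof.
by move=> k0; rewrite m_symbolE mulr_gt0 ?p_symbol_gt0// ltr0z.
Qed.

Lemma sqr_m_symbol_le k : m k ^+ 2 <= beta^-1 ^+ 2.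
Proof.
rewrite /m_symbol exprMn -[leRHS]mul1r ler_wpM2r ?sqr_ge0//.
exact: sqr_tanh_le1.
Qed.

Lemma sqr_m_symbol_ge k : k != 0 -> m 1 ^+ 2 <= m k ^+ 2.
Proof.
have m1 := m_symbol_gt0 (ltr01 : 0 < 1 :> int).
have pos j : 0 < j -> m 1 ^+ 2 <= m j ^+ 2.
  move=> j0; rewrite ler_sqr ?nnegrE ?(ltW m1) ?(ltW (m_symbol_gt0 j0))//.
  have : 1 <= j by lia.
  by rewrite le_eqVlt => /orP[/eqP ->//|/m_symbol_lt/ltW].
move=> k0; have [/pos//|k1|/esym/eqP] := ltrgtP 0 k; last by rewrite (negbTE k0).
by rewrite -[m k]opprK -m_symbolN sqrrN; apply: pos; rewrite oppr_gt0.
Qed.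

Lemma bracket_ge1 (k : int) : 1 <= bracket k :> R.
Proof. by rewrite -[leLHS]sqrtr1 ler_wsqrtr// lerDl sqr_ge0. Qed.

Lemma bracket_gt0 (k : int) : 0 < bracket k :> R.
Proof. exact: lt_le_trans ltr01 (bracket_ge1 k). Qed.

(** p_k is of the exact order of the inverse bracket of k, so that the energy norm
    is equivalent to the norm of L^2 x H^(-1/2). *)
Lemma p_symbol_bracket : exists2 K : R, 0 < K &
  forall k, p k * bracket k <= K /\ 1 <= K * (p k * bracket k).
Proof.
have t0 := tanh_gt0 beta_gt0; have tb : 0 < beta / tanh beta by rewrite divr_gt0.
(* The three terms serve k = 0, the upper bound tanh <= 1 and the lower bound tanh (beta k) >= tanh beta. *)
exists (1 + 2 / beta + beta / tanh beta).
  by rewrite !addr_gt0// divr_gt0.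
have b2 : 0 < 2 / beta by rewrite divr_gt0.
set K := _ + _.
have K1 : 1 <= K by rewrite /K; lra.
have pos k : 0 < k -> p k * bracket k <= K /\ 1 <= K * (p k * bracket k).
  move=> k0; have k1 : 1 <= k%:~R :> R by rewrite -[1]/(1%:~R) ler_int; lia.
  have kp : 0 < k%:~R :> R by lra.
  have bl : k%:~R <= bracket k :> R.
    by rewrite -[leLHS]ger0_norm ?(ltW kp)// -sqrtr_sqr /bracket ler_wsqrtr// lerDr.
  have bu : bracket k <= 2 * k%:~R :> R.
    rewrite -[leRHS]ger0_norm ?mulr_ge0 ?(ltW kp)// -sqrtr_sqr /bracket ler_wsqrtr//.
    by rewrite exprMn; nra.
  rewrite /p_symbol gt_eqF//.
  have bk : 0 < beta * k%:~R by rewrite mulr_gt0.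
  have tl : tanh beta <= tanh (beta * k%:~R).
    have [->|/eqP kn1] := eqVneq k 1; first by rewrite mulr1.
    apply: ltW; apply: tanh_lt; rewrite ltr_pMr//.
    by rewrite -[1]/(1%:~R) ltr_int; lia.
  have tu := tanh_lt1 (beta * k%:~R).
  split.
    apply: (@le_trans _ _ (2 / beta)); last by rewrite /K; lra.
    rewrite mulrAC ler_pdivrMr//.
    have -> : 2 / beta * (beta * k%:~R) = 2 * k%:~R by field; rewrite gt_eqF.
    have := ltW tu; have := bracket_gt0 k; nra.
  apply: (@le_trans _ _ (beta / tanh beta * (tanh (beta * k%:~R) / (beta * k%:~R) * bracket k))).
    have -> : beta / tanh beta * (tanh (beta * k%:~R) / (beta * k%:~R) * bracket k) =
        (tanh (beta * k%:~R) / tanh beta) * (bracket k / k%:~R).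
      by field; rewrite !gt_eqF.
    have h1 : 1 <= tanh (beta * k%:~R) / tanh beta by rewrite ler_pdivlMr// mul1r.
    have h2 : 1 <= bracket k / k%:~R :> R by rewrite ler_pdivlMr// mul1r.
    by nra.
  apply: ler_wpM2r; last by rewrite /K; lra.
  apply: mulr_ge0; last exact: ltW (bracket_gt0 k).
  by apply: divr_ge0; apply: ltW => //; exact: lt_le_trans t0 tl.
have bN (k : int) : bracket (- k) = bracket k :> R.
  by rewrite /bracket intrN sqrrN.
move=> k; have [/pos//|k0|<-] := ltrgtP 0 k.
  by have := pos (- k); rewrite oppr_gt0 bN p_symbolN; apply.
rewrite /p_symbol eqxx /bracket expr0n addr0 sqrtr1 !mulr1; split => //.
Qed.

(** The frequencies indexed by Z, with sign: tau_n = omega_n for n >= 0 and tau is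
    odd, so that i tau enumerates the spectrum. *)
Definition tau (k : int) : R := k%:~R * Num.sqrt (p k).

Lemma tauN k : tau (- k) = - tau k.
Proof. by rewrite /tau p_symbolN intrN mulNr. Qed.

Lemma sqr_tau k : tau k ^+ 2 = k%:~R * m k.
Proof. by rewrite /tau exprMn sqr_sqrtr ?ltW ?p_symbol_gt0// m_symbolE; ring. Qed.

Lemma tau0 : tau 0 = 0.
Proof. by rewrite /tau mul0r. Qed.

Lemma tau_gt0 k : 0 < k -> 0 < tau k.
Proof. by move=> k0; rewrite /tau mulr_gt0 ?ltr0z// sqrtr_gt0 p_symbol_gt0. Qed.

Lemma tau_lt_pos j k : 0 < j -> j < k -> tau j < tau k.
Proof.
move=> j0 jk; have tj := tau_gt0 j0; have tk := tau_gt0 (lt_trans j0 jk).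
rewrite -ltr_sqr ?nnegrE ?(ltW tj) ?(ltW tk)// !sqr_tau.
have h1 := m_symbol_lt jk; have h2 := m_symbol_gt0 j0.
have h3 : j%:~R < k%:~R :> R by rewrite ltr_int.
have h4 : 0 < j%:~R :> R by rewrite ltr0z.
by apply: ltr_pM => //; exact: ltW.
Qed.

Lemma tau_inj : injective tau.
Proof.
suff lt j k : j < k -> tau j < tau k.
  move=> j k e; apply/eqP; rewrite eq_le !leNgt.
  by apply/andP; split; apply/negP => /lt; rewrite e ltxx.
move=> jk; have [j0|j0|j0] := ltrgtP 0 j; first exact: tau_lt_pos.
- have [k0|k0|<-] := ltrgtP 0 k.
  + apply: (@lt_trans _ _ 0); last exact: tau_gt0.
    by rewrite -oppr_gt0 -tauN tau_gt0// oppr_gt0.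
  + rewrite -ltrN2 -!tauN; apply: tau_lt_pos; first by rewrite oppr_gt0.
    by rewrite ltrN2.
  + by rewrite tau0 -oppr_gt0 -tauN tau_gt0// oppr_gt0.
- by rewrite -j0 tau0 tau_gt0// j0.
Qed.

Lemma tau_omega (n : nat) : tau n%:Z = omega beta n.
Proof.
rewrite /omega; case: n => [|n]; first by rewrite tau0 mul0r mul0r sqrtr0.
rewrite -[LHS]ger0_norm ?ltW ?tau_gt0// -sqrtr_sqr sqr_tau /m_symbol.
by rewrite mulrA -pmulrn.
Qed.

(** The frequencies tend to infinity, which makes the spectrum discrete. *)
Lemma sqr_tau_ge (k : int) : m 1 * `|k|%:R <= tau k ^+ 2.
Proof.
have m1 := m_symbol_gt0 (ltr01 : 0 < 1 :> int).
have pos (j : int) : 0 < j -> m 1 * `|j|%:R <= tau j ^+ 2.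
  move=> j0; rewrite sqr_tau mulrC natr_absz ger0_norm ?(ltW j0)//.
  apply: ler_wpM2l; first by rewrite ler0z ltW.
  have : 1 <= j by lia.
  by rewrite le_eqVlt => /orP[/eqP ->//|/m_symbol_lt/ltW].
have [/pos//|k0|<-] := ltrgtP 0 k; last by rewrite mulr0 sqr_ge0.
by have := pos (- k); rewrite oppr_gt0 abszN tauN sqrrN; apply.
Qed.

(** Only the finitely many k with |tau_k| < |Im z| + 1 can give a point i tau_k at
    distance less than 1 from z; the least positive distance among these works. *)
Lemma tau_gap (z : R[i]) : exists2 d : R, 0 < d &
  forall k, z = Complex 0 (tau k) \/ d <= normc (z - Complex 0 (tau k)).
Proof.
have m1 := m_symbol_gt0 (ltr01 : 0 < 1 :> int).
(* Beyond |k| = N one has |tau_k| >= b, and then |Im z - tau_k| >= 1. *)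
pose b := `|complex.Im z| + 1.
have b0 : 0 < b by rewrite ltr_wpDl.
have [N hN] : exists N : nat, b ^+ 2 / m 1 <= N%:R.
  exists (Num.Def.archi_bound (b ^+ 2 / m 1)); apply/ltW/archi_boundP.
  by rewrite divr_ge0 ?sqr_ge0// ltW.
have far (k : int) : (N < `|k|)%N -> 1 <= normc (z - Complex 0 (tau k)).
  move=> kN; apply: le_trans (Im_le_normc _); rewrite Im_caddE Im_coppE /=.
  have : b ^+ 2 <= `|tau k| ^+ 2.
    rewrite real_normK ?num_real//; apply: le_trans (sqr_tau_ge k).
    rewrite ler_pdivrMr// mulrC in hN; apply: le_trans hN _.
    by rewrite ler_wpM2l ?(ltW m1)// ler_nat ltnW.
  rewrite ler_sqr ?nnegrE ?(ltW b0)// /b => h.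
  have := ler_normD (complex.Im z - tau k) (- complex.Im z).
  by rewrite addrAC subrr sub0r !normrN; lra.
have near (s : seq int) : exists2 d : R, 0 < d & forall k, k \in s ->
    z = Complex 0 (tau k) \/ d <= normc (z - Complex 0 (tau k)).
  elim: s => [|j s [d d0 hd]]; first by exists 1.
  have [zj|zj] := eqVneq z (Complex 0 (tau j)).
    exists d => // k; rewrite inE => /orP[/eqP ->|/hd//]; by left.
  have j0 : 0 < normc (z - Complex 0 (tau j)).
    rewrite lt_neqAle normc_ge0 andbT eq_sym; apply/eqP => /ComplexField.Normc.eq0_normc/eqP.
    by rewrite subr_eq0 (negbTE zj).
  exists (Num.min d (normc (z - Complex 0 (tau j)))); first by rewrite lt_min d0.
  move=> k; rewrite inE => /orP[/eqP ->|/hd[|h]]; first by right; rewrite ge_min lexx orbT.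
    by left.
  by right; rewrite ge_min h.
have [d d0 hd] := near (irange N).
exists (Num.min d 1) => [|k]; first by rewrite lt_min d0 /=.
have [kN|/far h] := leqP `|k| N; last by right; rewrite ge_min h orbT.
by have [|->|h] := hd k; rewrite ?mem_irange//; [left|right; rewrite ge_min h].
Qed.

End symbols.

(** * Modes, energy and regularity *)

Section energy_modes.
Context {R : realType}.
Variables (beta : R) (beta_gt0 : 0 < beta).
Notation p := (p_symbol beta).
Notation m := (m_symbol beta).
Notation H := (energy_space beta).
Notation A := (conservative_op beta).
Notation V := (pdistr R * pdistr R)%type.
Implicit Types (x y z : V) (s : bool) (k : int) (l : R[i]).

Lemma sqr_normcD_le (a b : R[i]) :
  normc (a + b) ^+ 2 <= 2 * (normc a ^+ 2 + normc b ^+ 2).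
Proof.
rewrite !sqr_normcE Re_caddE Im_caddE.
have := sqr_ge0 (complex.Re a - complex.Re b); have := sqr_ge0 (complex.Im a - complex.Im b).
by rewrite !sqrrB !sqrrD; lra.
Qed.

Lemma sqr_normcM (a b : R[i]) : normc (a * b) ^+ 2 = normc a ^+ 2 * normc b ^+ 2.
Proof. by rewrite ComplexField.Normc.normcM exprMn. Qed.

Lemma sqr_normc_ge0 (a : R[i]) : 0 <= normc a ^+ 2.
Proof. by rewrite exprn_ge0 ?normc_ge0. Qed.

Lemma wl2_lin (w : int -> R) (a : R[i]) c1 c2 : (forall k, 0 <= w k) ->
  wl2 w c1 -> wl2 w c2 -> wl2 w (fun k => a * c1 k + c2 k).
Proof.
move=> w0; have K0 : 0 <= 2 * (normc a ^+ 2 + 1) by have := sqr_normc_ge0 a; lra.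
apply: wl2_sum K0 _ => k.
apply: le_trans (ler_wpM2l (w0 k) (sqr_normcD_le _ _)) _.
rewrite sqr_normcM; have := sqr_normc_ge0 a; have := sqr_normc_ge0 (c1 k).
have := sqr_normc_ge0 (c2 k); have := w0 k.
move: (normc a ^+ 2) (normc (c1 k) ^+ 2) (normc (c2 k) ^+ 2) (w k) => A' B C W.
move=> W0 C0 B0 A0.
have : 0 <= W * B by rewrite mulr_ge0.
have : 0 <= A' * (W * C) by rewrite !mulr_ge0.
nra.
Qed.

Lemma sobolev_halfP (v : pdistr R) :
  sobolev 2^-1 v <-> wl2 (fun k => (p k)^-1) (fcoef v).
Proof.
have [K K0 hK] := p_symbol_bracket beta_gt0.
rewrite sobolevP.
have -> : (fun k : int => bracket k `^ (2 * 2^-1)) = @bracket R.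
  by apply/funext => k; rewrite divff// powRr1// ltW// bracket_gt0.
split; apply: wl2_le (ltW K0) _ => k; rewrite [leRHS]mulrA; apply: ler_wpM2r (sqr_normc_ge0 _) _ _ _.
- have p0 := p_symbol_gt0 beta_gt0 k; have [_ h] := hK k.
  by rewrite -[leLHS]mul1r ler_pdivrMr// -mulrA [bracket k * _]mulrC.
- have p0 := p_symbol_gt0 beta_gt0 k; rewrite ler_pdivlMr//.
  by have [h _] := hK k; rewrite mulrC.
Qed.

Lemma sobolev_Nhalf (v : pdistr R) : sobolev (- 2^-1) v <-> wl2 p (fcoef v).
Proof.
have [K K0 hK] := p_symbol_bracket beta_gt0.
rewrite sobolevP.
have -> : (fun k : int => bracket k `^ (2 * - 2^-1) : R) = (fun k => (bracket k)^-1).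
  apply/funext => k; rewrite mulrN divff// powR_inv1// ltW// bracket_gt0//.
have b0 k := @bracket_gt0 R k; have p0 k := p_symbol_gt0 beta_gt0 k.
split; apply: wl2_le (ltW K0) _ => k; rewrite [leRHS]mulrA; apply: ler_wpM2r (sqr_normc_ge0 _) _ _ _.
- by have [h _] := hK k; rewrite ler_pdivlMr.
- by have [_ h] := hK k; rewrite -[leLHS]mul1r ler_pdivrMr// -mulrA.
Qed.

Lemma hspaceP x : hspace H x <-> l2 (fcoef x.1) /\ wl2 p (fcoef x.2).
Proof. by rewrite /= L2P sobolev_Nhalf. Qed.

Lemma domP x : dom A x <-> wl2 (fun k => (p k)^-1) (fcoef x.1) /\ l2 (fcoef x.2).
Proof. by rewrite /= L2P sobolev_halfP. Qed.

Lemma fcoef_pair_lin (a : R[i]) x y k :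
  fcoef (a *: x + y).1 k = a * fcoef x.1 k + fcoef y.1 k /\
  fcoef (a *: x + y).2 k = a * fcoef x.2 k + fcoef y.2 k.
Proof. by split; rewrite /= fcoef_is_linear. Qed.

Lemma hspace_lin (a : R[i]) x y : hspace H x -> hspace H y -> hspace H (a *: x + y).
Proof.
move=> /hspaceP[x1 x2] /hspaceP[y1 y2]; apply/hspaceP; split.
  have -> : fcoef (a *: x + y).1 = fun k => a * fcoef x.1 k + fcoef y.1 k.
    by apply/funext => k; have [] := fcoef_pair_lin a x y k.
  exact: wl2_lin.
have -> : fcoef (a *: x + y).2 = fun k => a * fcoef x.2 k + fcoef y.2 k.
  by apply/funext => k; have [] := fcoef_pair_lin a x y k.
by apply: wl2_lin => // k; rewrite ltW// p_symbol_gt0.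
Qed.

Lemma dom_lin (a : R[i]) x y : dom A x -> dom A y -> dom A (a *: x + y).
Proof.
move=> /domP[x1 x2] /domP[y1 y2]; apply/domP; split.
  have -> : fcoef (a *: x + y).1 = fun k => a * fcoef x.1 k + fcoef y.1 k.
    by apply/funext => k; have [] := fcoef_pair_lin a x y k.
  by apply: wl2_lin => // k; rewrite invr_ge0 ltW// p_symbol_gt0.
have -> : fcoef (a *: x + y).2 = fun k => a * fcoef x.2 k + fcoef y.2 k.
  by apply/funext => k; have [] := fcoef_pair_lin a x y k.
exact: wl2_lin.
Qed.

Lemma p_symbol_le : exists2 K : R, 0 < K & forall k, p k <= K.
Proof.
have [K K0 hK] := p_symbol_bracket beta_gt0; exists K => // k.
have [h _] := hK k; apply: le_trans h.
by rewrite -[leLHS]mulr1 ler_wpM2l ?bracket_ge1// ltW// p_symbol_gt0.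
Qed.

Lemma dom_hspace x : dom A x -> hspace H x.
Proof.
have [K K0 hK] := p_symbol_le.
move=> /domP[x1 x2]; apply/hspaceP; split.
  apply: wl2_le (ltW K0) _ x1 => k; rewrite [leRHS]mulrA; apply: ler_wpM2r (sqr_normc_ge0 _) _ _ _.
  by rewrite ler_pdivlMr ?p_symbol_gt0// mul1r.
apply: wl2_le (ltW K0) _ x2 => k; rewrite [leRHS]mulrA; apply: ler_wpM2r (sqr_normc_ge0 _) _ _ _.
by rewrite mulr1.
Qed.

Lemma normc_imag (r : R) : normc (Complex 0 r) ^+ 2 = r ^+ 2.
Proof. by rewrite sqr_normcE /= expr0n add0r. Qed.

Lemma l2_m_symbol (c : int -> R[i]) : l2 c -> l2 (fun k => Complex 0 (- m k) * c k).
Proof.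
apply: (wl2_le (K := beta^-1 ^+ 2)) => [|k]; first exact: sqr_ge0.
rewrite !mul1r sqr_normcM normc_imag sqrrN ler_wpM2r ?sqr_normc_ge0//.
exact: sqr_m_symbol_le.
Qed.

Lemma fcoef_A x k : dom A x ->
  fcoef (app A x).1 k = Complex 0 (- m k) * fcoef x.2 k /\
  fcoef (app A x).2 k = - (Complex 0 k%:~R * fcoef x.1 k).
Proof.
move=> /domP[_ x2]; split; last by rewrite fcoefN fcoef_ddx.
by rewrite multiplierP//; exact: l2_m_symbol.
Qed.

Lemma hspace_A x : dom A x -> hspace H (app A x).
Proof.
move=> xD; have [x1 x2] := (domP x).1 xD; apply/hspaceP; split.
  have -> : fcoef (app A x).1 = fun k => Complex 0 (- m k) * fcoef x.2 k.
    by apply/funext => k; have [] := fcoef_A k xD.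
  exact: l2_m_symbol.
apply: (wl2_le (K := beta^-1 ^+ 2)) x1 => [|k]; first exact: sqr_ge0.
have [_ ->] := fcoef_A k xD.
rewrite normcN sqr_normcM normc_imag [leLHS]mulrA [leRHS]mulrA; apply: ler_wpM2r (sqr_normc_ge0 _) _ _ _.
have p0 := p_symbol_gt0 beta_gt0 k; rewrite ler_pdivlMr//.
have := sqr_m_symbol_le beta k; rewrite m_symbolE//; apply: le_trans.
by rewrite le_eqVlt; apply/orP; left; apply/eqP; ring.
Qed.

(** The eigen-coordinates of the block at frequency k. *)
Definition mode s x k : R[i] :=
  fcoef x.1 k + (if s then Num.sqrt (p k) else - Num.sqrt (p k))%:C * fcoef x.2 k.

Definition eigval s k : R[i] := Complex 0 (tau beta (if s then - k else k)).

Definition energy x k : R := normc (fcoef x.1 k) ^+ 2 + p k * normc (fcoef x.2 k) ^+ 2.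

Lemma sqrt_p_gt0 k : 0 < Num.sqrt (p k).
Proof. by rewrite sqrtr_gt0 p_symbol_gt0. Qed.

Lemma sqr_sqrt_p k : Num.sqrt (p k) ^+ 2 = p k.
Proof. by rewrite sqr_sqrtr// ltW// p_symbol_gt0. Qed.

Lemma mode_lin s (a : R[i]) x y k : mode s (a *: x + y) k = a * mode s x k + mode s y k.
Proof. by rewrite /mode; have [-> ->] := fcoef_pair_lin a x y k; ring. Qed.

Lemma modeB s x y k : mode s (x - y) k = mode s x k - mode s y k.
Proof. by rewrite addrC -scaleN1r mode_lin mulN1r addrC. Qed.

Lemma mode_sum x k : mode true x k + mode false x k = 2 * fcoef x.1 k.
Proof. by rewrite /mode rmorphN; ring. Qed.

Lemma mode_diff x k : mode true x k - mode false x k = 2 * (Num.sqrt (p k))%:C * fcoef x.2 k.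
Proof. by rewrite /mode rmorphN; ring. Qed.

(** Parallelogram identity: the modes diagonalize the block and the energy at once. *)
Lemma energyE x k :
  energy x k = (normc (mode true x k) ^+ 2 + normc (mode false x k) ^+ 2) / 2.
Proof.
rewrite /energy /mode; move: (sqr_sqrt_p k); move: (Num.sqrt (p k)) => q <-.
case: (fcoef x.1 k) (fcoef x.2 k) => a b [c d].
by rewrite !sqr_normcE !(Re_caddE, Im_caddE, Re_cmul, Im_cmul) /=; field.
Qed.

Lemma energy_ge0 x k : 0 <= energy x k.
Proof. by rewrite energyE divr_ge0// addr_ge0 ?sqr_normc_ge0. Qed.

Lemma mode_inj x y : (forall s k, mode s x k = mode s y k) -> x = y.
Proof.
move=> xy; have C2 : 2 != 0 :> R[i] by rewrite pnatr_eq0.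
case: x y xy => x1 x2 [y1 y2] xy; congr (_, _); apply: fcoef_inj => k.
  by apply: (mulfI C2); rewrite -(mode_sum (x1, x2)) -(mode_sum (y1, y2)) !xy.
have q0 : 2 * (Num.sqrt (p k))%:C != 0 :> R[i].
  rewrite mulf_eq0 (negbTE C2) /= eq_complex /= eqxx andbT.
  by rewrite gt_eqF// sqrt_p_gt0.
by apply: (mulfI q0); rewrite -(mode_diff (x1, x2)) -(mode_diff (y1, y2)) !xy.
Qed.

Lemma mode_A s x k : dom A x -> mode s (app A x) k = eigval s k * mode s x k.
Proof.
move=> xD; rewrite /mode /eigval; have [-> ->] := fcoef_A k xD.
rewrite m_symbolE//; case: s; rewrite ?tauN /tau;
  move: (sqr_sqrt_p k); move: (Num.sqrt (p k)) => q <-; case: (fcoef x.1 k) (fcoef x.2 k) => a b [c d];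
  by apply: eq_cplx; rewrite !(Re_caddE, Im_caddE, Re_coppE, Im_coppE, Re_cmul, Im_cmul) /=; ring.
Qed.

(** The zero frequency is covered by p_0 = 1, the others by m_k^2 >= m_1^2. *)
Lemma symbols_coercive : exists2 K : R, 0 <= K & forall k, 1 <= K * (p k + m k ^+ 2).
Proof.
have m1 := m_symbol_gt0 beta_gt0 (ltr01 : 0 < 1 :> int).
have v0 : 0 <= m 1 ^- 2 by rewrite invr_ge0 sqr_ge0.
exists (1 + m 1 ^- 2) => [|k]; first by rewrite addr_ge0.
have [->|/(sqr_m_symbol_ge beta_gt0) h] := eqVneq k 0.
  rewrite /p_symbol eqxx -[leLHS]mulr1.
  by apply: ler_pM => //; rewrite lerDl// sqr_ge0.
have h1 : 1 <= m 1 ^- 2 * m k ^+ 2 by rewrite mulrC ler_pdivlMr ?mul1r// exprn_gt0.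
have p0 := p_symbol_gt0 beta_gt0 k; have := sqr_ge0 (m k).
have : 0 <= m 1 ^- 2 * p k by rewrite mulr_ge0// ltW.
by rewrite mulrDl !mulrDr; lra.
Qed.

(** The two components of y control m b in l^2 and k a in H^(-1/2).  By
    symbols_coercive this gains half a derivative on a and on b over what
    membership in the energy space says. *)
Lemma dom_regularity x y : hspace H x -> hspace H y ->
  (forall s k, mode s y k = eigval s k * mode s x k) -> dom A x /\ app A x = y.
Proof.
move=> /hspaceP[x1 x2] /hspaceP[y1 y2] xy.
have C2 : 2 != 0 :> R[i] by rewrite pnatr_eq0.
have ey k : fcoef y.1 k = Complex 0 (- m k) * fcoef x.2 k /\
    fcoef y.2 k = - (Complex 0 k%:~R * fcoef x.1 k).
  split.
    apply: (mulfI C2); rewrite -mode_sum !xy /mode /eigval tauN /tau.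
    rewrite m_symbolE//; move: (sqr_sqrt_p k); move: (Num.sqrt (p k)) => q <-.
    case: (fcoef x.1 k) (fcoef x.2 k) => a b [c d];
    by apply: eq_cplx; rewrite !(Re_caddE, Im_caddE, Re_coppE, Im_coppE, Re_cmul, Im_cmul) /=; ring.
  have q0 : 2 * (Num.sqrt (p k))%:C != 0 :> R[i].
    rewrite mulf_eq0 (negbTE C2) /= eq_complex /= eqxx andbT.
    by rewrite gt_eqF// sqrt_p_gt0.
  apply: (mulfI q0); rewrite -mode_diff !xy /mode /eigval tauN /tau.
  case: (fcoef x.1 k) (fcoef x.2 k) => a b [c d];
  by apply: eq_cplx; rewrite !(Re_caddE, Im_caddE, Re_coppE, Im_coppE, Re_cmul, Im_cmul) /=; ring.
have [K K0 hK] := symbols_coercive.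
have xD : dom A x.
  apply/domP; split.
    apply: (wl2_sum K0 _ x1 y2) => k; have [_ ->] := ey k.
    rewrite normcN sqr_normcM normc_imag mul1r.
    rewrite [X in _ <= _ * X](_ : _ = (1 + p k * k%:~R ^+ 2) * normc (fcoef x.1 k) ^+ 2); last by ring.
    rewrite [leRHS]mulrA; apply: ler_wpM2r (sqr_normc_ge0 _) _ _ _.
    have p0 := p_symbol_gt0 beta_gt0 k; rewrite -[leLHS]mul1r ler_pdivrMr//.
    by apply: le_trans (hK k) _; rewrite m_symbolE// le_eqVlt; apply/orP; left; apply/eqP; ring.
  apply: (wl2_sum K0 _ x2 y1) => k; have [-> _] := ey k.
  rewrite sqr_normcM normc_imag sqrrN !mul1r.
  rewrite [X in _ <= _ * X](_ : _ = (p k + m k ^+ 2) * normc (fcoef x.2 k) ^+ 2); last by ring.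
  by rewrite [leRHS]mulrA -[leLHS]mul1r; apply: ler_wpM2r (sqr_normc_ge0 _) _ _ _.
split=> //; apply: mode_inj => s k.
by rewrite mode_A// xy.
Qed.

Lemma cvg_real_complex (u : nat -> R) (l : R) : u n @[n --> \oo] --> l ->
  ((u n)%:C : R[i]^o) @[n --> \oo] --> (l%:C : R[i]^o).
Proof.
move=> ul; apply/cvgrPdist_lt => e; rewrite ltcE /= => /andP[/eqP e1 e0].
have /cvgrPdist_lt/(_ _ e0)[N _ hN] := ul; exists N => // n nN.
have := hN n nN; rewrite /= -rmorphB normc_def /= expr0n addr0 sqrtr_sqr => h.
by rewrite ltcE /= e1 eqxx.
Qed.

Lemma limn_complex (u : nat -> R[i]) (l : R[i]) :
  (u n : R[i]^o) @[n --> \oo] --> (l : R[i]^o) -> limn (u : nat -> R[i]^o) = l.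
Proof. by move/cvg_lim; apply; exact: norm_hausdorff. Qed.

Lemma zsum_real (r : int -> R) (M : R) : (forall k, 0 <= r k) ->
  (forall N, \sum_(k <- irange N) r k <= M) ->
  cvgn (fun N => \sum_(k <- irange N) r k) /\
  zsum (fun k => (r k)%:C) = (limn (fun N => \sum_(k <- irange N) r k))%:C.
Proof.
move=> r0 rM; have cv : cvgn (fun N => \sum_(k <- irange N) r k).
  apply: nondecreasing_is_cvgn; last by exists M => _ [N _ <-].
  by move=> N N' NN'; exact: irange_le.
split=> //; apply: limn_complex.
rewrite [X in X @ _](_ : _ = fun N => (\sum_(k <- irange N) r k)%:C : R[i]^o).
  exact: cvg_real_complex.
by apply/funext => N; rewrite (irangeE (fun k => (r k)%:C)) rmorph_sum.
Qed.

(** For elements of the energy space the series defining the inner product have nonnegative bounded partial sums. *)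
Lemma hnormE x : hspace H x ->
  cvgn (fun N => \sum_(k <- irange N) energy x k) /\
  hnorm H x = Num.sqrt (2 * pi * limn (fun N => \sum_(k <- irange N) energy x k)).
Proof.
move=> /hspaceP[[M1 h1] [M2 h2]].
have h1' N : \sum_(k <- irange N) normc (fcoef x.1 k) ^+ 2 <= M1.
  by apply: le_trans (h1 N); apply: ler_sum => k _; rewrite mul1r.
have [c1 e1] := zsum_real (fun k => sqr_normc_ge0 (fcoef x.1 k)) h1'.
have p0 k : 0 <= p k * normc (fcoef x.2 k) ^+ 2.
  by rewrite mulr_ge0 ?sqr_normc_ge0// ltW// p_symbol_gt0.
have [c2 e2] := zsum_real p0 h2.
have sE : (fun N => \sum_(k <- irange N) energy x k) =
  (fun N => \sum_(k <- irange N) normc (fcoef x.1 k) ^+ 2 +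
            \sum_(k <- irange N) p k * normc (fcoef x.2 k) ^+ 2).
  by apply/funext => N; rewrite -big_split.
split; first by rewrite sE; exact: is_cvgD.
rewrite sE limD// /hnorm /=; congr Num.sqrt.
have -> : (fun k => fcoef x.1 k * conjc (fcoef x.1 k)) =
    (fun k => (normc (fcoef x.1 k) ^+ 2)%:C).
  by apply/funext => k; rewrite mulc_conjc.
have -> : (fun k => (p k)%:C * fcoef x.2 k * conjc (fcoef x.2 k)) =
    (fun k => (p k * normc (fcoef x.2 k) ^+ 2)%:C).
  by apply/funext => k; rewrite -mulrA mulc_conjc -rmorphM.
by rewrite e1 e2 -mulrDr -rmorphD -rmorphM.
Qed.

Lemma hnorm_ge0 x : 0 <= hnorm H x.
Proof. exact: sqrtr_ge0. Qed.

Lemma energy_sum_le_hnorm x N : hspace H x ->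
  2 * pi * \sum_(k <- irange N) energy x k <= hnorm H x ^+ 2.
Proof.
move=> xH; have [c e] := hnormE xH; have tp := @twopi_gt0 R.
have h : \sum_(k <- irange N) energy x k <= limn (fun N => \sum_(k <- irange N) energy x k).
  apply: (nondecreasing_cvgn_le _ c N) => n n' nn'.
  by apply: irange_le => // k; exact: energy_ge0.
rewrite e sqr_sqrtr ?ler_wpM2l ?(ltW tp)// mulr_ge0 ?(ltW tp)//.
by apply: le_trans h; apply: sumr_ge0 => k _; exact: energy_ge0.
Qed.

Lemma hnorm_le x (B : R) : hspace H x -> 0 <= B ->
  (forall N, 2 * pi * \sum_(k <- irange N) energy x k <= B ^+ 2) -> hnorm H x <= B.
Proof.
move=> xH B0 h; have [c ->] := hnormE xH; have tp := @twopi_gt0 R.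
rewrite -[leRHS]ger0_norm// -sqrtr_sqr ler_wsqrtr// -ler_pdivlMl//.
by apply: limr_le => //; apply: nearW => N; rewrite ler_pdivlMl.
Qed.

(** Convergence in the energy space implies convergence of every mode. *)
Lemma normc_mode_le s x k : hspace H x -> normc (mode s x k) <= hnorm H x.
Proof.
move=> xH; rewrite -ler_sqr ?nnegrE ?normc_ge0 ?hnorm_ge0//.
apply: le_trans (energy_sum_le_hnorm `|k| xH).
have : energy x k <= \sum_(j <- irange `|k|) energy x j.
  rewrite (bigD1_seq k) ?mem_irange ?irange_uniq//= lerDl.
  by apply: sumr_ge0 => j _; exact: energy_ge0.
have pi2 := @pi_ge2 R; rewrite energyE => h.
have h1 := sqr_normc_ge0 (mode true x k); have h2 := sqr_normc_ge0 (mode false x k).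
have : normc (mode s x k) ^+ 2 <=
  2 * ((normc (mode true x k) ^+ 2 + normc (mode false x k) ^+ 2) / 2).
  by case: s; lra.
move: h1 h2 h; set X := \sum_(j <- _) _; set Y := _ / 2; move=> h1 h2 h h3.
have Y0 : 0 <= Y by rewrite /Y; lra.
nra.
Qed.

End energy_modes.

(** * Spectrum, eigenspaces and normality *)

Section conservative_spectrum.
Context {R : realType}.
Variables (beta : R) (beta_gt0 : 0 < beta).
Notation p := (p_symbol beta).
Notation m := (m_symbol beta).
Notation H := (energy_space beta).
Notation A := (conservative_op beta).
Notation V := (pdistr R * pdistr R)%type.
Notation mode := (mode beta).
Notation eigval := (eigval beta).
Notation energy := (energy beta).
Notation itau := (fun k : int => Complex 0 (tau beta k) : R[i]).
Implicit Types (x y z : V) (s : bool) (k : int) (l : R[i]).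

Lemma hspaceB x y : hspace H x -> hspace H y -> hspace H (x - y).
Proof. by move=> xH yH; rewrite addrC -scaleN1r; exact: hspace_lin. Qed.

Lemma domB x y : dom A x -> dom A y -> dom A (x - y).
Proof. by move=> xD yD; rewrite addrC -scaleN1r; exact: dom_lin. Qed.

Lemma mode0 s k : mode s 0 k = 0.
Proof. by rewrite /mode /= !fcoef0 mulr0 addr0. Qed.

Lemma modeN s x k : mode s (- x) k = - mode s x k.
Proof. by rewrite -sub0r modeB// mode0 sub0r. Qed.

Lemma wl2_finite (w : int -> R) (c : int -> R[i]) N : (forall k, 0 <= w k) ->
  (forall k, (N < `|k|)%N -> c k = 0) -> wl2 w c.
Proof.
move=> w0 c0; pose a k := w k * normc (c k) ^+ 2.
have a0 k : 0 <= a k by rewrite mulr_ge0 ?sqr_normc_ge0.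
exists (\sum_(k <- irange N) a k) => N'.
apply: (@le_trans _ _ (\sum_(k <- irange (N + N')) a k)).
  by apply: irange_le => //; exact: leq_addl.
rewrite -subr_le0 -irangeB ?leq_addr// big1// => k _; case: leqP => // /c0 ck.
by rewrite /a ck ComplexField.Normc.normc0 expr0n mulr0.
Qed.

Lemma dom_finite N x : (forall k, (N < `|k|)%N -> fcoef x.1 k = 0) ->
  (forall k, (N < `|k|)%N -> fcoef x.2 k = 0) -> dom A x.
Proof.
move=> h1 h2; apply/(domP beta_gt0); split; apply: wl2_finite => //.
- by move=> k; rewrite invr_ge0 ltW// p_symbol_gt0.
- exact: h1.
- exact: h2.
Qed.

Lemma shiftE l x : app (shift_op l A) x = l *: x - app A x.
Proof. by []. Qed.

Lemma mode_shift l s x k : dom A x ->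
  mode s (app (shift_op l A) x) k = (l - eigval s k) * mode s x k.
Proof.
by move=> xD; rewrite shiftE modeB// -[l *: x]addr0 mode_lin
  mode0 addr0 mode_A// mulrBl.
Qed.

Lemma hspace_shift l x : dom A x -> hspace H (app (shift_op l A) x).
Proof.
move=> xD; rewrite shiftE; apply: hspaceB; last exact: hspace_A.
rewrite -[l *: x]addr0; apply: hspace_lin => //; first exact: dom_hspace.
by rewrite -(subrr x); apply: hspaceB; exact: dom_hspace.
Qed.

Lemma ker_shiftP l x : ker_op (shift_op l A) x <->
  dom A x /\ forall s k, (l - eigval s k) * mode s x k = 0.
Proof.
split=> [[xD e]|[xD e]]; split=> //.
  by move=> s k; rewrite -mode_shift// e mode0.
by apply: (mode_inj beta_gt0) => s k; rewrite mode_shift// e mode0.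
Qed.

(** On each mode the operator acts by a scalar, whose powers vanish only with it. *)
Lemma root_space_ker l : root_space A l = ker_op (shift_op l A).
Proof.
apply/seteqP; split=> [x [j _]|x [xD e]]; last by exists 1%N => //; split.
elim: j x => [|j IH] x /=.
  move=> ->; apply/ker_shiftP; split; last by move=> s k; rewrite mode0 mulr0.
  by apply: (dom_finite (N := 0)) => k _; rewrite fcoef0.
move=> [xD /IH/ker_shiftP[_ e]]; apply/ker_shiftP; split=> // s k.
have /eqP := e s k; rewrite -shiftE mode_shift// mulrA mulf_eq0.
by case/orP => [|/eqP ->]; rewrite ?mulr0// mulf_eq0 orbb => /eqP ->; rewrite mul0r.
Qed.

(** The ratio of the two components is -1 / sqrt(p_n) at frequency n and
    1 / sqrt(p_n) at - n, which makes one of the two modes vanish there. *)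
Definition eigvec (n : int) (c c' : R[i]) : V :=
  let r : R[i] := (Num.sqrt (p n))^-1%:C in
  (embed (c *: expi n + c' *: expi (- n)),
   embed (- r *: (c *: expi n - c' *: expi (- n)))).

Lemma fcoef_eigvec n c c' k :
  fcoef (eigvec n c c').1 k = c * (k == n)%:R + c' * (k == - n)%:R /\
  fcoef (eigvec n c c').2 k =
    - (Num.sqrt (p n))^-1%:C * (c * (k == n)%:R - c' * (k == - n)%:R).
Proof.
have E j c0 : fcoef (embed (c0 *: expi j : testfun R)) k = c0 * (k == j)%:R.
  by rewrite fcoef_embedZ fcoef_embed_expi; case: eqP.
have EN (phi : testfun R) : fcoef (embed (- phi)) k = - fcoef (embed phi) k.
  by rewrite -scaleN1r fcoef_embedZ mulN1r.
split.
  change (fcoef (embed (c *: expi n + c' *: expi (- n) : testfun R)) k =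
    c * (k == n)%:R + c' * (k == - n)%:R).
  by rewrite fcoef_embedD !E.
change (fcoef (embed (- (Num.sqrt (p n))^-1%:C *: (c *: expi n - c' *: expi (- n)) : testfun R)) k =
  - (Num.sqrt (p n))^-1%:C * (c * (k == n)%:R - c' * (k == - n)%:R)).
by rewrite fcoef_embedZ fcoef_embedD EN !E.
Qed.

Lemma dom_eigvec n c c' : dom A (eigvec n c c').
Proof.
have off k : (`|n| < `|k|)%N -> (k == n = false) * (k == - n = false).
  by move=> nk; split; apply/eqP => kn; rewrite kn ?abszN ltnn in nk.
apply: (dom_finite (N := `|n|%N)) => k /off[kn kn'].
  by have [-> _] := fcoef_eigvec n c c' k; rewrite kn kn' !mulr0 addr0.
by have [_ ->] := fcoef_eigvec n c c' k; rewrite kn kn' !mulr0 subr0 mulr0.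
Qed.

Lemma mode_eigvec n c c' s k : mode s (eigvec n c c') k =
  if s then 2 * c' * (k == - n)%:R else 2 * c * (k == n)%:R.
Proof.
rewrite /mode; have [-> ->] := fcoef_eigvec n c c' k.
have q0 := sqrt_p_gt0 beta_gt0 n; set r := (Num.sqrt (p n))^-1%:C.
have qK : (Num.sqrt (p n))%:C * r = 1 by rewrite -rmorphM /= divff ?gt_eqF.
have h1 : (Num.sqrt (p k))%:C * r * (k == n)%:R = (k == n)%:R.
  by have [->|_] := eqVneq k n; rewrite ?qK ?mul1r ?mulr0.
have h2 : (Num.sqrt (p k))%:C * r * (k == - n)%:R = (k == - n)%:R.
  by have [->|_] := eqVneq k (- n); rewrite ?p_symbolN ?qK ?mul1r ?mulr0.
case: s; rewrite ?rmorphN.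
  transitivity (c * (k == n)%:R - c * ((Num.sqrt (p k))%:C * r * (k == n)%:R) +
    c' * (k == - n)%:R + c' * ((Num.sqrt (p k))%:C * r * (k == - n)%:R)); first by ring.
  by rewrite h1 h2; ring.
transitivity (c * (k == n)%:R + c * ((Num.sqrt (p k))%:C * r * (k == n)%:R) +
  c' * (k == - n)%:R - c' * ((Num.sqrt (p k))%:C * r * (k == - n)%:R)); first by ring.
by rewrite h1 h2; ring.
Qed.

Lemma itau_inj j k : itau j = itau k -> j = k.
Proof. by move=> [] /(tau_inj beta_gt0). Qed.

(** By injectivity of tau, the eigenvalue i tau_n is attained only by the minus
    mode at frequency n and by the plus mode at frequency - n. *)
Lemma ker_itau n : ker_op (shift_op (itau n) A) =
  [set x | exists c c', x = eigvec n c c'].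
Proof.
have C2 : 2 != 0 :> R[i] by rewrite pnatr_eq0.
apply/seteqP; split=> [x /ker_shiftP[xD e]|_ [c [c' ->]]].
  exists (mode false x n / 2), (mode true x (- n) / 2).
  apply: (mode_inj beta_gt0) => s k; rewrite mode_eigvec ![2 * _]mulrC !divfK//.
  have /eqP := e s k; rewrite /eigval mulf_eq0 subr_eq0 => h.
  case: s h => /orP[/eqP/itau_inj h|/eqP h].
  - by rewrite h opprK eqxx mulr1.
  - by have [<-|] := eqVneq k (- n); rewrite ?mulr1 ?mulr0.
  - by rewrite h eqxx mulr1.
  - by have [<-|] := eqVneq k n; rewrite ?mulr1 ?mulr0.
apply/ker_shiftP; split; first exact: dom_eigvec.
move=> s k; rewrite mode_eigvec /eigval; case: s.
  have [->|] := eqVneq k (- n); last by rewrite !mulr0.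
  by rewrite opprK subrr mul0r.
by have [->|] := eqVneq k n; [rewrite subrr mul0r|rewrite !mulr0].
Qed.

Lemma geometric_multiplicity_itau n : geometric_multiplicity A (itau n) 2.
Proof.
have C2 : 2 != 0 :> R[i] by rewrite pnatr_eq0.
exists (fun i : 'I_2 => if i == ord0 then eigvec n 1 0 else eigvec n 0 1).
have sumE (c : 'I_2 -> R[i]) :
    \sum_i c i *: (if i == ord0 then eigvec n 1 0 else eigvec n 0 1) =
    eigvec n (c ord0) (c (lift ord0 ord0)).
  rewrite big_ord_recl big_ord1 /=.
  apply: (mode_inj beta_gt0) => s k.
  rewrite mode_lin -[c _ *: eigvec n 0 1]addr0 mode_lin mode0 !mode_eigvec.
  by case: s; ring.
split=> [c|]; last first.
  rewrite [LHS]ker_itau; apply/seteqP; split=> x /= [].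
    move=> c [c' ->]; exists (fun i => if i == ord0 then c else c').
    by rewrite sumE.
  by move=> c ->; exists (c ord0), (c (lift ord0 ord0)); rewrite sumE.
rewrite sumE => e.
have e0 : c ord0 = 0.
  have := congr1 (fun x => mode false x n) e; rewrite mode_eigvec mode0 eqxx mulr1.
  by move=> /eqP; rewrite mulf_eq0 (negbTE C2) => /eqP.
have e1 : c (lift ord0 ord0) = 0.
  have := congr1 (fun x => mode true x (- n)) e; rewrite mode_eigvec mode0 eqxx mulr1.
  by move=> /eqP; rewrite mulf_eq0 (negbTE C2) => /eqP.
move=> i; have [->//|] := eqVneq i ord0.
by case: i => -[|[|//]] //= i0 _; rewrite -e1; congr c; exact: val_inj.
Qed.

Lemma eigenvalue_itau n : is_eigenvalue A (itau n).
Proof.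
exists (eigvec n 1 0); split; last 2 first.
- exact: dom_eigvec.
- have : ker_op (shift_op (itau n) A) (eigvec n 1 0) by rewrite ker_itau; exists 1, 0.
  by move=> [_ /eqP]; rewrite shiftE subr_eq0 => /eqP.
apply/eqP => /(congr1 (fun x => mode false x n)); rewrite mode_eigvec mode0 eqxx !mulr1.
by move/eqP; rewrite pnatr_eq0.
Qed.

Lemma energy_shift_ge l (d : R) x k : dom A x -> 0 < d ->
  (forall k, d <= normc (l - itau k)) ->
  d ^+ 2 * energy x k <= energy (app (shift_op l A) x) k.
Proof.
move=> xD d0 hd; rewrite !(energyE beta_gt0) !mode_shift// !sqr_normcM mulrA.
rewrite ler_pM2r ?invr_gt0// mulrDr.
have h s : d ^+ 2 <= normc (l - eigval s k) ^+ 2.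
  by rewrite ler_sqr ?nnegrE ?normc_ge0 ?(ltW d0)//; exact: hd.
by apply: lerD; apply: ler_wpM2r; rewrite ?sqr_normc_ge0// h.
Qed.

Lemma resolvent_bound l (d : R) x : dom A x -> 0 < d ->
  (forall k, d <= normc (l - itau k)) ->
  hnorm H x <= d^-1 * hnorm H (app (shift_op l A) x).
Proof.
move=> xD d0 hd; have dv : 0 <= d^-1 by rewrite invr_ge0 ltW.
apply: (hnorm_le beta_gt0); first exact: dom_hspace.
  by rewrite mulr_ge0// hnorm_ge0.
move=> N; rewrite exprMn exprVn ler_pdivlMl ?exprn_gt0//.
apply: le_trans (energy_sum_le_hnorm beta_gt0 N (hspace_shift l xD)).
rewrite mulrCA; apply: ler_wpM2l; first exact: ltW twopi_gt0.
rewrite mulr_sumr; apply: ler_sum => k _; exact: energy_shift_ge.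
Qed.

Lemma half_sum_diff (u v q : R[i]) : q != 0 ->
  (u + v) / 2 + q * ((u - v) / (2 * q)) = u /\
  (u + v) / 2 + - q * ((u - v) / (2 * q)) = v.
Proof. by move=> q0; split; field. Qed.

(** Dividing the modes of y by l - eigval keeps them square summable; Riesz-Fischer turns them
    into distributions once b is known to be in l^2, and dom_regularity puts
    the result in the domain. *)
Lemma shift_surjective l (d : R) y : hspace H y -> 0 < d ->
  (forall k, d <= normc (l - itau k)) ->
  exists2 x, dom A x & app (shift_op l A) x = y.
Proof.
move=> yH d0 hd; have /(hspaceP beta_gt0)[y1 y2] := yH.
have C2 : 2 != 0 :> R[i] by rewrite pnatr_eq0.
have q0 k : (Num.sqrt (p k))%:C != 0 :> R[i].
  by rewrite eq_complex /= eqxx andbT gt_eqF// sqrt_p_gt0.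
have l0 s k : l - eigval s k != 0.
  apply/eqP => e; have := hd (if s then - k else k); rewrite [l - _]e.
  by rewrite ComplexField.Normc.normc0 leNgt d0.
pose xs s k := mode s y k / (l - eigval s k).
pose a k := (xs true k + xs false k) / 2.
pose b k := (xs true k - xs false k) / (2 * (Num.sqrt (p k))%:C).
have ab s k : a k + (if s then Num.sqrt (p k) else - Num.sqrt (p k))%:C * b k = xs s k.
  have [e1 e2] := half_sum_diff (xs true k) (xs false k) (q0 k).
  by rewrite /a /b; case: s; rewrite ?rmorphN.
have en k : normc (a k) ^+ 2 + p k * normc (b k) ^+ 2 <=
    d ^- 2 * (1 * normc (fcoef y.1 k) ^+ 2 + p k * normc (fcoef y.2 k) ^+ 2).
  have -> : normc (a k) ^+ 2 + p k * normc (b k) ^+ 2 =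
      (normc (xs true k) ^+ 2 + normc (xs false k) ^+ 2) / 2.
    rewrite -!ab rmorphN mulNr; move: (sqr_sqrt_p beta_gt0 k); move: (Num.sqrt (p k)) => q <-.
    case: (a k) (b k) => a1 a2 [b1 b2].
    by rewrite !sqr_normcE !(Re_caddE, Im_caddE, Re_coppE, Im_coppE, Re_cmul, Im_cmul) /=; field.
  rewrite mul1r (energyE beta_gt0 y k : _ + _ = _) mulrA.
  rewrite ler_pM2r ?invr_gt0// mulrDr.
  have h s : normc (xs s k) ^+ 2 <= d ^- 2 * normc (mode s y k) ^+ 2.
    rewrite /xs sqr_normcM mulrC ComplexField.Normc.normcV exprVn.
    apply: ler_wpM2r; first exact: sqr_normc_ge0.
    have nl : d <= normc (l - eigval s k) by exact: hd.
    have n0 : 0 < normc (l - eigval s k) by exact: lt_le_trans nl.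
    rewrite lef_pV2 ?posrE ?exprn_gt0//.
    by rewrite ler_sqr ?nnegrE ?(ltW d0) ?(ltW n0).
  exact: lerD.
have dv : 0 <= d ^- 2 by rewrite invr_ge0 sqr_ge0.
have a2 : l2 a.
  apply: (wl2_sum dv _ y1 y2) => k; rewrite mul1r; apply: le_trans (en k).
  by rewrite lerDl mulr_ge0 ?sqr_normc_ge0// ltW// p_symbol_gt0.
have pb2 : wl2 p b.
  apply: (wl2_sum dv _ y1 y2) => k; apply: le_trans (en k).
  by rewrite lerDr sqr_normc_ge0.
(* The first component of the resolvent equation improves b from H^(-1/2) to L^2. *)
have mb k : Complex 0 (- m k) * b k = l * a k - fcoef y.1 k.
  apply: (mulfI C2); rewrite mulrBr -(mode_sum beta).
  have ey s : mode s y k = (l - eigval s k) * xs s k by rewrite mulrC divfK.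
  rewrite !ey -!ab /eigval tauN// /tau m_symbolE//.
  move: (sqr_sqrt_p beta_gt0 k); move: (Num.sqrt (p k)) => q <-.
  case: (l) (a k) (b k) => l1 l2 [a1 a3] [b1 b3].
  by apply: eq_cplx; rewrite !(Re_caddE, Im_caddE, Re_coppE, Im_coppE, Re_cmul, Im_cmul) /=; ring.
have mb2 : l2 (fun k => Complex 0 (- m k) * b k).
  have K0 : 0 <= 2 * (normc l ^+ 2 + 1) by have := sqr_normc_ge0 l; lra.
  apply: (wl2_sum K0 _ a2 y1) => k; rewrite !mul1r mb.
  apply: le_trans (sqr_normcD_le _ _) _; rewrite normcN sqr_normcM.
  have := sqr_normc_ge0 l; have := sqr_normc_ge0 (a k); have := sqr_normc_ge0 (fcoef y.1 k).
  move: (normc l ^+ 2) (normc (a k) ^+ 2) (normc (fcoef y.1 k) ^+ 2) => u v w w0 v0 u0.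
  have : 0 <= u * w by rewrite mulr_ge0.
  lra.
have [K K0 hK] := symbols_coercive beta_gt0.
have b2 : l2 b.
  apply: (wl2_sum K0 _ pb2 mb2) => k; rewrite sqr_normcM normc_imag sqrrN !mul1r.
  rewrite -mulrDl mulrA -[leLHS]mul1r; apply: ler_wpM2r (sqr_normc_ge0 _) _ _ _.
  exact: hK.
have [h _ hE] := riesz_fischer a2; have [u _ uE] := riesz_fischer b2.
have mx s k : mode s (h, u) k = xs s k by rewrite /mode /= hE uE ab.
have xH : hspace H (h, u).
  apply/(hspaceP beta_gt0) => /=; split.
    by rewrite (funext hE).
  by rewrite (funext uE).
have [xD xE] : dom A (h, u) /\ app A (h, u) = l *: (h, u) - y.
  apply: (dom_regularity beta_gt0) => //.
    by apply: hspaceB => //; rewrite -[_ *: _]addr0; apply: hspace_lin => //;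
      rewrite -(subrr y); exact: hspaceB.
  move=> s k; rewrite modeB// -[l *: _]addr0 mode_lin mode0 addr0 !mx.
  have -> : mode s y k = (l - eigval s k) * xs s k by rewrite mulrC divfK.
  by ring.
by exists (h, u) => //; rewrite shiftE xE opprB addrC subrK.
Qed.

Lemma spectrum_itau : spectrum H A = [set l | exists k, l = itau k].
Proof.
apply/seteqP; split=> l /=.
  move=> nres; apply: contrapT => hl; apply: nres.
  have [d d0 hd] := tau_gap beta_gt0 l.
  have {}hd k : d <= normc (l - itau k).
    by case: (hd k) => // e; exfalso; apply: hl; exists k.
  have l0 s k : l - eigval s k != 0.
    apply/eqP => e; have := hd (if s then - k else k); rewrite [l - _]e.
    by rewrite ComplexField.Normc.normc0 leNgt d0.
  split.
  - by move=> x xD; exact: hspace_shift.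
  - move=> y yH; have [x xD xE] := shift_surjective yH d0 hd.
    exists x; split=> // x' [x'D x'E]; apply: (mode_inj beta_gt0) => s k.
    by apply: (mulfI (l0 s k)); rewrite -!mode_shift// xE x'E.
  - by exists d^-1 => x xD; exact: resolvent_bound.
move=> [n ->] [_ hex _]; have [x [x0 xD xE]] := eigenvalue_itau n.
have h0 : hspace H 0.
  by rewrite -(subrr x); apply: hspaceB; exact: dom_hspace.
have [w [_ hw]] := hex 0 h0.
have wx : w = x.
  by apply: hw; split=> //; rewrite shiftE xE subrr.
have w0 : w = 0.
  apply: hw; split; first by rewrite -(subrr x); exact: domB.
  by apply: (mode_inj beta_gt0) => s k; rewrite mode_shift ?mode0 ?mulr0// -(subrr x); exact: domB.
by move: x0; rewrite -wx w0 eqxx.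
Qed.

Lemma itau_isolating_nbhs (z : R[i]) : exists2 U : set R[i]^o,
  nbhs (z : R[i]^o) U & forall k, U (itau k) -> itau k = z.
Proof.
have [d d0 hd] := tau_gap beta_gt0 z.
exists (ball (z : R[i]^o) d%:C).
  by apply: nbhsx_ballx; rewrite ltcR.
move=> k; rewrite -ball_normE /= => h.
case: (hd k) => // dz; move: h.
have -> : `|z - itau k| = (normc (z - itau k))%:C by [].
by rewrite ltcR ltNge dz.
Qed.

Lemma isolated_spectrum l : spectrum H A l -> isolated (spectrum H A : set R[i]^o) l.
Proof.
move=> sl; split; first exact/mem_set.
have [U Ul hU] := itau_isolating_nbhs l.
exists U => //; apply/seteqP; split=> [w [Uw]|w ->].
  by rewrite spectrum_itau => -[k wk]; move: Uw; rewrite wk => /hU.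
by split=> //; exact: (nbhs_singleton Ul).
Qed.

Lemma limit_point_spectrum : limit_point (spectrum H A : set R[i]^o) = set0.
Proof.
apply/seteqP; split=> // z hz; have [U Uz hU] := itau_isolating_nbhs z.
have [w [wz sw Uw]] := hz U Uz; move: sw; rewrite spectrum_itau => -[k wk].
by move: Uw wz; rewrite wk => /hU ->; rewrite eqxx.
Qed.

(** Truncating the Fourier series leaves the tail of a convergent series as energy. *)
Lemma densely_defined_A : densely_defined H A.
Proof.
split=> [x|x xH e e0]; first exact: dom_hspace.
have tp := @twopi_gt0 R.
pose E N := \sum_(k <- irange N) energy x k.
have en0 k := energy_ge0 beta_gt0 x k.
have ndE : nondecreasing_seq E by move=> n n' nn'; exact: irange_le.
have bE n : E n <= hnorm H x ^+ 2 / (2 * pi).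
  by rewrite ler_pdivlMr// mulrC; exact: energy_sum_le_hnorm.
(* The strict inequality is obtained with room to spare by aiming at e / 2. *)
pose B := e / 2; have B0 : 0 < B by rewrite divr_gt0.
have [N hN] := nondecreasing_tail ndE bE (divr_gt0 (exprn_gt0 2 B0) tp).
pose y : V := (embed (trig N (fcoef x.1)), embed (trig N (fcoef x.2))).
have yc k : fcoef y.1 k = (if (`|k| <= N)%N then fcoef x.1 k else 0) /\
    fcoef y.2 k = (if (`|k| <= N)%N then fcoef x.2 k else 0).
  by split; rewrite /= fcoef_trig.
have yD : dom A y.
  by apply: (dom_finite (N := N)) => k kN; have [e1 e2] := yc k; rewrite ?e1 ?e2 leqNgt kN.
exists y => //; apply: (@le_lt_trans _ _ B); last first.
  by rewrite ltr_pdivrMr// ltr_pMr// ltr1n.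
have xyE k : energy (x - y) k = if (`|k| <= N)%N then 0 else energy x k.
  rewrite /energy [fcoef (x - y).1 k]fcoefD [fcoef (x - y).2 k]fcoefD !fcoefN.
  have [-> ->] := yc k; case: ifP => _; last by rewrite !subr0.
  by rewrite !subrr ComplexField.Normc.normc0 expr0n mulr0 addr0.
apply: (hnorm_le beta_gt0); rewrite ?(ltW B0)//.
  by apply: hspaceB => //; exact: dom_hspace.
move=> N'; rewrite mulrC -ler_pdivlMr//.
have xy0 k : 0 <= energy (x - y) k by exact: energy_ge0.
apply: (@le_trans _ _ (\sum_(k <- irange (N + N')) energy (x - y) k)).
  by apply: irange_le => //; exact: leq_addl.
under eq_bigr do rewrite xyE.
by rewrite irangeB ?leq_addr//; apply: hN; exact: leq_addr.
Qed.

(** The relation between the modes of x and y passes to the limit mode by mode. *)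
Lemma closed_A : closed_op H A.
Proof.
move=> u x y uD xH yH ux Auy; apply: (dom_regularity beta_gt0) => // s k.
apply/eqP; rewrite -subr_eq0; apply/eqP/ComplexField.Normc.eq0_normc.
set g := _ - _; apply/eqP; rewrite eq_le normc_ge0 andbT.
pose h n := hnorm H (app A (u n) - y) + normc (eigval s k) * hnorm H (u n - x).
have h0 : h n @[n --> \oo] --> (0 : R).
  rewrite -[0 in X in _ --> X]addr0 -[X in _ + X](mulr0 (normc (eigval s k))).
  by apply: cvgD => //; apply: cvgM => //; exact: cvg_cst.
rewrite -[leRHS](cvg_lim (@Rhausdorff R) h0); apply: limr_ge; first exact: cvgP h0.
apply: nearW => n.
have uH : hspace H (u n) by exact: dom_hspace.
have -> : g = eigval s k * mode s (u n - x) k - mode s (app A (u n) - y) k.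
  by rewrite !modeB// mode_A// /g; ring.
apply: le_trans (le_normcD _ _) _; rewrite normcN addrC ComplexField.Normc.normcM.
apply: lerD; first by apply: normc_mode_le => //; apply: hspaceB => //; exact: hspace_A.
apply: ler_wpM2l; first exact: normc_ge0.
by apply: normc_mode_le => //; exact: hspaceB.
Qed.

Lemma zsum_delta (a : int -> R[i]) j : (forall k, k != j -> a k = 0) -> zsum a = a j.
Proof.
move=> a0; apply: limn_complex; apply: cvg_near_cst.
by exists `|j|%N => // N jN; rewrite irangeE (irange_delta a0).
Qed.

(** If y is in the domain, the two sums in the inner product are exchanged term
    by term.  Conversely, exponentials in either component read off the
    coefficients of z, and dom_regularity applies. *)
Lemma graph_adj_A y z : graph_adj H A y z <-> dom A y /\ z = - app A y.
Proof.
split=> [[yH zH hyz]|[yD ->]]; last first.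
  split; first exact: dom_hspace.
    rewrite -sub0r; apply: hspaceB; last exact: hspace_A.
    by rewrite -(subrr (app A y)); apply: hspaceB; exact: hspace_A.
  (* The first series on one side is the second on the other. *)
  move=> x xD; rewrite /= addrC; congr (_ + _); congr (_ * zsum _); apply/funext => k.
    have [_ e] := fcoef_A beta_gt0 k xD; rewrite [fcoef _ k in LHS]e.
    have [e' _] := fcoef_A beta_gt0 k yD.
    rewrite [fcoef (- _) k]fcoefN [fcoef (T_op _ _) k]e' m_symbolE//.
    case: (fcoef x.1 k) (fcoef y.2 k) => a b [c d].
    by apply: eq_cplx; rewrite !(Re_cmul, Im_cmul) /=; ring.
  have [e _] := fcoef_A beta_gt0 k xD; rewrite [fcoef (T_op _ _) k]e.
  have [_ e'] := fcoef_A beta_gt0 k yD.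
  rewrite [fcoef (- - _) k]fcoefN [fcoef (- ddx y.1) k]e' m_symbolE//.
  case: (fcoef x.2 k) (fcoef y.1 k) => a b [c d].
  by apply: eq_cplx; rewrite !(Re_cmul, Im_cmul) /=; ring.
have tp : (2 * pi)%:C != 0 :> R[i].
  by rewrite eq_complex /= eqxx andbT gt_eqF// twopi_gt0.
have delta k j : fcoef (embed (expi j : testfun R)) k = (k == j)%:R.
  by rewrite fcoef_embed_expi; case: eqP.
have testD (b : bool) j : dom A (if b then (embed (expi j), 0) else (0, embed (expi j)) : V).
  apply: (dom_finite (N := `|j|%N)) => k kj; case: b; rewrite /= ?fcoef0//;
  by rewrite delta; case: eqP => // kj'; rewrite kj' ltnn in kj.
have z1 j : fcoef z.1 j = Complex 0 (m j) * fcoef y.2 j.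
  have := hyz _ (testD true j).
  have eA := fun k => fcoef_A beta_gt0 k (testD true j).
  rewrite /= in eA *.
  rewrite (zsum_delta (j := j)) => [|k kj]; last first.
    by have [e _] := eA k; rewrite [fcoef (T_op _ _) k]e fcoef0 mulr0 mul0r.
  rewrite (zsum_delta (j := j)) => [|k kj]; last first.
    by have [_ e] := eA k; rewrite [fcoef (- _) k]e delta (negbTE kj) mulr0 oppr0 mulr0 mul0r.
  rewrite (zsum_delta (j := j)) => [|k kj]; last by rewrite delta (negbTE kj) mul0r.
  rewrite (zsum_delta (j := j)) => [|k kj]; last by rewrite fcoef0 mulr0 mul0r.
  have [e e'] := eA j; rewrite [fcoef (T_op _ _) j]e [fcoef (- _) j]e' fcoef0 delta eqxx.
  rewrite !(mulr0, mul0r, addr0, add0r) mulr1 mul1r => /(mulfI tp) h.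
  rewrite -[fcoef z.1 j]conjcK -h m_symbolE//; case: (fcoef y.2 j) => a b.
  by apply: eq_cplx => /=; ring.
have z2 j : fcoef z.2 j = Complex 0 j%:~R * fcoef y.1 j.
  have := hyz _ (testD false j).
  have eA := fun k => fcoef_A beta_gt0 k (testD false j).
  rewrite /= in eA *.
  rewrite (zsum_delta (j := j)) => [|k kj]; last first.
    by have [e _] := eA k; rewrite [fcoef (T_op _ _) k]e delta (negbTE kj) mulr0 mul0r.
  rewrite (zsum_delta (j := j)) => [|k kj]; last first.
    by have [_ e] := eA k; rewrite [fcoef (- _) k]e fcoef0 mulr0 oppr0 mulr0 mul0r.
  rewrite (zsum_delta (j := j)) => [|k kj]; last by rewrite fcoef0 mul0r.
  rewrite (zsum_delta (j := j)) => [|k kj]; last by rewrite delta (negbTE kj) mulr0 mul0r.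
  have [e e'] := eA j; rewrite [fcoef (T_op _ _) j]e [fcoef (- _) j]e' fcoef0 delta eqxx.
  rewrite !(mulr0, mul0r, addr0, add0r, oppr0) !mulr1 => /(mulfI tp) h.
  have p0 : (p j)%:C != 0 :> R[i].
    by rewrite eq_complex /= eqxx andbT gt_eqF// p_symbol_gt0.
  apply: (mulfI p0); rewrite -[fcoef z.2 j]conjcK; move: h; rewrite m_symbolE//.
  case: (fcoef y.1 j) (fcoef z.2 j) => a b [c d] /= [h1 h2].
  by apply: eq_cplx => /=; lra.
have [yD yE] : dom A y /\ app A y = - z.
  apply: (dom_regularity beta_gt0) => //.
    by rewrite -sub0r; apply: hspaceB => //; rewrite -(subrr y); exact: hspaceB.
  move=> s k; rewrite -sub0r modeB// mode0 sub0r /mode z1 z2 /eigval m_symbolE//.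
  case: s; rewrite ?tauN// /tau; move: (sqr_sqrt_p beta_gt0 k); move: (Num.sqrt (p k)) => q <-;
    case: (fcoef y.1 k) (fcoef y.2 k) => a b [c d];
    by apply: eq_cplx; rewrite !(Re_caddE, Im_caddE, Re_coppE, Im_coppE, Re_cmul, Im_cmul) /=; ring.
by rewrite yE opprK.
Qed.

Lemma domN x : dom A x -> dom A (- x).
Proof. by move=> xD; rewrite -sub0r; apply: domB => //; rewrite -(subrr x); exact: domB. Qed.

Lemma A_opp x : dom A x -> app A (- x) = - app A x.
Proof.
move=> xD; apply: (mode_inj beta_gt0) => s k.
rewrite (mode_A beta_gt0 s k (domN xD)) (modeN s x k).
by rewrite [RHS](modeN s (app A x) k) (mode_A beta_gt0 s k xD) mulrN.
Qed.

Lemma normal_A : normal_op H A.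
Proof.
split; [exact: densely_defined_A|exact: closed_A|move=> x z; split].
- move=> [y [xD <-] /graph_adj_A[AxD ->]]; exists (- app A x).
    exact/graph_adj_A.
  by split; [exact: domN|rewrite A_opp].
- move=> [y /graph_adj_A[xD ->] [NAxD <-]]; exists (app A x) => //.
  have AxD : dom A (app A x) by rewrite -[app A x]opprK; exact: domN.
  by apply/graph_adj_A; split=> //; rewrite A_opp.
Qed.

End conservative_spectrum.

(** * Frequencies indexed by the natural numbers *)

Section statement_bridge.
Context {R : realType}.
Variables (beta : R) (beta_gt0 : 0 < beta).
Notation p := (p_symbol beta).
Notation H := (energy_space beta).
Notation A := (conservative_op beta).

Lemma opp_itau k : - Complex 0 (tau beta k) = Complex 0 (tau beta (- k)) :> R[i].
Proof. by rewrite tauN//; apply: eq_cplx => /=; rewrite ?oppr0. Qed.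

Lemma itau0 : Complex 0 (tau beta 0) = 0 :> R[i].
Proof. by rewrite tau0. Qed.

Lemma div_omega (n : nat) : (0 < n)%N -> n%:R / omega beta n = (Num.sqrt (p n))^-1.
Proof.
move=> n0; rewrite -tau_omega// /tau -pmulrn invfM mulrA divff ?mul1r//.
by rewrite pnatr_eq0 -lt0n.
Qed.

Lemma spectrum_omega : [set l : R[i] | exists k, l = Complex 0 (tau beta k)] =
  [set 0] `|` [set l | exists n : nat, (0 < n)%N /\
    (l = Complex 0 (omega beta n) \/ l = - Complex 0 (omega beta n))].
Proof.
apply/seteqP; split=> l /= [].
  move=> k ->; case: k => [[|n]|n].
  - by left; rewrite itau0.
  - by right; exists n.+1; split=> //; left; rewrite tau_omega.
  - right; exists n.+1; split=> //; right.
    by rewrite -tau_omega// opp_itau NegzE.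
- by move=> ->; exists 0; rewrite itau0.
- move=> [n [_ [->|->]]]; first by exists n%:Z; rewrite tau_omega.
  by exists (- n%:Z); rewrite -tau_omega// opp_itau.
Qed.

Lemma ker_conservative_op : ker_op A =
  [set x | exists a b : R[i],
    x = a *: (embed (expi 0), 0) + b *: (0, embed (expi 0)) :> pdistr R * pdistr R].
Proof.
have -> : ker_op A = ker_op (shift_op (Complex 0 (tau beta 0)) A).
  rewrite itau0; apply/seteqP; split=> x [xD e]; split=> //.
    by rewrite shiftE e scale0r subr0.
  by move: e; rewrite shiftE scale0r sub0r => /eqP; rewrite oppr_eq0 => /eqP.
have p0 : p 0 = 1 by rewrite /p_symbol eqxx.
have E (c c' : R[i]) : eigvec beta 0 c c' =
    (c + c') *: (embed (expi 0), 0) + (c' - c) *: (0, embed (expi 0)).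
  rewrite /eigvec p0 sqrtr1 invr1 oppr0; congr (_, _); apply: fcoef_inj => k /=.
    rewrite fcoefD !fcoefZ fcoef0 mulr0 addr0 fcoef_embedD !fcoef_embedZ; ring.
  by rewrite fcoefD !fcoefZ fcoef0 mulr0 add0r -scalerBl scalerA !fcoef_embedZ; ring.
rewrite ker_itau//; apply/seteqP; split=> _ /= [c [c' ->]].
  by exists (c + c'), (c' - c); rewrite E.
exists ((c - c') / 2), ((c + c') / 2); rewrite E.
by congr (_ *: _ + _ *: _); field.
Qed.

End statement_bridge.

Theorem theorem3p3 (R : realType) (beta : R) (beta_gt0 : 0 < beta) :
  let H := energy_space beta in
  let A := conservative_op beta in
  let iomega (n : nat) : R[i] := Complex 0 (omega beta n) in
  let one : pdistr R := embed (expi 0) in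
  [/\ purely_discrete H A,
      spectrum H A =
        [set 0] `|` [set l | exists n : nat,
          (0 < n)%N /\ (l = iomega n \/ l = - iomega n)],
      ker_op A =
        [set x | exists a b : R[i], x = a *: (one, 0) + b *: (0, one)]
    & forall n : nat, (0 < n)%N ->
      let r : R[i] := (n%:R / omega beta n)%:C in
      let e := expi n%:Z in
      let e' := expi (- n%:Z) in
      ker_op (shift_op (iomega n) A) =
        [set x | exists c c' : R[i],
          x = (embed (c *: e + c' *: e'), embed (- r *: (c *: e - c' *: e')))] /\
      ker_op (shift_op (- iomega n) A) =
        [set x | exists c c' : R[i],
          x = (embed (c *: e + c' *: e'), embed (r *: (c *: e - c' *: e')))]] /\
  [/\ geometric_multiplicity A 0 2,
      forall n : nat, (0 < n)%N ->
        geometric_multiplicity A (iomega n) 2 /\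
        geometric_multiplicity A (- iomega n) 2,
      normal_op H A,
      forall l, spectrum H A l -> forall d,
        algebraic_multiplicity A l d <-> geometric_multiplicity A l d
    & limit_point (spectrum H A : set R[i]^o) = set0].
Proof.
move=> H A iomega one.
have io n : iomega n = Complex 0 (tau beta n%:Z) by rewrite tau_omega.
have nio n : - iomega n = Complex 0 (tau beta (- n%:Z)) by rewrite io opp_itau.
have sp l : spectrum H A l -> exists k, l = Complex 0 (tau beta k).
  by rewrite spectrum_itau.
split; split.
- move=> l sl; have [k lk] := sp l sl; split.
  + exact: isolated_spectrum.
  + by rewrite lk; exact: eigenvalue_itau.
  + exists 2%N; rewrite /algebraic_multiplicity root_space_ker// lk.
    exact: geometric_multiplicity_itau.
- by rewrite spectrum_itau// spectrum_omega.
- exact: ker_conservative_op.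
- move=> n n0 r e e'; have rE : r = (Num.sqrt (p_symbol beta n))^-1%:C.
    by rewrite /r div_omega.
  split; [rewrite io|rewrite nio]; rewrite ker_itau//.
    by apply/seteqP; split=> _ /= [c [c' ->]]; exists c, c'; rewrite /eigvec -rE.
  apply/seteqP; split=> _ /= [c [c' ->]]; exists c', c;
    rewrite /eigvec p_symbolN// -rE opprK; congr (embed _, embed _).
  + by rewrite addrC.
  + by rewrite scaleNr -scalerN opprB.
  + by rewrite addrC.
  + by rewrite scaleNr -scalerN opprB.
- by rewrite -(itau0 beta); exact: geometric_multiplicity_itau.
- by move=> n _; rewrite nio io; split; exact: geometric_multiplicity_itau.
- exact: normal_A.
- move=> l _ d; rewrite /algebraic_multiplicity root_space_ker//.
- exact: limit_point_spectrum.
Qed.
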